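(* Suppose the Wonham filter is stable, meaning: for all $\mu,\nu\in\mathcal P(\mathbb S)$ with $\mu\ll\nu$ and every $f\in\mathbb R^d$, $$\mathsf E^\mu\big(|\pi_t^\mu(f)-\pi_t^\nu(f)|^2\big)\to 0\quad\text{as } t\to\infty.$$ Then the BSDE $$-\mathrm dY_t(x)=\big((AY_t)(x)+h(x)U_t+h(x)V_t(x)\big)\mathrm dt-V_t(x)\,\mathrm dZ_t,\qquad Y_T=f,$$ is stabilizable. Conversely, if this BSDE is stabilizable, then for all $\mu,\nu\in\mathcal P(\mathbb S)$ with $\mu\ll\nu$ and every $k=1,\dots,m$, $$\pi_T^\nu(\mathsf 1_{\mathbb S_k})\longrightarrow \mathsf 1_{\mathbb S_k}(X_0)\quad \text{as }T\to\infty,\quad \mathsf P^\mu\text{-a.s.}$$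
   Context: Let $\mathbb S=\{1,\dots,d\}$. Functions $f:\mathbb S\to\mathbb R$ are identified with vectors in $\mathbb R^d$. $\mathsf 1$ denotes the all-ones vector and $\mathsf 1_D$ the indicator of $D\subset\mathbb S$. For $f,g\in\mathbb R^d$, $fg$ denotes the entrywise product. $\mathcal P(\mathbb S)$ denotes the set of probability vectors on $\mathbb S$, and for $\mu\in\mathcal P(\mathbb S)$ we write $\mu(f)=\sum_x\mu(x)f(x)$. $X=\{X_t\}_{t\ge0}$ is a continuous-time Markov chain on $\mathbb S$ with rate matrix $A\in\mathbb R^{d\times d}$: off-diagonal entries are nonnegative, rows sum to zero, and $(Af)(x)=\sum_jA(x,j)f(j)$. The set $\mathbb S$ is partitioned into ergodic classes, $\mathbb S=\bigcup_{k=1}^m\mathbb S_k$, where each $\mathbb S_k$ is a closed irreducible class; in particular $\mathsf P(X_t\in\mathbb S_l\mid X_0\in\mathbb S_k)=0$ for $l\ne k$. The observation process is $Z_t=\int_0^th(X_s)\,\mathrm ds+W_t$, where $h\in\mathbb R^d$ and $W$ is a scalar Brownian motion with variance $R>0$, independent of $X$. Let $\mathcal Z_t=\sigma(Z_s:s\le t)$. $\mathsf P^\mu$ (with expectation $\mathsf E^\mu$) denotes the law under which $X_0\sim\mu$. When $\mu\ll\nu$, $\mathsf P^\mu$ and $\mathsf P^\nu$ live on a common space with $\mathrm d\mathsf P^\mu/\mathrm d\mathsf P^\nu=\mu(X_0)/\nu(X_0)$, so $(X,Z)$ has the same transition law under both. Define $\pi_t^\nu(f):=\mathsf E^\nu(f(X_t)\mid\mathcal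 Z_t)$; equivalently, $\pi^\nu$ solves the Wonham filter $$\mathrm d\pi_t=A^\top\pi_t\,\mathrm dt+(\mathrm{diag}(h)-\pi_th^\top)\pi_tR^{-1}(\mathrm dZ_t-\pi_t(h)\,\mathrm dt),\qquad \pi_0=\nu.$$ Admissible controls $U$ are real-valued $\mathcal Z$-adapted processes on $[0,T]$ with $\mathsf E\int_0^TU_t^2\,\mathrm dt<\infty$. The solution $(Y,V)$ of the BSDE is $\mathcal Z$-adapted, square-integrable, and $\mathbb R^d\times\mathbb R^d$-valued. The controllable subspace $\mathcal C$ is the set of $y_0\in\mathbb R^d$ for which there exist a deterministic $c\in\mathbb R$ and an admissible $U$ such that the BSDE solution with $Y_T=c\mathsf 1$ satisfies $Y_0=y_0$. Equivalently (by a known result, for every $T>0$), $\mathcal C$ is the smallest subspace of $\mathbb R^d$ containing $\mathsf 1$ and closed under the maps $g\mapsto Ag$ and $g\mapsto gh$. Since $\mathcal C$ is $A$-invariant, $A$ induces a linear map $\bar A_{uc}$ on the quotient $\mathbb R^d/\mathcal C$; in an orthonormal basis adapted to $\mathcal C\oplus\mathcal C^\perp$, $A$ is block upper triangular and $\bar A_{uc}$ is its lower-right block. The BSDE is stabilizable if either $\mathcal C=\mathbb R^d$, or $\mathcal C\ne\mathbb R^d$ and $\bar A_{uc}$ is Hurwitz (all eigenvalues have negative real part). *)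

(* Defs.v *)
From HB Require Import structures.
From mathcomp Require Import all_boot all_order all_algebra.
From mathcomp Require Import all_classical all_reals all_analysis.
From mathcomp Require Import complex.

Set Implicit Arguments.
Unset Strict Implicit.
Unset Printing Implicit Defensive.

Import Order.TTheory GRing.Theory Num.Theory.
Import numFieldNormedType.Exports.

Local Open Scope classical_set_scope.
Local Open Scope ring_scope.

(* The state space S = {1,..,d} is 'I_d; functions S -> R are 'I_d -> R. *)

Section Linear_algebra.
Context {R : realType} {d : nat}.

Definition rate_matrix (A : 'M[R]_d) : Prop :=
  (forall i j : 'I_d, i != j -> 0 <= A i j) /\ (forall i : 'I_d, \sum_j A i j = 0).

Definition prob_vec (mu : 'I_d -> R) : Prop :=
  (forall x, 0 <= mu x) /\ \sum_x mu x = 1.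

Definition abs_cont (mu nu : 'I_d -> R) : Prop := forall x, nu x = 0 -> mu x = 0.

Definition ind_set (D : {set 'I_d}) (x : 'I_d) : R := (x \in D)%:R.

Definition closed_class (A : 'M[R]_d) (D : {set 'I_d}) : Prop :=
  forall x y, x \in D -> y \notin D -> A x y = 0.

Definition irreducible_class (A : 'M[R]_d) (D : {set 'I_d}) : Prop :=
  forall x y, x \in D -> y \in D ->
    connect [rel u v | [&& u \in D, v \in D & 0 < A u v]] x y.

Definition expmx (M : 'M[R]_d) (i j : 'I_d) : R :=
  limn (series (fun k : nat => (M ^+ k) i j / (k`!)%:R)).

(** Functions g in R^d are represented by row vectors 'rV_d; subspaces of R^d
    by (row spaces of) matrices.  g |-> A g  is  g |-> g *m A^T  and
    g |-> g h (entrywise product) is g |-> g *m diag_mx h. *)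
Definition closed_ctrb (A : 'M[R]_d) (h : 'rV[R]_d) (V : 'M[R]_d) : bool :=
  [&& ((const_mx 1 : 'rV[R]_d) <= V)%MS, (V *m A^T <= V)%MS & (V *m diag_mx h <= V)%MS].

Definition is_ctrb_space (A : 'M[R]_d) (h : 'rV[R]_d) (V : 'M[R]_d) : Prop :=
  closed_ctrb A h V /\ (forall W : 'M[R]_d, closed_ctrb A h W -> (V <= W)%MS).

(** lambda (complex) is an eigenvalue of the linear map induced by A on the
    (complexified) quotient R^d / V : there is a class [v] <> 0 in C^d / V_C
    with A v = lambda v modulo V_C *)
Definition quot_eigenvalue (A : 'M[R]_d) (V : 'M[R]_d) (lam : R[i]) : Prop :=
  exists v : 'rV[R[i]]_d,
    ~~ (v <= map_mx (fun x : R => (x%:C)%C) V)%MS /\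
    (v *m map_mx (fun x : R => (x%:C)%C) A^T - lam *: v <= map_mx (fun x : R => (x%:C)%C) V)%MS.

Definition quot_hurwitz (A : 'M[R]_d) (V : 'M[R]_d) : Prop :=
  forall lam : R[i], quot_eigenvalue A V lam -> complex.Re lam < 0.

(** stabilizability of the BSDE (algebraic form of the definition) *)
Definition stabilizable (A : 'M[R]_d) (h : 'I_d -> R) : Prop :=
  exists V : 'M[R]_d, is_ctrb_space A (\row_i h i) V /\
    ((V == 1%:M)%MS \/ (~~ (V == 1%:M)%MS /\ quot_hurwitz A V)).

End Linear_algebra.

Section Model.
Context {R : realType} {d : nat} {dis : measure_display} {Omega : measurableType dis}.

(** The probability space (Omega, P) carries X (a continuous-time Markov chain
    on 'I_d with rate matrix A, initial law rho, right-continuous paths) and W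
    (a Brownian motion with variance Rv, continuous paths, W_0 = 0), X and W
    independent.  This is expressed by the joint finite-dimensional laws on
    every time grid 0 = t_0 < t_1 < ... < t_n :
      P(X_{t_i} = x_i (i <= n), W_{t_{i+1}} - W_{t_i} \in B_i (i < n))
        = rho(x_0) prod_i exp((t_{i+1}-t_i) A)(x_i,x_{i+1})
                   * prod_i N(0, Rv (t_{i+1} - t_i))(B_i). *)
Definition wonham_model (P : probability Omega R) (A : 'M[R]_d) (Rv : R)
    (rho : 'I_d -> R) (X : R -> Omega -> 'I_d) (W : R -> Omega -> R) : Prop :=
  [/\ (forall t x, measurable [set w | X t w = x]),
      (forall t, measurable_fun setT (W t)) /\ (forall w, W 0 w = 0),
      (forall w, {within [set t : R | 0 <= t], continuous (fun t => W t w)}),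
      (forall w t, 0 <= t ->
         exists2 e : R, 0 < e & forall s, t <= s < t + e -> X s w = X t w) &
      (forall (n : nat) (tt : nat -> R) (x : nat -> 'I_d) (B : nat -> set R),
         tt 0%N = 0 -> (forall i, (i < n)%N -> tt i < tt i.+1) ->
         (forall i, measurable (B i)) ->
         P [set w | (forall i, (i <= n)%N -> X (tt i) w = x i) /\
                    (forall i, (i < n)%N -> B i (W (tt i.+1) w - W (tt i) w))]
         = ((rho (x 0%N) *
              \prod_(i < n) expmx ((tt i.+1 - tt i) *: A) (x i) (x i.+1))%:E *
            \prod_(i < n)
              normal_prob 0 (Num.sqrt (Rv * (tt i.+1 - tt i))) (B i))%E)].

Definition obs (h : 'I_d -> R) (X : R -> Omega -> 'I_d) (W : R -> Omega -> R)
    (t : R) (w : Omega) : R :=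
  (\int[lebesgue_measure]_(s in [set s : R | 0 <= s <= t]) h (X s w))%R + W t w.

Definition obs_sigma (Z : R -> Omega -> R) (t : R) : set (set Omega) :=
  <<s [set E | exists s (B : set R), [/\ 0 <= s <= t, measurable B &
                                         E = Z s @^-1` B]] >>.

Definition measurable_wrt (G : set (set Omega)) (g : Omega -> R) : Prop :=
  forall B : set R, measurable B -> G (g @^-1` B).

(** density dP^nu / dP = nu(X_0) / rho(X_0) *)
Definition dens (rho nu : 'I_d -> R) (X : R -> Omega -> 'I_d) (w : Omega) : R :=
  nu (X 0 w) / rho (X 0 w).

(** g is a version of E^nu(F | G), where P^nu has density wt w.r.t. P *)
Definition cexp_version (P : probability Omega R) (wt : Omega -> R)
    (G : set (set Omega)) (F g : Omega -> R) : Prop :=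
  [/\ measurable_wrt G g,
      P.-integrable setT (fun w => (wt w * g w)%:E) &
      forall E, G E ->
        (\int[P]_(w in E) (wt w * g w)%:E = \int[P]_(w in E) (wt w * F w)%:E)%E].

(** pi nu t f = pi_t^nu(f) = E^nu(f(X_t) | Z_t), taken as the (path-continuous)
    Wonham-filter version *)
Definition is_wonham_filter (P : probability Omega R) (rho : 'I_d -> R)
    (X : R -> Omega -> 'I_d) (Z : R -> Omega -> R)
    (pi : ('I_d -> R) -> R -> ('I_d -> R) -> Omega -> R) : Prop :=
  forall nu, prob_vec nu -> forall f : 'I_d -> R,
    (forall t, 0 <= t ->
       cexp_version P (dens rho nu X) (obs_sigma Z t) (fun w => f (X t w))
                    (pi nu t f)) /\
    (forall w, {within [set t : R | 0 <= t], continuous (fun t => pi nu t f w)}).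

Definition filter_stable (P : probability Omega R) (rho : 'I_d -> R)
    (X : R -> Omega -> 'I_d)
    (pi : ('I_d -> R) -> R -> ('I_d -> R) -> Omega -> R) : Prop :=
  forall mu nu, prob_vec mu -> prob_vec nu -> abs_cont mu nu ->
  forall f : 'I_d -> R,
    (\int[P]_w (dens rho mu X w * (pi mu t f w - pi nu t f w) ^+ 2)%:E)%E
      @[t --> +oo] --> 0%E.

(** P^mu-almost surely (P^mu has density dens rho mu X w.r.t. P, which vanishes
    exactly where mu(X_0) = 0) *)
Definition ae_under (P : probability Omega R) (rho mu : 'I_d -> R)
    (X : R -> Omega -> 'I_d) (Q : Omega -> Prop) : Prop :=
  {ae P, forall w, 0 < dens rho mu X w -> Q w}.

End Model.

(* Main.v *)
(** Stability implies stabilizability.  If the quotient map had an eigenvalue in the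
    closed right half-plane, a Gershgorin argument would force it to be 0, and there
    would be a signed measure w <> 0, invariant under the chain and orthogonal to the
    controllable space.  Its normalised positive and negative parts mu, nu live on
    disjoint closed sets but induce the same law of the observations, since every
    discretised observation event pairs w with elements of the controllable space.
    The filter started at (mu + nu)/2 then assigns probability 1/2 to the first set
    forever, whereas the filter started at mu assigns it probability 1.

    Stabilizability implies detection of the class.  The functions f for which f(X_t)
    is the conditional mean, given the past, of a bounded statistic of later
    observation increments form a subspace that contains 1 and is closed under
    f |-> A f and f |-> h f; the last two come from differentiating at s = 0 the
    probabilities of {X_s = y} and of {X_s = y, Z_s > 0}.  So this subspace contains
    the controllable space, which contains the indicator of each class D: A annihilates
    it, and 0 is not an eigenvalue on the quotient.  Averaging the statistic over disjoint time windows identifies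
    {X_0 in D} up to small probability from finitely many observations (Chebyshev),
    and Doob's maximal inequality upgrades this to almost sure convergence of the
    martingale pi_t(1_D). *)
Require Import Defs.
From HB Require Import structures.
From mathcomp Require Import all_boot all_order all_algebra.
From mathcomp Require Import all_classical all_reals all_analysis.
From mathcomp Require Import complex measurable_realfun zify ring lra.
Import Order.TTheory GRing.Theory Num.Theory.
Import numFieldNormedType.Exports.
Local Open Scope classical_set_scope.
Local Open Scope ring_scope.

Set Implicit Arguments.
Unset Strict Implicit.
Unset Printing Implicit Defensive.

(** * Finite combinations of probabilities, sub-sigma-algebras *)

(** The model is given only by its laws on finite grids, while the observation integrates [h] along
    a path. Facts about Z are therefore proved for cylinders and Riemann sums and transported as
    linear identities: a vanishing combination of probabilities of [E] intersected with fixed events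
    survives pi-lambda arguments and limits, so no conditional law of the chain has to be
    constructed. Positivity of an observation increment reveals [h] by scaling: over a step of
    length s the drift [s * h x] moves a threshold inside a Gaussian of width of order sqrt(s), an
    effect of order sqrt(s), whereas a jump during the step has probability O(s). Positivity passes
    to the limit of Riemann sums because the increment has no atom at 0. For unobservability the
    cylinders may restrict the state only to level sets of [h]: multiplying by their indicators
    preserves the controllable space, which fails for general sets of states. A change of initial
    law is a weight depending on [X 0] alone, so every weighted probability is a finite combination
    of probabilities under [P]. *)

Section FiniteMeasure.
Context {R : realType} {dis : measure_display} {Omega : measurableType dis}
  (P : probability Omega R).

(** Real-valued, so that signed combinations can be formed and the arithmetic tactics apply. *)
Definition Pr (E : set Omega) : R := fine (P E).

Lemma PrE E : measurable E -> P E = (Pr E)%:E.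
Proof. by move=> mE; rewrite /Pr fineK// fin_num_measure. Qed.

Lemma Pr0 : Pr set0 = 0.
Proof. by rewrite /Pr measure0. Qed.

Lemma PrT : Pr setT = 1.
Proof. by rewrite /Pr probability_setT. Qed.

Lemma Pr_ge0 E : 0 <= Pr E.
Proof. by rewrite /Pr fine_ge0. Qed.

Lemma le_Pr (A B : set Omega) : measurable A -> measurable B -> A `<=` B ->
  Pr A <= Pr B.
Proof.
move=> mA mB AB; rewrite -lee_fin -!PrE//.
by apply: le_measure => //; rewrite inE.
Qed.

Lemma PrU (A B : set Omega) : measurable A -> measurable B -> A `&` B = set0 ->
  Pr (A `|` B) = Pr A + Pr B.
Proof.
move=> mA mB AB; apply: EFin_inj; rewrite EFinD -!PrE//; last exact: measurableU.
by rewrite measureU.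
Qed.

Lemma PrD (A B : set Omega) : measurable A -> measurable B -> B `<=` A ->
  Pr (A `\` B) = Pr A - Pr B.
Proof.
move=> mA mB BA; have mD := measurableD mA mB.
apply/eqP; rewrite eq_sym subr_eq eq_sym; apply/eqP.
by rewrite -PrU// ?setDKU//; apply/seteqP; split => x //= [[]].
Qed.

Lemma le_PrU (A B : set Omega) : measurable A -> measurable B ->
  Pr (A `|` B) <= Pr A + Pr B.
Proof.
move=> mA mB; rewrite -(setDUK (@subsetUl _ A B)) PrU//.
- rewrite lerD2l; apply: le_Pr => //; first exact: measurableD (measurableU _ _ mA mB) mA.
  by move=> x [[]].
- exact: measurableD (measurableU _ _ mA mB) mA.
- by apply/seteqP; split => x //= [? []].
Qed.

Lemma le_Pr_bigU (n : nat) (F : nat -> set Omega) : (forall i, measurable (F i)) ->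
  Pr [set w | exists2 i, (i < n)%N & F i w] <= \sum_(i < n) Pr (F i).
Proof.
move=> mF; elim: n => [|n ih].
  rewrite big_ord0 (_ : [set _ | _] = set0) ?Pr0//.
  by apply/seteqP; split => w //= -[].
rewrite big_ord_recr/=.
have -> : [set w | exists2 i, (i < n.+1)%N & F i w] =
    [set w | exists2 i, (i < n)%N & F i w] `|` F n.
  apply/seteqP; split => w /=.
    by case=> i; rewrite ltnS leq_eqVlt => /predU1P[-> ?|? ?]; [right|left; exists i].
  by case=> [[i il Fi]|Fn]; [exists i => //; exact: ltnW|exists n].
apply: le_trans (le_PrU _ (mF _)) _; last by rewrite lerD2r.
have -> : [set w | exists2 i, (i < n)%N & F i w] = \big[setU/set0]_(i < n) F i.
  by rewrite -bigcup_mkord; apply/seteqP; split => w /= [i il Fi]; exists i.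
exact: bigsetU_measurable.
Qed.

Lemma Pr_partition_seq (T : eqType) (Y : Omega -> T) (E : set Omega) (s : seq T) :
  measurable E -> (forall y, measurable [set w | Y w = y]) -> uniq s ->
  Pr (E `&` [set w | Y w \in s]) = \sum_(y <- s) Pr (E `&` [set w | Y w = y]) /\
  measurable (E `&` [set w | Y w \in s]).
Proof.
move=> mE mY; elim: s => [_|y s ih /= /andP[ys /ih[{}ih ms]]].
  rewrite big_nil (_ : _ `&` _ = set0) ?Pr0; first by split.
  by apply/seteqP; split => w //= [].
have EE : E `&` [set w | Y w \in y :: s] =
    (E `&` [set w | Y w = y]) `|` (E `&` [set w | Y w \in s]).
  apply/seteqP; split => w /=; rewrite inE.
    by case=> Ew /predU1P[|]; [left|right].
  by case=> -[Ew H]; split => //; rewrite H ?eqxx ?orbT.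
rewrite EE big_cons -ih; split; last by apply: measurableU => //; exact: measurableI.
apply: PrU => //; first exact: measurableI.
by apply/seteqP; split => w //= [[_ yw] [_]]; rewrite yw (negbTE ys).
Qed.

Lemma Pr_partition (T : finType) (Y : Omega -> T) (E : set Omega) :
  measurable E -> (forall y, measurable [set w | Y w = y]) ->
  Pr E = \sum_y Pr (E `&` [set w | Y w = y]).
Proof.
move=> mE mY; have [<- _] := Pr_partition_seq mE mY (index_enum_uniq T).
by congr Pr; apply/seteqP; split => w //= => [Ew|[]//]; rewrite mem_index_enum.
Qed.

Lemma cvg_Pr_nd (F : nat -> set Omega) : (forall i, measurable (F i)) ->
  (forall n m, (n <= m)%N -> F n `<=` F m) ->
  Pr (F n) @[n --> \oo] --> Pr (\bigcup_n F n).
Proof.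
move=> mF ndF; have mU : measurable (\bigcup_n F n) by exact: bigcup_measurable.
apply: (@fine_cvg _ _ _ _ (P \o F)); rewrite -PrE//.
by apply: nondecreasing_cvg_mu => // n m nm; apply/subsetPset/ndF.
Qed.

(** Dominated convergence for indicators. In the application [F n] involves positivity of a Riemann
    approximation, and [N] is the event that the limiting increment vanishes. *)
Lemma cvg_Pr_ae (F : nat -> set Omega) (E N : set Omega) :
  (forall i, measurable (F i)) -> measurable E -> P.-negligible N ->
  (forall w, ~ N w -> \forall n \near \oo, F n w <-> E w) ->
  Pr (F n) @[n --> \oo] --> Pr E.
Proof.
move=> mF mE N0 FE.
apply: (@fine_cvg _ _ _ _ (P \o F)); rewrite -PrE//.
have H := @dominated_convergence _ _ _ P setT measurableT
  (fun n w => (\1_(F n) w)%:E) (fun w => (\1_E w)%:E) (cst 1%E).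
case: H => //.
- by move=> n; apply/measurable_EFinP; exact: measurable_indic.
- by apply/measurable_EFinP; exact: measurable_indic.
- apply: negligibleS N0 => w /= /not_implyP[_ H]; apply: contrapT => /FE Fw.
  apply: H; apply: cvg_near_cst; near=> n.
  have /propeqP e : F n w <-> E w by near: n.
  by rewrite !indicE; congr (_%:E); congr (_%:R); congr nat_of_bool; apply/idP/idP;
    rewrite !inE e.
- exact: finite_measure_integrable_cst.
- by apply: aeW => w n _ /=; rewrite lee_fin indicE; case: (_ \in _); rewrite ?normr1 ?normr0.
- move=> _ _; rewrite integral_indic// setIT.
  by under eq_fun do rewrite integral_indic// setIT.
Unshelve. all: by end_near. Qed.

(** The sets [E] satisfying the identity form a lambda-system: proper differences by linearity,
    increasing unions by continuity from below. The whole space is a separate hypothesis because [G]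
    need not contain it. Arbitrary signs in [c] let one lemma serve both the Markov property and
    orthogonality to a signed measure. *)
Lemma pi_lambda_comb (I : finType) (c : I -> R) (S : I -> set Omega)
    (G : set (set Omega)) :
  setI_closed G -> (forall E, G E -> measurable E) -> (forall i, measurable (S i)) ->
  \sum_i c i * Pr (S i) = 0 ->
  (forall E, G E -> \sum_i c i * Pr (E `&` S i) = 0) ->
  forall E, <<s G >> E -> \sum_i c i * Pr (E `&` S i) = 0.
Proof.
move=> GI mG mS LT LG.
suff: <<s G >> `<=` [set E | measurable E /\ \sum_i c i * Pr (E `&` S i) = 0].
  by move=> H E /H[].
apply: lambda_system_subset => //; last by move=> E GE; split; [exact: mG|exact: LG].
split => //=.
- by split => //; under eq_bigr do rewrite setTI.
- move=> A B BA [mA LA] [mB LB]; split; first exact: measurableD.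
  under eq_bigr => i _.
    rewrite (_ : (A `\` B) `&` S i = (A `&` S i) `\` (B `&` S i)); last first.
      apply/seteqP; split => w /=; first by move=> [[Aw nB] Sw]; split => // -[].
      by move=> [[Aw Sw] H]; split => //; split => // Bw; apply: H.
    rewrite PrD; [|exact: measurableI|exact: measurableI|exact: setSI].
    rewrite mulrBr.
    over.
  by rewrite sumrB LA LB subrr.
- move=> F ndF FL; split; first by apply: bigcup_measurable => k _; have [] := FL k.
  have cv : \sum_i c i * Pr (F n `&` S i) @[n --> \oo] -->
      \sum_i c i * Pr ((\bigcup_n F n) `&` S i).
    apply: cvg_big => [|i _]; first exact: add_continuous.
     apply: cvgM; first exact: cvg_cst.
    rewrite setI_bigcupl; apply: cvg_Pr_nd.
      by move=> n; apply: measurableI => //; have [] := FL n.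
    by move=> n m nm; apply: setSI; apply/subsetPset/ndF.
  apply/esym; apply: cvg_unique cv => //.
  rewrite /= (_ : (fun n => _) = cst 0); first exact: cvg_cst.
  by apply/funext => n; have [_] := FL n.
Qed.

Lemma pi_lambda_eq (a b : R) (S T : set Omega) (G : set (set Omega)) :
  setI_closed G -> (forall E, G E -> measurable E) -> measurable S -> measurable T ->
  a * Pr S = b * Pr T ->
  (forall E, G E -> a * Pr (E `&` S) = b * Pr (E `&` T)) ->
  forall E, <<s G >> E -> a * Pr (E `&` S) = b * Pr (E `&` T).
Proof.
move=> GI mG mS mT LT LG E sE.
have := @pi_lambda_comb bool (fun b' => if b' then a else - b)
  (fun b' => if b' then S else T) G GI mG.
rewrite big_bool/= => L; apply/eqP; rewrite -subr_eq0 -mulNr; apply/eqP.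
have := L _ _ _ E sE; rewrite big_bool/=; apply.
- by case.
- by rewrite LT mulNr subrr.
- by move=> E' GE'; rewrite big_bool/= LG// mulNr subrr.
Qed.

(** The sum depends on [w] only through the finite pattern [Y w] of memberships, so its second
    moment is a finite sum over patterns and the inequality holds pattern by pattern, without
    integration. The right-hand side is left as pair probabilities because orthogonality will be
    expressed through them. *)
Lemma chebyshev_fin (K : finType) (c : K -> R) (E : K -> set Omega) (a : R) :
  0 <= a -> (forall k, measurable (E k)) ->
  measurable [set w | a <= `|\sum_k c k * (w \in E k)%:R|] /\
  a ^+ 2 * Pr [set w | a <= `|\sum_k c k * (w \in E k)%:R|] <=
  \sum_k \sum_l c k * c l * Pr (E k `&` E l).
Proof.
move=> a0 mE; pose Y w : {ffun K -> bool} := [ffun k => w \in E k].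
have mY y : measurable [set w | Y w = y].
  rewrite (_ : [set w | _] = ~` (\bigcup_(k in [set: K]) ~` (if y k then E k else ~` E k))).
    apply: measurableC; apply: fin_bigcup_measurable; first exact: finite_finset.
    by move=> k _; apply: measurableC; case: ifP => // _; exact: measurableC.
  apply/seteqP; split => w /=.
    move=> <- [k _]; rewrite /Y ffunE; case: ifPn => [/set_mem|/negP H] //.
    by apply=> Ew; apply: H; exact/mem_set.
  move=> H; apply/ffunP => k; rewrite /Y ffunE; apply: contrapT => ne; apply: H; exists k => //.
  by case: (y k) ne => ne; [move=> Ew|move=> nE]; apply: ne; [exact: mem_set|exact: memNset].
pose g (y : {ffun K -> bool}) := \sum_k c k * (y k)%:R.
have gE w : \sum_k c k * (w \in E k)%:R = g (Y w).
  by apply: eq_bigr => k _; rewrite /Y ffunE.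
have EY y : [set w | a <= `|\sum_k c k * (w \in E k)%:R|] `&` [set w | Y w = y] =
    if a <= `|g y| then [set w | Y w = y] else set0.
  apply/seteqP; split => w /=.
    by rewrite gE => -[+ Yw]; rewrite Yw => ->.
  by case: ifP => // ag /= Yw; rewrite gE Yw.
have mEv : measurable [set w | a <= `|\sum_k c k * (w \in E k)%:R|].
  rewrite (_ : [set w | _] = \bigcup_(y in [set y | a <= `|g y|]) [set w | Y w = y]).
    by apply: fin_bigcup_measurable => //; exact: finite_finset.
  apply/seteqP; split => w /=; first by rewrite gE => ag; exists (Y w).
  by move=> [y /= ag Yw]; rewrite gE Yw.
split => //; rewrite (Pr_partition mEv mY) mulr_sumr.
have -> : \sum_k \sum_l c k * c l * Pr (E k `&` E l) =
    \sum_y g y ^+ 2 * Pr [set w | Y w = y].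
  transitivity (\sum_k \sum_l \sum_(y : {ffun K -> bool}) c k * c l * (y k && y l)%:R * Pr [set w | Y w = y]).
    apply: eq_bigr => k _; apply: eq_bigr => l _.
    rewrite (Pr_partition (measurableI _ _ (mE k) (mE l)) mY) mulr_sumr.
    apply: eq_bigr => y _; rewrite -[RHS]mulrA; congr (_ * _).
    case: (boolP (y k && y l)) => [/andP[yk yl]|ykl].
      rewrite mul1r setIidr// => w /= Yw; move: yk yl; rewrite -Yw /Y !ffunE.
      by move=> /set_mem ? /set_mem.
    rewrite mul0r (_ : _ `&` _ = set0) ?Pr0//; apply/seteqP; split => w //= [[Ek El] Yw].
    by move: ykl; rewrite -Yw /Y !ffunE !mem_set.
  under eq_bigr do rewrite exchange_big/=.
  rewrite exchange_big/=; apply: eq_bigr => y _.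
  rewrite /g expr2 mulr_suml mulr_suml; apply: eq_bigr => k _.
  rewrite mulr_sumr mulr_suml; apply: eq_bigr => l _.
  by case: (y k); case: (y l); rewrite /= ?mulr0 ?mul0r ?mulr1.
apply: ler_sum => y _; rewrite EY; case: ifP => ag; last first.
  by rewrite Pr0 mulr0 mulr_ge0 ?sqr_ge0 ?Pr_ge0.
rewrite ler_wpM2r ?Pr_ge0// -[g y ^+ 2]real_normK ?num_real//.
by rewrite ler_sqr ?nnegrE.
Qed.

End FiniteMeasure.

Section SubSigmaAlgebra.
Context {R : realType} {dis : measure_display} {Omega : measurableType dis}.
Implicit Types (S : set (set Omega)) (g : Omega -> R).

Lemma sigma_algebra_gen (G : set (set Omega)) : sigma_algebra setT <<s G >>.
Proof. exact: smallest_sigma_algebra. Qed.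

(** Makes the closure properties of measurable functions available for a sub-sigma-algebra that is
    given as a bare family of sets. *)
Lemma measurable_wrtP S g : sigma_algebra setT S ->
  measurable_wrt S g <->
  measurable_fun setT (g : g_sigma_algebraType S -> R).
Proof.
move=> sS; have SE := measurable_g_measurableTypeE sS.
split => [gS _ B mB|mg B mB].
  by rewrite setTI; have := gS _ mB; rewrite -{1}SE.
by have := mg measurableT _ mB; rewrite setTI SE.
Qed.

Section Closure.
Variable S : set (set Omega).
Hypothesis sS : sigma_algebra setT S.

Lemma saI A B : S A -> S B -> S (A `&` B).
Proof.
rewrite -(measurable_g_measurableTypeE sS); exact: measurableI.
Qed.

Lemma saU A B : S A -> S B -> S (A `|` B).
Proof.
rewrite -(measurable_g_measurableTypeE sS); exact: measurableU.
Qed.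

Lemma saT : S setT.
Proof. rewrite -(measurable_g_measurableTypeE sS); exact: measurableT. Qed.

Lemma saC A : S A -> S (~` A).
Proof. rewrite -(measurable_g_measurableTypeE sS); exact: measurableC. Qed.

Lemma sa_bigcup (F : nat -> set Omega) : (forall n, S (F n)) -> S (\bigcup_n F n).
Proof. by case: sS => _ _; apply. Qed.

Lemma sa_bigcap (F : nat -> set Omega) : (forall n, S (F n)) -> S (\bigcap_n F n).
Proof.
move=> SF; rewrite -[X in S X]setCK; apply: saC; rewrite setC_bigcap.
by apply: sa_bigcup => n; exact: saC.
Qed.

Lemma wrt_cst (c : R) : measurable_wrt S (fun _ => c).
Proof. by apply/measurable_wrtP => //; exact: measurable_cst. Qed.

Lemma wrtD f g : measurable_wrt S f -> measurable_wrt S g ->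
  measurable_wrt S (fun w => f w + g w).
Proof.
move=> /measurable_wrtP mf /measurable_wrtP mg; apply/measurable_wrtP => //.
by apply: (@measurable_funD _ (g_sigma_algebraType S) R setT f g);
  [exact: mf|exact: mg].
Qed.

Lemma wrtZ (c : R) f : measurable_wrt S f -> measurable_wrt S (fun w => c * f w).
Proof.
move=> /measurable_wrtP mf; apply/measurable_wrtP => //.
by apply: (@measurable_funM _ (g_sigma_algebraType S) R setT (cst c) f) => //;
  exact: mf.
Qed.

Lemma wrt_sum (I : Type) (s : seq I) (f : I -> Omega -> R) :
  (forall i, measurable_wrt S (f i)) ->
  measurable_wrt S (fun w => \sum_(i <- s) f i w).
Proof.
move=> mf; elim: s => [|i s ih].
  by under eq_fun do rewrite big_nil; exact: wrt_cst.
by under eq_fun do rewrite big_cons; exact: wrtD.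
Qed.

Lemma wrt_cvg (f : nat -> Omega -> R) g :
  (forall n, measurable_wrt S (f n)) ->
  (forall w, f n w @[n --> \oo] --> g w) -> measurable_wrt S g.
Proof.
move=> mf fg; apply/measurable_wrtP => //.
apply: measurable_fun_cvg => [n|w _]; last exact: fg.
by have /measurable_wrtP := mf n; exact.
Qed.

Lemma wrt_ind E : S E -> measurable_wrt S (fun w => (w \in E)%:R : R).
Proof.
move=> SE; apply/measurable_wrtP => //.
have := @measurable_indic _ (g_sigma_algebraType S) R setT E.
by apply; rewrite (measurable_g_measurableTypeE sS).
Qed.

End Closure.

Lemma measurable_wrtS S S' g : S `<=` S' -> measurable_wrt S g -> measurable_wrt S' g.
Proof. by move=> SS' mg B mB; exact/SS'/mg. Qed.

End SubSigmaAlgebra.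

(** * Rate matrices and the controllable space *)

Section Subspaces.

(** Among matrices whose row space lies in [S] take one of maximal rank: adjoining a vector of [S]
    outside its row space would raise the rank. *)
Lemma subspace_matrix (F : fieldType) (d : nat) (S : 'rV[F]_d -> Prop) :
  S 0 -> (forall f g, S f -> S g -> S (f + g)) -> (forall a f, S f -> S (a *: f)) ->
  exists U : 'M[F]_d, forall f, (f <= U)%MS <-> S f.
Proof.
move=> S0 SD SZ.
pose p (k : nat) := `[< exists2 U : 'M[F]_d, \rank U = k & forall f, (f <= U)%MS -> S f >].
have p0 : exists k, p k.
  exists 0%N; apply/asboolP; exists 0; first exact: mxrank0.
  by move=> f; rewrite submx0 => /eqP ->.
have pd k : p k -> (k <= d)%N by move=> /asboolP[U <- _]; exact: rank_leq_row.
case: (ex_maxnP p0 pd) => k /asboolP[U rU SU] kmax.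
exists U => f; split => [|Sf]; first exact: SU.
apply: contrapT => fU.
suff /kmax : p (\rank (U + f)%MS).
  rewrite -rU leqNgt => /negP; apply; rewrite rank_ltmx//.
  rewrite ltmxE addsmxSl addsmx_sub submx_refl/=; exact/negP.
apply/asboolP; exists (U + f)%MS => // g /sub_addsmxP[[u1 u2] /= ->].
apply: SD; first by apply: SU; exact: submxMl.
by rewrite [u2]mx11_scalar mul_scalar_mx; exact: SZ.
Qed.

(** Membership in a row space is a finite system of linear equations, given by the cokernel, and
    these pass to entrywise limits. *)
Lemma submx_cvg (R : realType) (d : nat) (V : 'M[R]_d) (u_ : nat -> 'rV[R]_d)
    (u : 'rV[R]_d) :
  (forall n, (u_ n <= V)%MS) -> (forall i, u_ n 0 i @[n --> \oo] --> u 0 i) ->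
  (u <= V)%MS.
Proof.
move=> uV cu; rewrite submxE; apply/eqP/rowP => k; rewrite !mxE.
have cv : \sum_j u_ n 0 j * cokermx V j k @[n --> \oo] -->
    \sum_j u 0 j * cokermx V j k.
  apply: cvg_big => [|j _]; first exact: add_continuous.
  by apply: cvgM; [exact: cu|exact: cvg_cst].
apply: cvg_unique cv _ => //.
rewrite (_ : (fun n => _) = cst 0); first exact: cvg_cst.
apply/funext => n; have := uV n; rewrite submxE => /eqP/rowP/(_ k).
by rewrite !mxE.
Qed.

Lemma ctrb_space_exists (R : realType) (d : nat) (A : 'M[R]_d) (h : 'rV[R]_d) :
  exists V : 'M[R]_d, is_ctrb_space A h V.
Proof.
(* The intersection of all closed subspaces, an infinite family, becomes a single matrix through
   [subspace_matrix]. *)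
pose S (f : 'rV[R]_d) := forall W, closed_ctrb A h W -> (f <= W)%MS.
have [|f g Sf Sg W cW|a f Sf W cW|V VS] := @subspace_matrix R d S.
- by move=> W _; exact: sub0mx.
- by apply: addmx_sub; [exact: Sf|exact: Sg].
- by apply: scalemx_sub; exact: Sf.
exists V; split; last first.
  by move=> W cW; apply/row_subP => i; have /VS := row_sub i V; exact.
apply/and3P; split.
- by apply/VS => W /and3P[].
- apply/row_subP => i; rewrite row_mul; apply/VS => W cW.
  have /VS/(_ W cW) rW := row_sub i V.
  by case/and3P: cW => _ + _; apply: submx_trans; exact: submxMr.
- apply/row_subP => i; rewrite row_mul; apply/VS => W cW.
  have /VS/(_ W cW) rW := row_sub i V.
  by case/and3P: cW => _ _; apply: submx_trans; exact: submxMr.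
Qed.

(* An endomorphism of a finite-dimensional quotient that is not injective is not
   surjective, hence some functional on the quotient kills its image. *)
Lemma quotient_kernel_dual (F : fieldType) (d : nat) (V B : 'M[F]_d) (v : 'rV[F]_d) :
  (V *m B <= V)%MS -> ~~ (v <= V)%MS -> (v *m B <= V)%MS ->
  exists y : 'cV[F]_d, [/\ y != 0, V *m y = 0 & B *m y = 0].
Proof.
move=> VB vV vB; set K := cokermx V.
(* [K] is the quotient map. The kernel of [B *m K] contains both [V] and [v], so its rank is below d
   minus the rank of [V], which is the rank of [K]. *)
have rk : (\rank (B *m K) < \rank K)%N.
  rewrite mxrank_coker.
  have sub : (V + v <= kermx (B *m K))%MS.
    by rewrite addsmx_sub !sub_kermx (mulmxA V) (mulmxA v) -!submxE VB vB.
  have lt : (\rank V < \rank (V + v)%MS)%N.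
    by rewrite rank_ltmx// ltmxE addsmxSl addsmx_sub submx_refl.
  have := mxrankS sub; rewrite mxrank_ker => le.
  have := rank_leq_row (B *m K); have := rank_leq_row V.
  move: (leq_trans lt le); lia.
have : K *m cokermx (B *m K) != 0.
  by apply: contraL rk; rewrite -submxE -leqNgt => /mxrankS.
case/matrix0Pn => i [j Kij].
exists (col j (K *m cokermx (B *m K))); split.
- by apply/cV0Pn; exists i; rewrite mxE.
- by rewrite colE mulmxA (mulmxA V) mulmx_coker !mul0mx.
- by rewrite colE mulmxA (mulmxA B) mulmx_coker mul0mx.
Qed.

End Subspaces.

Section RateMatrices.
Context {R : realType} {d : nat} (A : 'M[R]_d).
Hypothesis rA : rate_matrix A.

Lemma rate_diag i : - A i i = \sum_(j | j != i) A i j.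
Proof.
have [_ /(_ i)] := rA; rewrite (bigD1 i)//= => /eqP; rewrite addrC addr_eq0.
by move=> /eqP ->.
Qed.

(** The closed disc of radius [b] about [- b] meets the closed right half-plane only at 0; with
    [b = - A j j] this is the disc around a diagonal entry of the rate matrix. *)
Lemma lt_norm_shift (lam : R[i]) (b : R) : 0 <= b -> 0 <= complex.Re lam -> lam != 0 ->
  (b%:C)%C < `|lam + (b%:C)%C|.
Proof.
case: lam => x y /= b0 x0 xy0; rewrite normc_def /= ltcR addr0.
rewrite -[ltLHS]ger0_norm// -sqrtr_sqr ltr_sqrt; last first.
  move: xy0; rewrite eq_complex/= negb_and.
  have [->|yn0 _] := eqVneq y 0; last by rewrite ltr_wpDl ?sqr_ge0// exprn_even_gt0.
  rewrite orbF => xn0; rewrite expr0n addr0 exprn_even_gt0//=.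
  by rewrite gt_eqF// ltr_wpDr// lt_neqAle eq_sym xn0.
have : 0 < x ^+ 2 + y ^+ 2.
  move: xy0; rewrite eq_complex/= negb_and => /orP[|] H.
    by rewrite ltr_wpDr ?sqr_ge0// exprn_even_gt0.
  by rewrite ltr_wpDl ?sqr_ge0// exprn_even_gt0.
nra.
Qed.

(* Gershgorin discs of the columns: they touch the imaginary axis only at 0. *)
Lemma rate_left_eigenvalue (lam : R[i]) (y : 'cV[R[i]]_d) :
  y != 0 -> 0 <= complex.Re lam ->
  map_mx (real_complex R) A^T *m y = lam *: y -> lam = 0.
Proof.
move=> y0 lam0 Ey; apply/eqP; apply: contraT => lamn0.
have H j : `|lam - (A j j)%:C%C| * `|y j 0| <= \sum_(i | i != j) (A i j)%:C%C * `|y i 0|.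
  have /colP/(_ j) := Ey; rewrite !mxE (bigD1 j)//= !mxE => E.
  rewrite -normrM mulrBl -E addrAC subrr add0r.
  apply: le_trans (ler_norm_sum _ _ _) _; apply: ler_sum => i ij.
  rewrite !mxE normrM ler_wpM2r//.
  by rewrite ger0_norm// lecR; have [+ _] := rA; exact.
(* A single estimate [H j] involves a column of [A], about whose sum nothing is known. Summing over
   [j] and exchanging the sums turns the columns into rows, whose off-diagonal sums are
   [- A i i]. *)
have : \sum_j `|lam - (A j j)%:C%C| * `|y j 0| <=
       \sum_j (- A j j)%:C%C * `|y j 0|.
  apply: le_trans (ler_sum _ (fun j _ => H j)) _.
  rewrite (exchange_big_dep predT)//= le_eqVlt; apply/orP; left; apply/eqP.
  apply: eq_bigr => i _; rewrite -mulr_suml; congr (_ * _).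
  rewrite rate_diag rmorph_sum/=; apply: eq_bigl => j.
  by rewrite eq_sym.
have L j : (- A j j)%:C%C * `|y j 0| <= `|lam - (A j j)%:C%C| * `|y j 0|.
  rewrite ler_wpM2r// -rmorphN/= ltW// lt_norm_shift//.
  by rewrite rate_diag sumr_ge0// => k kj; have [+ _] := rA; apply; rewrite eq_sym.
move=> le; suff lt : \sum_j (- A j j)%:C%C * `|y j 0| <
    \sum_j `|lam - (A j j)%:C%C| * `|y j 0| by move: (lt_le_trans lt le); rewrite ltxx.
have [i yi0] := cV0Pn _ y0.
rewrite (bigD1 i)//= [ltRHS](bigD1 i)//=; apply: ltr_leD; last by apply: ler_sum.
rewrite ltr_pM2r ?normr_gt0// -rmorphN/= lt_norm_shift//.
by rewrite rate_diag sumr_ge0// => k kj; have [+ _] := rA; apply; rewrite eq_sym.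
Qed.

(** Let [a i] be the total of row [i] over the states where [w] is positive. The terms [w i * a i]
    sum to zero by invariance and are all nonpositive: from inside, [a i] is minus the exit rate;
    from outside, [a i] is nonnegative and [w i] is not positive. Hence every term vanishes, and
    with it the exit rate of each inner state. *)
Lemma rate_null_pos_closed (w : 'I_d -> R) :
  (forall j, \sum_i w i * A i j = 0) ->
  forall x y, 0 < w x -> ~~ (0 < w y) -> A x y = 0.
Proof.
move=> wA x y wx wy; have [A0 As] := rA.
pose a i := \sum_(j | 0 < w j) A i j.
have aN i : a i = - \sum_(j | ~~ (0 < w j)) A i j.
  by have /eqP := As i; rewrite (bigID (fun j => 0 < w j))/= addr_eq0 => /eqP.
have a0 i : w i * a i <= 0.
  have [wi|wi] := ltP 0 (w i).
    rewrite aN mulrN oppr_le0 mulr_ge0// ?(ltW wi)// sumr_ge0// => j wj.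
    by apply: A0; apply: contraNneq wj => <-.
  rewrite mulr_le0_ge0// sumr_ge0// => j wj; apply: A0.
  by apply: contraTneq wj => <-; rewrite -leNgt.
have s0 : \sum_i - (w i * a i) = 0.
  rewrite sumrN; apply/eqP; rewrite oppr_eq0; apply/eqP.
  under eq_bigr do rewrite mulr_sumr.
  by rewrite exchange_big/= big1.
have ax : a x = 0.
  have H i : true -> 0 <= - (w i * a i) by rewrite oppr_ge0.
  have /eqP := psumr_eq0P H s0 (isT : xpredT x).
  by rewrite oppr_eq0 mulf_eq0 gt_eqF//= => /eqP.
have sx : \sum_(j | ~~ (0 < w j)) A x j = 0.
  by apply/eqP; rewrite -oppr_eq0 -aN ax.
apply: (psumr_eq0P _ sx) => // j wj.
by apply: A0; apply: contraNneq wj => <-.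
Qed.

(* A quotient eigenvalue in the closed right half-plane must be 0, and is then
   witnessed by a real invariant signed measure orthogonal to V. *)
Lemma quot_eigenvalue_null_functional (V : 'M[R]_d) (lam : R[i]) :
  (V *m A^T <= V)%MS -> quot_eigenvalue A V lam -> 0 <= complex.Re lam ->
  exists w : 'I_d -> R, [/\ exists x, w x != 0,
    forall j, \sum_i w i * A i j = 0 &
    forall g : 'rV[R]_d, (g <= V)%MS -> \sum_i w i * g 0 i = 0].
Proof.
move=> VA [v [vV vB]] lam0.
pose VC := map_mx (real_complex R) V.
pose B := map_mx (real_complex R) A^T - lam%:M.
have [|||y [y0 Vy By]] := @quotient_kernel_dual _ _ VC B v.
- rewrite mulmxBr addmx_sub// ?eqmx_opp.
    by rewrite -map_mxM map_submx.
  by rewrite scalar_mxC mul_scalar_mx scalemx_sub.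
- exact: vV.
- by rewrite mulmxBr mul_mx_scalar.
have lamE : lam = 0.
  apply: (@rate_left_eigenvalue lam y) => //.
  by move: By; rewrite mulmxBl mul_scalar_mx => /eqP; rewrite subr_eq0 => /eqP.
(* [A] and [V] are real, so any real-linear [f] maps the complex relations for [y] to real ones. It
   is used with the real and the imaginary part, one of which does not vanish on [y]. *)
have key (f : {additive R[i] -> R}) : (forall (a : R) z, f (a%:C%C * z) = a * f z) ->
    (forall j, \sum_i f (y i 0) * A i j = 0) /\
    (forall g : 'rV[R]_d, (g <= V)%MS -> \sum_i f (y i 0) * g 0 i = 0).
  move=> fZ; split.
    move=> j; move: By; rewrite /B lamE raddf0 subr0 => /colP/(_ j)/(congr1 f).
    rewrite !mxE raddf_sum raddf0/= => E; rewrite -[RHS]E.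
    by apply: eq_bigr => i _; rewrite !mxE fZ mulrC.
  move=> g /submxP[D ->].
  have : map_mx (real_complex R) (D *m V) *m y = 0.
    by rewrite map_mxM -mulmxA Vy mulmx0.
  move=> /rowP/(_ 0)/(congr1 f); rewrite !mxE raddf_sum raddf0/= => E.
  by rewrite -[RHS]E; apply: eq_bigr => i _; rewrite [map_mx _ _ _ _]mxE fZ mulrC.
have [i yi0] := cV0Pn _ y0.
have [Re0|Re0] := eqVneq (complex.Re (y i 0)) 0.
  have [|H1 H2] := key (@complex.Im R : {additive R[i] -> R}).
    by move=> a [z1 z2] /=; rewrite mul0r addr0.
  exists (fun i => complex.Im (y i 0)); split => //; exists i.
  by apply: contraNneq yi0 => Im0; rewrite eq_complex/= Re0 Im0 eqxx.
have [|H1 H2] := key (@complex.Re R : {additive R[i] -> R}).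
  by move=> a [z1 z2] /=; rewrite mul0r subr0.
by exists (fun i => complex.Re (y i 0)); split => //; exists i.
Qed.

Lemma closed_ind_ctrb (h : 'I_d -> R) (D : {set 'I_d}) :
  closed_class A D -> closed_class A (~: D) -> stabilizable A h ->
  exists2 V : 'M[R]_d, is_ctrb_space A (\row_i h i) V & ((\row_x ind_set D x) <= V)%MS.
Proof.
move=> cD cDC [V [cV st]]; exists V => //; set g := \row_x _.
case: st => [/eqmxP eV|[_ hur]]; first by rewrite eV submx1.
apply: contrapT => /negP gV.
have gA : g *m A^T = 0.
  apply/rowP => i; rewrite !mxE.
  have [iD|iD] := boolP (i \in D); last first.
    rewrite big1// => j _; rewrite !mxE /ind_set.
    have [jD|jD] := boolP (j \in D); last by rewrite mul0r.
    by rewrite (cDC i j) ?mulr0 ?inE ?negbK.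
  have [_ /(_ i) As] := rA; rewrite -[RHS]As.
  apply: eq_bigr => j _; rewrite !mxE /ind_set.
  by have [jD|jD] := boolP (j \in D); rewrite ?mul1r// mul0r (cD i j).
have /hur : quot_eigenvalue A V 0.
  exists (map_mx (real_complex R) g); split; first by rewrite map_submx.
  by rewrite scale0r subr0 -map_mxM gA map_mx0 sub0mx.
by rewrite /= ltxx.
Qed.

End RateMatrices.

(** * Matrix exponential *)

Section MatrixExponential.
Context {R : realType} {d : nat}.
Implicit Types (M A : 'M[R]_d) (i j : 'I_d).

(** Dominates every entry and, by [mx_pow_bound], the entries of powers, so the matrix exponential
    is controlled term by term by the scalar one. *)
Definition mxsum_norm M : R := \sum_i \sum_j `|M i j|.

Lemma mxsum_norm_ge0 M : 0 <= mxsum_norm M.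
Proof. by do 2 (apply: sumr_ge0 => ? _). Qed.

Lemma mx_pow_bound M k i j : `|(M ^+ k) i j| <= mxsum_norm M ^+ k.
Proof.
elim: k i j => [|k ih] i j.
  by rewrite !expr0 mxE; case: eqP; rewrite ?normr1 ?normr0.
rewrite !exprS mxE; apply: le_trans (ler_norm_sum _ _ _) _.
apply: (@le_trans _ _ (\sum_l `|M i l| * mxsum_norm M ^+ k)).
  by apply: ler_sum => l _; rewrite normrM ler_wpM2l.
rewrite -mulr_suml ler_wpM2r ?exprn_ge0 ?mxsum_norm_ge0//.
rewrite /mxsum_norm [leRHS](bigD1 i)//= lerDl.
by do 2 (apply: sumr_ge0 => ? _).
Qed.

Lemma expmx_term_bound M k i j :
  `|(M ^+ k) i j / k`!%:R| <= exp_coeff (mxsum_norm M) k.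
Proof.
rewrite /exp_coeff/= normrM [`|_^-1|]ger0_norm ?invr_ge0//.
by rewrite ler_wpM2r ?invr_ge0// mx_pow_bound.
Qed.

Lemma cvg_expmx M i j :
  series (fun k : nat => (M ^+ k) i j / k`!%:R) n @[n --> \oo] --> expmx M i j.
Proof.
apply: normed_cvg; apply: (series_le_cvg _ _ _ (is_cvg_series_exp_coeff (mxsum_norm M))).
- by move=> n /=.
- by move=> n /=; rewrite /exp_coeff/= divr_ge0// exprn_ge0// mxsum_norm_ge0.
- by move=> n /=; exact: expmx_term_bound.
Qed.

Lemma expmx_closed M (D : {set 'I_d}) i j :
  (forall x y, x \in D -> y \notin D -> M x y = 0) ->
  i \in D -> j \notin D -> expmx M i j = 0.
Proof.
move=> cD iD jD.
have M0 k x y : x \in D -> y \notin D -> (M ^+ k) x y = 0.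
  elim: k x => [|k ih] x xD yD.
    by rewrite expr0 mxE; case: eqP => // xy; rewrite -xy xD in yD.
  rewrite exprS mxE big1// => l _.
  by have [lD|lD] := boolP (l \in D); [rewrite ih// mulr0|rewrite cD// mul0r].
have := @cvg_expmx M i j.
rewrite (_ : series _ = cst 0) => [c0|]; last first.
  by apply/funext => n; rewrite /series/= big1// => k _; rewrite M0// mul0r.
by apply: cvg_unique c0 _ => //; exact: cvg_cst.
Qed.

Lemma expmx_stable M (V : 'M[R]_d) (g : 'rV[R]_d) :
  (V *m M^T <= V)%MS -> (g <= V)%MS ->
  ((\row_i (\sum_j expmx M i j * g 0 j)%R) <= V)%MS.
Proof.
move=> VM gV.
have gk k : (g *m (M^T ^+ k) <= V)%MS.
  elim: k => [|k ih]; first by rewrite expr0 mulmx1.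
  by rewrite exprSr mulmxA; apply: submx_trans VM; exact: submxMr.
pose u n : 'rV[R]_d := \sum_(0 <= k < n) (k`!%:R^-1) *: (g *m (M^T ^+ k)).
apply: (@submx_cvg _ _ _ u).
  move=> n; apply: summx_sub => k _; exact: scalemx_sub.
move=> i; rewrite mxE.
rewrite (_ : (fun n => u n 0 i) =
   (fun n => \sum_j series (fun k : nat => (M ^+ k) i j / k`!%:R) n * g 0 j)).
  apply: cvg_big => [|j _]; first exact: add_continuous.
  by apply: cvgM; [exact: cvg_expmx|exact: cvg_cst].
apply/funext => n; rewrite /u summxE.
under [RHS]eq_bigr do rewrite /series/= mulr_suml.
rewrite exchange_big/=; apply: eq_bigr => k _.
rewrite !mxE mulr_sumr; apply: eq_bigr => j _.
have -> : M^T ^+ k = (M ^+ k)^T.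
  elim: (k) => [|l ih]; first by rewrite !expr0 trmx1.
  by rewrite exprS exprSr ih trmx_mul.
by rewrite mxE; ring.
Qed.

(** From exp(-z) >= 1 - z one gets exp(z) <= 1 / (1 - z), so the left side is at most z^2 / (1 - z);
    the bound z <= 1/2 gives the constant 2. *)
Lemma exp_le_quadratic (z : R) : 0 <= z <= 1/2 -> expR z - 1 - z <= 2 * z ^+ 2.
Proof.
move=> /andP[z0 z1].
have := expR_ge1Dx (- z); have := expRxMexpNx_1 z.
have := expR_gt0 z; set a := expR z; set b := expR (- z) => a0 ab ge.
have : a * (1 - z) <= 1 by nra.
nra.
Qed.

(** The omitted terms are dominated one by one by those of the scalar series. Taking [m] equal to 2
    and 1 gives the first and zeroth order estimates. *)
Lemma expmx_tail (A : 'M[R]_d) (s : R) (m : nat) i j : 0 <= s ->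
  `|expmx (s *: A) i j - series (fun k : nat => ((s *: A) ^+ k) i j / k`!%:R) m|
  <= expR (s * mxsum_norm A) - series (exp_coeff (s * mxsum_norm A)) m.
Proof.
move=> s0; set b := s * _.
have bE : b = mxsum_norm (s *: A).
  rewrite /b /mxsum_norm mulr_sumr; apply: eq_bigr => k _; rewrite mulr_sumr.
  by apply: eq_bigr => l _; rewrite !mxE normrM ger0_norm.
set u := series _.
have cu : `|u n - u m| @[n --> \oo] --> `|expmx (s *: A) i j - u m|.
  by apply: cvg_norm; apply: cvgB; [exact: cvg_expmx|exact: cvg_cst].
have cv : series (exp_coeff b) n - series (exp_coeff b) m @[n --> \oo] -->
    expR b - series (exp_coeff b) m.
  by apply: cvgB; [exact: is_cvg_series_exp_coeff|exact: cvg_cst].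
apply: (ler_cvg_to cu cv); near=> n.
have mn : (m <= n)%N by near: n; exists m.
rewrite /u !sub_series_geq//; apply: le_trans (ler_norm_sum _ _ _) _.
by apply: ler_sum => k _; rewrite bE; exact: expmx_term_bound.
Unshelve. all: by end_near. Qed.

Lemma expmx_order1 (A : 'M[R]_d) (s : R) i j :
  0 <= s -> s * mxsum_norm A <= 1/2 ->
  `|expmx (s *: A) i j - (i == j)%:R - s * A i j| <= 2 * (s * mxsum_norm A) ^+ 2.
Proof.
move=> s0 s1; have z0 : 0 <= s * mxsum_norm A by rewrite mulr_ge0// mxsum_norm_ge0.
have := @expmx_tail A s 2 i j s0.
rewrite /series/= !big_nat_recr//= !big_geq// /exp_coeff/=.
rewrite !expr0 !expr1 !divr1 !add0r !mxE opprD addrA => /le_trans; apply.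
by rewrite opprD addrA; apply: exp_le_quadratic; rewrite z0.
Qed.

Lemma expmx_order0 (A : 'M[R]_d) (s : R) i j :
  0 <= s -> s * mxsum_norm A <= 1/2 ->
  `|expmx (s *: A) i j - (i == j)%:R| <= 2 * (s * mxsum_norm A).
Proof.
move=> s0 s1; have z0 : 0 <= s * mxsum_norm A by rewrite mulr_ge0// mxsum_norm_ge0.
have := @expmx_tail A s 1 i j s0.
rewrite /series/= !big_nat_recr//= !big_geq// /exp_coeff/=.
rewrite !expr0 !divr1 !add0r !mxE => /le_trans; apply.
have := @exp_le_quadratic (s * mxsum_norm A); rewrite z0 s1 => /(_ isT).
by move: (s * _) z0 s1 => z z0 z1; nra.
Qed.

End MatrixExponential.

(** * Right-continuous paths and Riemann sums *)

Lemma within_ge0_continuousP (R : realType) (f : R -> R) :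
  {within [set t : R | 0 <= t], continuous f} -> forall t e, 0 <= t -> 0 < e ->
  exists2 dl : R, 0 < dl & forall s, 0 <= s -> `|t - s| < dl -> `|f t - f s| < e.
Proof.
move=> /subspace_continuousP cf t e t0 e0.
have /cvgrPdist_lt/(_ e e0) := cf t t0.
rewrite near_withinE => /nbhs_ballP[dl dl0 H].
by exists dl => // s s0 ts; apply: H.
Qed.

Lemma cvg_within_ge0 (R : realType) (f : R -> R) (u_ : nat -> R) (u : R) :
  {within [set t : R | 0 <= t], continuous f} -> 0 <= u ->
  u_ n @[n --> \oo] --> u -> (forall n, 0 <= u_ n) -> f (u_ n) @[n --> \oo] --> f u.
Proof.
move=> cf u0 cu u_0; apply/cvgrPdist_lt => e e0.
have [dl dl0 H] := within_ge0_continuousP cf u0 e0.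
have /cvgrPdist_lt/(_ _ dl0) := cu; apply: filterS => n un.
exact: H.
Qed.

Section Paths.
Context {R : realType} {d : nat}.
Implicit Types (h : 'I_d -> R) (phi : R -> 'I_d).

Definition right_cont phi := forall t, 0 <= t ->
  exists2 e : R, 0 < e & forall s, t <= s < t + e -> phi s = phi t.

(** The first point strictly after [u] of the grid of mesh [T / 2 ^ n]. Sampling from the right is
    forced by paths that are only right continuous; at [u = T] it overshoots, which is why the
    endpoint is treated apart below. *)
Definition dyadic_up (T u : R) (n : nat) : R :=
  T * (Num.truncn (u * (2 ^ n)%:R / T)).+1%:R / (2 ^ n)%:R.

Lemma pow2_gt0 (n : nat) : 0 < (2 ^ n)%:R :> R.
Proof. by rewrite ltr0n expn_gt0. Qed.

Lemma cvg_div_pow2 (T : R) : T / (2 ^ n)%:R @[n --> \oo] --> 0.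
Proof.
rewrite -(mulr0 T); apply: cvgM; first exact: cvg_cst.
under eq_fun do rewrite natrX -exprVn.
by apply: cvg_expr; rewrite ger0_norm ?invf_lt1 ?ltr1n.
Qed.

Lemma dyadic_up_gt (T u : R) n : 0 < T -> 0 <= u -> u < dyadic_up T u n.
Proof.
move=> T0 u0; rewrite /dyadic_up ltr_pdivlMr ?pow2_gt0// [T * _]mulrC -ltr_pdivrMr//.
exact: truncnS_gt.
Qed.

Lemma dyadic_up_le (T u : R) n : 0 < T -> 0 <= u ->
  dyadic_up T u n <= u + T / (2 ^ n)%:R.
Proof.
move=> T0 u0; rewrite /dyadic_up -natr1 mulrDr mulr1 mulrDl lerD2r.
rewrite ler_pdivrMr ?pow2_gt0// mulrC -ler_pdivlMr//.
by rewrite truncn_le divr_ge0 ?mulr_ge0// ltW.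
Qed.

Lemma dyadic_up_cvg (T u : R) : 0 < T -> 0 <= u -> dyadic_up T u n @[n --> \oo] --> u.
Proof.
move=> T0 u0; apply: (@squeeze_cvgr _ _ _ _ (cst u) (fun n => u + T / (2 ^ n)%:R)).
- by apply: nearW => n; rewrite ltW ?dyadic_up_gt// dyadic_up_le.
- exact: cvg_cst.
- by rewrite -[X in _ --> X]addr0; apply: cvgD; [exact: cvg_cst|exact: cvg_div_pow2].
Qed.

Lemma dyadic_up_index (T u : R) n : 0 < T -> 0 <= u < T ->
  (Num.truncn (u * (2 ^ n)%:R / T) < 2 ^ n)%N.
Proof.
move=> T0 /andP[u0 uT]; rewrite -(ltr_nat R).
apply: (@le_lt_trans _ _ (u * (2 ^ n)%:R / T)).
  by rewrite truncn_le divr_ge0 ?mulr_ge0// ltW.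
by rewrite ltr_pdivrMr// mulrC ltr_pM2l// pow2_gt0.
Qed.

Lemma right_cont_dyadic phi (t T u : R) : right_cont phi -> 0 <= t -> 0 < T -> 0 <= u ->
  \forall n \near \oo, phi (t + dyadic_up T u n) = phi (t + u).
Proof.
move=> rc t0 T0 u0; have [|e e0 phie] := rc (t + u); first by rewrite addr_ge0.
have /cvgrPdist_lt/(_ _ e0) := dyadic_up_cvg T0 u0.
apply: filterS => n; rewrite ltr_norml => /andP[+ _]; rewrite ltrNl opprB => ne.
by apply: phie; rewrite lerD2l ltW ?dyadic_up_gt//= -addrA ltrD2l -ltrBlDl.
Qed.

Definition riemann h phi (t s : R) (m : nat) : R :=
  \sum_(i < m) h (phi (t + s * i.+1%:R / m%:R)) * (s / m%:R).

Definition primitive h phi (t : R) : R :=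
  \int[lebesgue_measure]_(u in [set u : R | 0 <= u <= t]) h (phi u).

Definition fun_bound h : R := \sum_x `|h x|.

Lemma le_fun_bound h x : `|h x| <= fun_bound h.
Proof. by rewrite /fun_bound (bigD1 x)//= lerDl sumr_ge0. Qed.

Lemma fun_bound_ge0 h : 0 <= fun_bound h.
Proof. exact: sumr_ge0. Qed.

Definition step_cell (t s : R) (m i : nat) : set R :=
  `[t + s * i%:R / m%:R, t + s * i.+1%:R / m%:R[%classic.

(** The value on a cell is taken at its right endpoint, so the integral is a Riemann sum and the
    value at [u] samples the path at [dyadic_up]. Pointwise convergence then needs right continuity
    only. *)
Definition step_fun h phi (t s : R) (n : nat) (u : R) : R :=
  \sum_(i < 2 ^ n) h (phi (t + s * i.+1%:R / (2 ^ n)%:R)) * \1_(step_cell t s (2 ^ n) i) u.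

Lemma step_funE h phi (t s : R) n (u : R) : 0 < s -> t <= u < t + s ->
  step_fun h phi t s n u = h (phi (t + dyadic_up s (u - t) n)).
Proof.
move=> s0 /andP[tu us].
have uts : 0 <= u - t < s by rewrite subr_ge0 tu ltrBlDl.
have kn := dyadic_up_index n s0 uts.
have x0 : 0 <= (u - t) * (2 ^ n)%:R / s.
  by rewrite divr_ge0 ?mulr_ge0 ?(ltW s0)//; case/andP: uts.
have mem i : step_cell t s (2 ^ n) i u = (i = Num.truncn ((u - t) * (2 ^ n)%:R / s)).
  rewrite /step_cell/= in_itv/= -lerBrDl -ltrBlDl.
  rewrite ler_pdivrMr ?pow2_gt0// ltr_pdivlMr ?pow2_gt0//.
  rewrite [s * i%:R]mulrC -ler_pdivlMr// [s * _]mulrC -ltr_pdivrMr//.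
  apply/propext; split => [H|->].
    by apply/esym/eqP; rewrite truncn_eq.
  by rewrite truncn_itv.
rewrite /step_fun (bigD1 (Ordinal kn))//= big1 ?addr0.
  by rewrite indicE mem_set ?mulr1// mem.
move=> i ik; rewrite indicE memNset ?mulr0// mem => ei.
by move/eqP: ik; apply; exact: val_inj.
Qed.

Lemma measurable_step_fun h phi (t s : R) n D : measurable_fun D (step_fun h phi t s n).
Proof.
apply: measurable_sum => i; apply: measurable_funM => //.
by apply: measurable_indic; exact: measurable_itv.
Qed.

Lemma step_fun_cvg h phi (t s u : R) : right_cont phi -> 0 <= t -> 0 < s -> t <= u < t + s ->
  step_fun h phi t s n u @[n --> \oo] --> h (phi u).
Proof.
move=> rc t0 s0 tu; apply: cvg_near_cst.
have ut0 : 0 <= u - t by rewrite subr_ge0; case/andP: tu.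
have := right_cont_dyadic rc t0 s0 ut0; apply: filterS => n.
by rewrite step_funE// (addrC t (u - t)) subrK => ->.
Qed.

Lemma lebesgue_itv_fin (t s : R) :
  (lebesgue_measure (`[t, (t + s)%R[%classic : set R) < +oo)%E.
Proof. by rewrite lebesgue_measure_itv; case: ifP => // _; rewrite -EFinB ltry. Qed.

Lemma measurable_path h phi (t s : R) : right_cont phi -> 0 <= t -> 0 < s ->
  measurable_fun (`[t, t + s[%classic : set R) (fun u => h (phi u)).
Proof.
move=> rc t0 s0.
apply: (@measurable_fun_cvg _ _ _ _ (fun n => step_fun h phi t s n)).
  by move=> n; exact: measurable_step_fun.
by move=> u /=; rewrite in_itv/= => tu; exact: step_fun_cvg.
Qed.

Lemma integrable_path h phi (t s : R) : right_cont phi -> 0 <= t -> 0 < s ->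
  lebesgue_measure.-integrable (`[t, t + s[%classic : set R) (EFin \o (fun u => h (phi u))).
Proof.
move=> rc t0 s0; apply: measurable_bounded_integrable => //.
- exact: lebesgue_itv_fin.
- exact: measurable_path.
- exists (fun_bound h); split; [exact: num_real|move=> M hM u _ /=].
  by apply: le_trans (le_fun_bound _ _) (ltW hM).
Qed.

Lemma Rintegral_step_fun h phi (t s : R) n : 0 < s ->
  \int[lebesgue_measure]_(u in `[t, t + s[%classic) step_fun h phi t s n u =
  riemann h phi t s (2 ^ n).
Proof.
move=> s0; rewrite /step_fun /riemann.
have D0 := lebesgue_itv_fin t s.
have ind i : lebesgue_measure.-integrable (`[t, t + s[%classic : set R)
     (EFin \o (\1_(step_cell t s (2 ^ n) i) : R -> R)).
  apply: measurable_bounded_integrable => //; first by apply: measurable_indic; exact: measurable_itv.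
  exists 1; split => // M M1 u _ /=; rewrite indicE.
  by case: (_ \in _); rewrite ?normr1 ?normr0 ltW// (lt_trans _ M1).
rewrite /Rintegral.
under eq_integral do rewrite -sumEFin.
rewrite integral_sum//=; last first.
  by move=> i; exact: (integrableZl _ _ (ind i)).
rewrite (eq_bigr (fun i : 'I_(2 ^ n) =>
  (h (phi (t + s * i.+1%:R / (2 ^ n)%:R)) * (s / (2 ^ n)%:R))%:E)) ?sumEFin// => i _.
etransitivity; first exact: (integralZl _ (ind i)).
rewrite integral_indic; [|exact: measurable_itv|exact: measurable_itv].
rewrite setIidl; last first.
  move=> u; rewrite /step_cell/= !in_itv/= => /andP[u1 u2]; apply/andP; split.
    by apply: le_trans u1; rewrite lerDl divr_ge0// mulr_ge0// ltW.
  apply: lt_le_trans u2 _; rewrite lerD2l ler_pdivrMr ?pow2_gt0// ler_pM2l//.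
  by rewrite ler_nat.
rewrite EFinM; congr (_ * _)%E; rewrite /step_cell.
apply: (etrans (lebesgue_measure_itv _)).
rewrite /= lte_fin ltrD2l ltr_pM2r ?invr_gt0 ?pow2_gt0// ltr_pM2l// ltr_nat ltnSn.
by rewrite -EFinB -natr1; congr (_%:E); ring.
Qed.

Lemma riemann_cvg_itv h phi (t s : R) : right_cont phi -> 0 <= t -> 0 < s ->
  riemann h phi t s (2 ^ n) @[n --> \oo] -->
  \int[lebesgue_measure]_(u in `[t, t + s[%classic) h (phi u).
Proof.
move=> rc t0 s0.
have D0 := lebesgue_itv_fin t s.
have [] := @dominated_convergence _ _ _ lebesgue_measure (`[t, t + s[%classic : set R)
  (measurable_itv _) (fun n u => (step_fun h phi t s n u)%:E)
  (fun u => (h (phi u))%:E) (cst (fun_bound h)%:E).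
- by move=> n; apply/measurable_EFinP; exact: measurable_step_fun.
- by apply/measurable_EFinP; exact: measurable_path.
- apply: aeW => u; rewrite /= in_itv/= => tu.
  by apply: cvg_EFin; [exact: nearW|exact: step_fun_cvg].
- apply: (@measurable_bounded_integrable _ _ _ _ (cst (fun_bound h))) => //.
  exists (fun_bound h); split; [exact: num_real|move=> M hM u _ /=].
  by rewrite ger0_norm ?fun_bound_ge0// ltW.
- apply: aeW => u n; rewrite /= in_itv/= => tu; rewrite lee_fin step_funE//.
  exact: le_fun_bound.
move=> ig _ cv.
have fi : (\int[lebesgue_measure]_(u in `[t, (t + s)%R[%classic) (h (phi u))%:E)%E \is a fin_num.
  exact: integrable_fin_num ig.
rewrite -(fineK fi) in cv; have := @fine_cvg _ _ _ _ _ _ cv.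
rewrite (_ : fine \o _ = (fun n => riemann h phi t s (2 ^ n))); first by apply.
by apply/funext => n /=; rewrite -Rintegral_step_fun.
Qed.

Lemma primitiveE h phi (t : R) :
  primitive h phi t = \int[lebesgue_measure]_(u in `[0, t]%classic) h (phi u).
Proof.
by rewrite /primitive; congr (Rintegral _ _ _).
Qed.

Lemma primitive0 h phi : primitive h phi 0 = 0.
Proof. by rewrite primitiveE set_itv1 Rintegral_set1. Qed.

Lemma primitiveB h phi (t s : R) : right_cont phi -> 0 <= t -> 0 < s ->
  primitive h phi (t + s) - primitive h phi t =
  \int[lebesgue_measure]_(u in `[t, t + s[%classic) h (phi u).
Proof.
move=> rc t0 s0.
have ts1 : 0 < t + s + 1 by rewrite ltr_wpDl// addr_ge0// ltW.
have ig0 := integrable_path h rc (lexx 0) ts1; rewrite add0r in ig0.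
have ig (a b : itv_bound R) : (BLeft 0 <= a)%O -> (b <= BRight (t + s))%O ->
    lebesgue_measure.-integrable [set` Interval a b] (EFin \o (fun u => h (phi u))).
  move=> a0 bts; apply: integrableS ig0 => //.
  move=> u /=; apply: subitvP; rewrite subitvE a0/=.
  by apply: le_trans bts _; rewrite bnd_simp ltrDl.
rewrite !primitiveE Rintegral_itvB.
- rewrite Rintegral_itv_obnd_cbnd ?Rintegral_itv_bndo_bndc//; apply: ig;
    rewrite ?bnd_simp//.
- by apply: ig; rewrite ?bnd_simp.
- by rewrite bnd_simp.
- by rewrite bnd_simp lerDl ltW.
Qed.

Lemma riemann_cvg h phi (t s : R) : right_cont phi -> 0 <= t -> 0 < s ->
  riemann h phi t s (2 ^ n) @[n --> \oo] --> primitive h phi (t + s) - primitive h phi t.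
Proof. by move=> rc t0 s0; rewrite primitiveB//; exact: riemann_cvg_itv. Qed.

Lemma lebesgue_itv0 (s : R) : 0 <= s ->
  fine (lebesgue_measure (`[0, s]%classic : set R)) = s.
Proof.
move=> s0; rewrite lebesgue_measure_itv/= lte_fin.
case: ltP => [_|s0']; first by rewrite -EFinB subr0.
by apply/eqP; rewrite eq_le s0 s0'.
Qed.

Lemma primitive_cst h phi (s : R) x : 0 <= s -> (forall u, 0 <= u <= s -> phi u = x) ->
  primitive h phi s = s * h x.
Proof.
move=> s0 E; rewrite /primitive.
have -> : \int[lebesgue_measure]_(u in [set u : R | 0 <= u <= s]) h (phi u) =
    \int[lebesgue_measure]_(u in [set u : R | 0 <= u <= s]) h x.
  by apply: eq_Rintegral => u; rewrite inE/= => us; rewrite E.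
rewrite -/(primitive h (fun=> x) s) primitiveE Rintegral_cst//.
by rewrite mulrC; congr (_ * _); exact: lebesgue_itv0.
Qed.

End Paths.

(** * Measurability of the observation process from dyadic times *)

Section ObservationMeasurability.
Context {R : realType} {d : nat} {dis : measure_display} {Omega : measurableType dis}.
Context (X : R -> Omega -> 'I_d) (W : R -> Omega -> R).
Hypothesis rcX : forall w, right_cont (X ^~ w).
Hypothesis cW : forall w, {within [set t : R | 0 <= t], continuous (fun t => W t w)}.
Hypothesis W0 : forall w, W 0 w = 0.
Variable S : set (set Omega).
Hypothesis sS : sigma_algebra setT S.

(** Only [h (X u)] is assumed measurable, not [X u]: the lemma also serves a smaller sigma-algebra
    in which the state is visible only through [h]. *)
Lemma obs_measurable_wrt (h : 'I_d -> R) (T : R) :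
  (forall u, 0 <= u <= T -> measurable_wrt S (fun w => h (X u w))) ->
  (forall u, 0 <= u <= T -> measurable_wrt S (W u)) ->
  forall u, 0 <= u <= T -> measurable_wrt S (obs h X W u).
Proof.
move=> hX hW u uT; apply: wrtD => //; last exact: hW.
case/andP: uT; rewrite le_eqVlt => /predU1P[<- _|u0 uT].
  rewrite (_ : (fun w => _) = (fun=> 0)); first exact: wrt_cst.
  by apply/funext => w; exact: (primitive0 h (X ^~ w)).
apply: (@wrt_cvg _ _ _ _ sS (fun n w => riemann h (X ^~ w) 0 u (2 ^ n))).
  move=> n; apply: wrt_sum => // i.
  have -> : (fun w => h (X (0 + u * i.+1%:R / (2 ^ n)%:R) w) * (u / (2 ^ n)%:R)) =
     (fun w => (u / (2 ^ n)%:R) * h (X (0 + u * i.+1%:R / (2 ^ n)%:R) w)).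
    by apply/funext => w; rewrite mulrC.
  apply: wrtZ => //; apply: hX; rewrite add0r divr_ge0 ?mulr_ge0 ?(ltW u0)//=.
  rewrite (le_trans _ uT)// ler_pdivrMr ?pow2_gt0// ler_pM2l// ler_nat.
  exact: ltn_ord.
move=> w; have := @riemann_cvg _ _ h (X ^~ w) 0 u (rcX w) (lexx 0) u0.
by rewrite add0r primitive0 subr0.
Qed.

Lemma path_dyadic_wrt (k : 'I_d -> R) (T : R) : 0 < T ->
  (forall n i, (i <= 2 ^ n)%N -> measurable_wrt S (fun w => k (X (T * i%:R / (2 ^ n)%:R) w))) ->
  forall u, 0 <= u <= T -> measurable_wrt S (fun w => k (X u w)).
Proof.
move=> T0 kX u /andP[u0]; rewrite le_eqVlt => /predU1P[->|uT].
  by have := kX 0%N 1%N (leqnn _); rewrite expn0 divr1 mulr1.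
apply: (@wrt_cvg _ _ _ _ sS (fun n w => k (X (dyadic_up T u n) w))).
  by move=> n; apply: kX; rewrite dyadic_up_index// u0.
move=> w; apply: cvg_near_cst.
have := right_cont_dyadic (rcX w) (lexx 0) T0 u0.
by apply: filterS => n; rewrite !add0r => ->.
Qed.

Lemma noise_dyadic_wrt (T : R) : 0 < T ->
  (forall n i, (i <= 2 ^ n)%N -> measurable_wrt S (W (T * i%:R / (2 ^ n)%:R))) ->
  forall u, 0 <= u <= T -> measurable_wrt S (W u).
Proof.
move=> T0 mW u /andP[u0]; rewrite le_eqVlt => /predU1P[->|uT].
  by have := mW 0%N 1%N (leqnn _); rewrite expn0 divr1 mulr1.
apply: (@wrt_cvg _ _ _ _ sS (fun n w => W (dyadic_up T u n) w)).
  by move=> n; apply: mW; rewrite dyadic_up_index// u0.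
move=> w; apply: (@cvg_within_ge0 _ (W^~ w) (dyadic_up T u) u) => //; first exact: dyadic_up_cvg.
by move=> n; rewrite ltW// (le_lt_trans u0)// dyadic_up_gt.
Qed.

End ObservationMeasurability.

(** * Cylinder laws and the Markov property of the observed chain *)

Section Model.
Context {R : realType} {d : nat} {dis : measure_display} {Omega : measurableType dis}.
Context (P : probability Omega R) (A : 'M[R]_d) (Rv : R) (rho : 'I_d -> R).
Context (X : R -> Omega -> 'I_d) (W : R -> Omega -> R).
Hypothesis model : wonham_model P A Rv rho X W.

Let mX : forall t x, measurable [set w | X t w = x].
Proof. by case: model. Qed.
Let mW : forall t, measurable_fun setT (W t).
Proof. by case: model => _ []. Qed.
Let W0 : forall w, W 0 w = 0.
Proof. by case: model => _ []. Qed.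
Let cW : forall w, {within [set t : R | 0 <= t], continuous (fun t => W t w)}.
Proof. by case: model. Qed.
Let rcX : forall w, right_cont (X ^~ w).
Proof. by case: model => _ _ _ rc _ w t; exact: rc. Qed.

Definition gauss (s : R) (B : set R) : R := fine (normal_prob 0 (Num.sqrt (Rv * s)) B).

Definition trans (s : R) (x y : 'I_d) : R := expmx (s *: A) x y.

Lemma gauss_fin_num s (B : set R) : measurable B ->
  normal_prob 0 (Num.sqrt (Rv * s)) B \is a fin_num.
Proof.
move=> mB; rewrite ge0_fin_numE ?measure_ge0//.
by apply: (@le_lt_trans _ _ 1%E); [exact: probability_le1|rewrite ltry].
Qed.

Lemma gaussT s : gauss s setT = 1.
Proof. by rewrite /gauss probability_setT. Qed.

Definition grid (n : nat) (tt : nat -> R) :=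
  tt 0%N = 0 /\ forall i, (i < n)%N -> tt i < tt i.+1.

Lemma grid_ge0 n tt : grid n tt -> forall i, (i <= n)%N -> 0 <= tt i.
Proof.
move=> [t0 ti]; elim=> [|i ih] lin; first by rewrite t0.
by apply: le_trans (ih (ltnW lin)) _; rewrite ltW// ti.
Qed.

(** State constraints are sets, so that cylinders on a fixed grid are closed under intersection,
    although the model states the law for point constraints [pt] only. *)
Definition cyl (n : nat) (tt : nat -> R) (D : nat -> set 'I_d) (B : nat -> set R) :
    set Omega :=
  [set w | (forall i, (i <= n)%N -> D i (X (tt i) w)) /\
           (forall i, (i < n)%N -> B i (W (tt i.+1) w - W (tt i) w))].

Definition pt (x : nat -> 'I_d) (i : nat) : set 'I_d := [set x i].

Lemma measurable_state t (D : set 'I_d) : measurable [set w | D (X t w)].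
Proof.
rewrite (_ : [set w | _] = \bigcup_(x in D) [set w | X t w = x]); last first.
  by apply/seteqP; split => [w Dw|w [x Dx /= ->]//]; exists (X t w).
by apply: fin_bigcup_measurable => //; exact: finite_finset.
Qed.

Lemma measurable_incr (s t : R) (B : set R) : measurable B ->
  measurable [set w | B (W t w - W s w)].
Proof.
move=> mB; rewrite -[X in measurable X]setTI.
by apply: (measurable_funB (mW t) (mW s)).
Qed.

Lemma measurable_cyl n tt D B : (forall i, measurable (B i)) -> measurable (cyl n tt D B).
Proof.
move=> mB; rewrite (_ : cyl _ _ _ _ =
   (\bigcap_(i in [set i | (i <= n)%N]) [set w | D i (X (tt i) w)]) `&`
   (\bigcap_(i in [set i | (i < n)%N]) [set w | B i (W (tt i.+1) w - W (tt i) w)])).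
  apply: measurableI; apply: bigcap_measurableType => i _; first exact: measurable_state.
  exact: measurable_incr.
by apply/seteqP; split => w [] H1 H2; split => i ni; [exact: H1|exact: H2|exact: H1|exact: H2].
Qed.

Lemma cyl_law n tt x B : grid n tt -> (forall i, measurable (B i)) ->
  Pr P (cyl n tt (pt x) B) =
  (rho (x 0%N) * \prod_(i < n) trans (tt i.+1 - tt i) (x i) (x i.+1)) *
  \prod_(i < n) gauss (tt i.+1 - tt i) (B i).
Proof.
move=> [t0 ti] mB; apply: EFin_inj; rewrite -PrE; last exact: measurable_cyl.
case: model => _ _ _ _ H; rewrite /cyl /pt/= H// [RHS]EFinM; congr (_ * _)%E.
rewrite -prodEFin; apply: eq_bigr => i _; rewrite /gauss fineK//.
exact: gauss_fin_num.
Qed.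

(** Extends a finite path to all indices, as [cyl] expects; for an index beyond [n] the value is a
    default of [inord] that a cylinder of length [n] never reads. *)
Definition qpath n (q : {ffun 'I_n.+1 -> 'I_d}) (i : nat) : 'I_d := q (inord i).

Lemma Pr_path_partition n tt (E : set Omega) : measurable E ->
  Pr P E = \sum_(q : {ffun 'I_n.+1 -> 'I_d})
    Pr P (E `&` cyl n tt (pt (qpath q)) (fun=> setT)).
Proof.
move=> mE; pose Y w : {ffun 'I_n.+1 -> 'I_d} := [ffun i => X (tt (val i)) w].
have YE q : [set w | Y w = q] = cyl n tt (pt (qpath q)) (fun=> setT).
  apply/seteqP; split => w /=.
    by move=> <-; split => // i ni; rewrite /pt /qpath ffunE/= inordK.
  move=> [H _]; apply/ffunP => i; rewrite ffunE.
  by have := H (val i) (leq_ord i); rewrite /pt /qpath/= inord_val.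
rewrite (@Pr_partition _ _ _ P _ Y E mE); last first.
  by move=> q; rewrite YE; exact: measurable_cyl.
by apply: eq_bigr => q _; rewrite YE.
Qed.

Lemma cylI n tt D B D' B' : cyl n tt D B `&` cyl n tt D' B' =
  cyl n tt (fun i => D i `&` D' i) (fun i => B i `&` B' i).
Proof.
apply/seteqP; split => w /=.
  move=> [[H1 H2] [H3 H4]]; split => i ni; split;
  [exact: H1|exact: H3|exact: H2|exact: H4].
move=> [H1 H2]; split; split => i ni; have := H1 i; have := H2 i; move=> H2i H1i;
  by [case: (H1i ni)|case: (H2i ni)].
Qed.

Lemma cylT n tt : cyl n tt (fun=> setT) (fun=> setT) = setT.
Proof. by apply/seteqP; split. Qed.

Lemma cyl_path n tt x : grid n tt ->
  Pr P (cyl n tt (pt x) (fun=> setT)) =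
  rho (x 0%N) * \prod_(i < n) trans (tt i.+1 - tt i) (x i) (x i.+1).
Proof.
by move=> g; rewrite cyl_law// [X in _ * X]big1 ?mulr1// => i _; exact: gaussT.
Qed.

Lemma cyl_factor n tt x B : grid n tt -> (forall i, measurable (B i)) ->
  Pr P (cyl n tt (pt x) B) = Pr P (cyl n tt (pt x) (fun=> setT)) *
  \prod_(i < n) gauss (tt i.+1 - tt i) (B i).
Proof. by move=> g mB; rewrite cyl_path// cyl_law. Qed.

Lemma noise_law n tt B : grid n tt -> (forall i, measurable (B i)) ->
  Pr P (cyl n tt (fun=> setT) B) = \prod_(i < n) gauss (tt i.+1 - tt i) (B i).
Proof.
move=> g mB; rewrite (Pr_path_partition n tt); last exact: measurable_cyl.
under eq_bigr => q _.
  rewrite cylI.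
  rewrite (_ : cyl _ _ _ _ = cyl n tt (pt (qpath q)) B); last first.
    by congr cyl; apply/funext => i; [rewrite setTI|rewrite setIT].
  rewrite cyl_factor//.
  over.
rewrite -mulr_suml.
suff -> : \sum_(q : {ffun 'I_n.+1 -> 'I_d}) Pr P (cyl n tt (pt (qpath q)) (fun=> setT)) = 1.
  by rewrite mul1r.
rewrite -(PrT P) (Pr_path_partition n tt)//.
by apply: eq_bigr => q _; rewrite setTI.
Qed.

Definition noise_gen n tt : set (set Omega) :=
  [set E | exists B, (forall i, measurable (B i)) /\ E = cyl n tt (fun=> setT) B].

(** The extension to the generated sigma-algebra matters because a total increment over several grid
    steps is a sum of grid increments, hence not a cylinder condition. *)
Lemma noise_indep n tt x H : grid n tt -> <<s noise_gen n tt >> H ->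
  Pr P (H `&` cyl n tt (pt x) (fun=> setT)) =
  Pr P (cyl n tt (pt x) (fun=> setT)) * Pr P H.
Proof.
move=> g sH; set Q := cyl n tt (pt x) _.
have mQ : measurable Q by exact: measurable_cyl.
rewrite -[LHS]mul1r -[in RHS](setIT H); move: H sH; apply: pi_lambda_eq => //.
- move=> E E' [B [mB ->]] [B' [mB' ->]]; exists (fun i => B i `&` B' i); split.
    by move=> i; exact: measurableI.
  by rewrite cylI; congr cyl; apply/funext => i; rewrite setTI.
- by move=> E [B [mB ->]]; exact: measurable_cyl.
- by rewrite PrT mulr1 mul1r.
- move=> E [B [mB ->]]; rewrite setIT noise_law// mul1r cylI.
  rewrite (_ : cyl _ _ _ _ = cyl n tt (pt x) B); last first.
    by congr cyl; apply/funext => i; [rewrite setTI|rewrite setIT].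
  by rewrite cyl_factor.
Qed.

Lemma noise_gen_incr n tt i : (i < n)%N ->
  measurable_wrt <<s noise_gen n tt >> (fun w => W (tt i.+1) w - W (tt i) w).
Proof.
move=> ni B mB; apply: sub_sigma_algebra.
exists (fun j => if j == i then B else setT); split.
  by move=> j; case: ifP.
apply/seteqP; split => w /=.
  by move=> Bw; split => // j nj; case: eqP => // ->.
by move=> [_ /(_ i ni)]; rewrite eqxx.
Qed.

Lemma noise_gen_total n tt k m : (k + m <= n)%N ->
  measurable_wrt <<s noise_gen n tt >> (fun w => W (tt (k + m)%N) w - W (tt k) w).
Proof.
elim: m => [_|m ih kmn].
  rewrite addn0 (_ : (fun w => _) = (fun=> 0)); last by apply/funext => w; rewrite subrr.
  by apply: wrt_cst; exact: sigma_algebra_gen.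
rewrite (_ : (fun w => _) = (fun w => (W (tt (k + m).+1) w - W (tt (k + m)%N) w) +
   (W (tt (k + m)%N) w - W (tt k) w))); last first.
  by apply/funext => w; rewrite addnS; ring.
apply: wrtD; first exact: sigma_algebra_gen.
  by apply: noise_gen_incr; rewrite -addnS.
by apply: ih; rewrite addnS in kmn; exact: ltnW.
Qed.

Lemma sa_forall (S : set (set Omega)) (F : nat -> set Omega) (p : pred nat) :
  sigma_algebra setT S -> (forall i, p i -> S (F i)) -> S [set w | forall i, p i -> F i w].
Proof.
move=> sS SF.
rewrite (_ : [set w | _] = \bigcap_i (if p i then F i else setT)); last first.
  apply/seteqP; split => w /= H i; first by case: ifP => // /H.
  by move=> pi; have := H i I; rewrite pi.
apply: sa_bigcap => // i; case: ifPn => [/SF//|_]; exact: saT.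
Qed.

(** * Grids prolonged by a uniformly subdivided time step *)

Section Future.
Variables (n : nat) (tt : nat -> R) (s : R) (m : nat).
Hypotheses (g : grid n tt) (s0 : 0 < s) (m0 : (0 < m)%N).

Definition joined (i : nat) : R :=
  if (i <= n)%N then tt i else tt n + s * (i - n)%:R / m%:R.

Let m0R : 0 < m%:R :> R. Proof. by rewrite ltr0n. Qed.

Lemma joined_right j : joined (n + j) = tt n + s * j%:R / m%:R.
Proof.
rewrite /joined; case: ifPn => [|_]; last by rewrite addKn.
by rewrite -[leqRHS]addn0 leq_add2l leqn0 => /eqP ->; rewrite addn0 mulr0 mul0r addr0.
Qed.

Lemma joined_left i : (i <= n)%N -> joined i = tt i.
Proof. by rewrite /joined => ->. Qed.

Lemma joined_step j : joined (n + j).+1 - joined (n + j) = s / m%:R.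
Proof. by rewrite -addnS !joined_right -natr1; ring. Qed.

Lemma joined_grid : grid (n + m) joined.
Proof.
split; first by rewrite /joined leq0n; case: g.
move=> i im; have [ni|ni] := ltnP i n.
  by rewrite !joined_left ?(ltnW ni)//; case: g => _; exact.
rewrite -subr_gt0 -(subnKC ni) joined_step divr_gt0//.
Qed.

Definition future_path (p : nat -> 'I_d) : set Omega :=
  [set w | forall j, (j <= m)%N -> X (tt n + s * j%:R / m%:R) w = p j].

Lemma future_law x p B C : p 0%N = x n -> (forall i, measurable (B i)) -> measurable C ->
  Pr P (cyl n tt (pt x) B `&` future_path p `&` [set w | C (W (tt n + s) w - W (tt n) w)]) =
  Pr P (cyl n tt (pt x) B) * (\prod_(j < m) trans (s / m%:R) (p j) (p j.+1) * gauss s C).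
Proof.
move=> p0 mB mC.
pose x' i := if (i <= n)%N then x i else p (i - n)%N.
have x'l i : (i <= n)%N -> x' i = x i by rewrite /x' => ->.
have x'r j : x' (n + j)%N = p j.
  rewrite /x'; case: ifPn => [|_]; last by rewrite addKn.
  by rewrite -[leqRHS]addn0 leq_add2l leqn0 => /eqP ->; rewrite addn0.
pose H := cyl n tt (fun=> setT) B `&` [set w | C (W (tt n + s) w - W (tt n) w)].
have -> : cyl n tt (pt x) B `&` future_path p `&` [set w | C (W (tt n + s) w - W (tt n) w)]
    = H `&` cyl (n + m) joined (pt x') (fun=> setT).
  apply/seteqP; split => w.
    move=> [[[H1 H2] H3] H4]; split; first by split => //; split.
    split => // i inm; rewrite /pt/=; have [ni|ni] := leqP i n.
      by rewrite joined_left// x'l//; exact: H1.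
    rewrite -(subnKC (ltnW ni)) joined_right x'r; apply: H3.
    by rewrite leq_subLR.
  move=> [[[_ H2] H4] [H1 _]]; split => //; split.
    split => // i ni; have := H1 i (leq_trans ni (leq_addr _ _)).
    by rewrite /pt/= joined_left// x'l.
  move=> j jm; have := H1 (n + j)%N; rewrite leq_add2l => /(_ jm).
  by rewrite /pt/= joined_right x'r.
have g' := joined_grid.
have tE : tt n + s = joined (n + m) by rewrite joined_right mulfK// gt_eqF.
have tE0 : tt n = joined n by rewrite joined_left.
rewrite noise_indep//; last first.
  have sa := sigma_algebra_gen (noise_gen (n + m) joined).
  apply: (saI sa).
    rewrite (_ : cyl _ _ _ _ = [set w | forall i, (i < n)%N ->
       [set w | B i (W (joined i.+1) w - W (joined i) w)] w]).
      apply: sa_forall => // i ni; apply: (noise_gen_incr (n := (n + m)%N)) => //.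
      by rewrite (leq_trans ni)// leq_addr.
    apply/seteqP; split => w /=.
      by move=> [_ H1] i ni; rewrite !joined_left ?(ltnW ni)//; exact: H1.
    by move=> H1; split => // i ni; have := H1 i ni; rewrite !joined_left ?(ltnW ni).
  by rewrite tE tE0; apply: (noise_gen_total (leqnn _)).
(* The noise law is read off on a coarser grid whose last step has length [s]. The total increment
   is then directly normal with variance [Rv * s], and no convolution of [m] Gaussians is needed. *)
pose tt2 i := if (i <= n)%N then tt i else tt n + s.
pose B2 i := if (i < n)%N then B i else C.
have g2 : grid n.+1 tt2.
  split; first by rewrite /tt2 leq0n; case: g.
  move=> i; rewrite ltnS leq_eqVlt => /predU1P[->|ni].
    by rewrite /tt2 leqnn ltnn ltrDl.
  by rewrite /tt2 ni (ltnW ni); case: g => _; exact.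
have -> : H = cyl n.+1 tt2 (fun=> setT) B2.
  apply/seteqP; split => w.
    move=> [[_ H1] H2]; split => // i; rewrite ltnS leq_eqVlt => /predU1P[->|ni].
      by rewrite /B2 /tt2 ltnn leqnn.
    by rewrite /B2 /tt2 ni (ltnW ni); exact: H1.
  move=> [_ H1]; split; last first.
    by have := H1 n (ltnSn _); rewrite /B2 /tt2 ltnn leqnn.
  split => // i ni; have := H1 i (ltnW ni).
  by rewrite /B2 /tt2 ni (ltnW ni).
rewrite noise_law//; last by move=> i; rewrite /B2; case: ifP.
rewrite cyl_path// cyl_law// big_split_ord/= x'l// big_ord_recr/=.
rewrite /B2 /tt2 ltnn leqnn addrAC subrr add0r.
rewrite (eq_bigr (fun i : 'I_n => trans (tt i.+1 - tt i) (x i) (x i.+1))); last first.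
  by move=> i _; rewrite !joined_left ?x'l ?(ltnW (ltn_ord i)).
rewrite [X in _ * (_ * X) * _](eq_bigr (fun j : 'I_m => trans (s / m%:R) (p j) (p j.+1))); last first.
  by move=> j _; rewrite joined_step -addnS !x'r.
rewrite [X in _ * (X * _)](eq_bigr (fun i : 'I_n => gauss (tt i.+1 - tt i) (B i))); last first.
  by move=> i _; rewrite (ltn_ord i) (ltnW (ltn_ord i)).
by ring.
Qed.

End Future.

Lemma path_noise_law n tt s m q C : grid n tt -> 0 < s -> (0 < m)%N -> measurable C ->
  Pr P (cyl (n + m) (joined n tt s m) (pt q) (fun=> setT) `&`
        [set w | C (W (tt n + s) w - W (tt n) w)]) =
  Pr P (cyl (n + m) (joined n tt s m) (pt q) (fun=> setT)) * gauss s C.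
Proof.
move=> g s0 m0 mC; have E0 := @future_law n tt s m g s0 m0 q (fun j => q (n + j)%N) (fun=> setT).
have cE : cyl (n + m) (joined n tt s m) (pt q) (fun=> setT) =
    cyl n tt (pt q) (fun=> setT) `&` future_path n tt s m (fun j => q (n + j)%N).
  apply/seteqP; split => w.
    move=> [H _]; split.
      split => // i ni; have := H i (leq_trans ni (leq_addr _ _)).
      by rewrite /pt/= joined_left.
    move=> j jm; have := H (n + j)%N; rewrite leq_add2l => /(_ jm).
    by rewrite /pt/= joined_right.
  move=> [[H1 _] H2]; split => // i inm; rewrite /pt/=; have [ni|ni] := leqP i n.
    by rewrite joined_left//; exact: H1.
  rewrite -(subnKC (ltnW ni)) joined_right; apply: H2.
  by rewrite leq_subLR.
have := E0 setT; rewrite (_ : [set w | setT _] = setT)// setIT -cE gaussT mulr1 => -> //; last first.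
  by rewrite addn0.
by rewrite cE E0 ?addn0// mulrA.
Qed.

Definition riem_obs (h : 'I_d -> R) (t s : R) (m : nat) (w : Omega) : R :=
  riemann h (X ^~ w) t s m + (W (t + s) w - W t w).

Definition obs_incr (h : 'I_d -> R) (t s : R) (w : Omega) : R :=
  obs h X W (t + s) w - obs h X W t w.

Lemma riem_obs_cvg h t s w : 0 <= t -> 0 < s ->
  riem_obs h t s (2 ^ n) w @[n --> \oo] --> obs_incr h t s w.
Proof.
move=> t0 s0; rewrite (_ : obs_incr h t s w =
  (primitive h (X ^~ w) (t + s) - primitive h (X ^~ w) t) + (W (t + s) w - W t w)).
  by apply: cvgD; [exact: riemann_cvg|exact: cvg_cst].
by rewrite /obs_incr /obs /primitive; ring.
Qed.

Definition riem_val (h : 'I_d -> R) (s : R) (m : nat) (p : nat -> 'I_d) : R :=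
  \sum_(i < m) h (p i.+1) * (s / m%:R).

Lemma riem_obs_path h n tt s m p w : future_path n tt s m p w ->
  riem_obs h (tt n) s m w = riem_val h s m p + (W (tt n + s) w - W (tt n) w).
Proof.
move=> H; rewrite /riem_obs /riemann /riem_val; congr (_ + _).
by apply: eq_bigr => i _; rewrite H.
Qed.

Lemma measurable_riemann h t s m : measurable_fun setT (fun w => riemann h (X ^~ w) t s m).
Proof.
apply: measurable_sum => i; apply: measurable_funM => //.
move=> _ B mB; rewrite setTI.
exact: (measurable_state _ [set x | B (h x)]).
Qed.

Lemma measurable_riem_obs h t s m : measurable_fun setT (riem_obs h t s m).
Proof.
apply: measurable_funD; first exact: measurable_riemann.
exact: measurable_funB.
Qed.

Lemma measurable_shift (a : R) (C : set R) : measurable C -> measurable [set z | C (a + z)].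
Proof.
move=> mC; rewrite -[X in measurable X]setTI.
by apply: (@measurable_funD _ _ _ setT (cst a) id).
Qed.

(** The joint transition kernel of the state and the discretised observation increment: once the
    path [q] is fixed, the increment is a Gaussian shifted by [riem_val], so the condition [C]
    becomes a shifted condition on the noise. *)
Definition kern (h : 'I_d -> R) (s : R) (m : nat) (C : set R) (x y : 'I_d) : R :=
  \sum_(q : {ffun 'I_m.+1 -> 'I_d} | (qpath q 0%N == x) && (qpath q m == y))
    \prod_(j < m) trans (s / m%:R) (qpath q j) (qpath q j.+1) *
    gauss s [set z | C (riem_val h s m (qpath q) + z)].

Lemma future_kern h n tt s m x B C y : grid n tt -> 0 < s -> (0 < m)%N ->
  (forall i, measurable (B i)) -> measurable C ->
  Pr P (cyl n tt (pt x) B `&` [set w | C (riem_obs h (tt n) s m w)] `&`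
        [set w | X (tt n + s) w = y]) =
  Pr P (cyl n tt (pt x) B) * kern h s m C (x n) y.
Proof.
move=> g s0 m0 mB mC; set E := cyl n tt (pt x) B.
have mE : measurable E by exact: measurable_cyl.
have mR : measurable [set w | C (riem_obs h (tt n) s m w)].
  rewrite -[X in measurable X]setTI; exact: measurable_riem_obs.
have m0R : m%:R != 0 :> R by rewrite pnatr_eq0 -lt0n.
have fpE q : cyl m (fun j => tt n + s * j%:R / m%:R) (pt (qpath q)) (fun=> setT) =
    future_path n tt s m (qpath q).
  by apply/seteqP; split => w; [case|].
rewrite (Pr_path_partition m (fun j => tt n + s * j%:R / m%:R)); last first.
  by apply: measurableI; [exact: measurableI|exact: mX].
rewrite /kern mulr_sumr [RHS]big_mkcond/=; apply: eq_bigr => q _.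
rewrite fpE; case: ifPn => [/andP[/eqP q0 /eqP qm]|].
  rewrite (_ : _ `&` _ `&` _ `&` _ = E `&` future_path n tt s m (qpath q) `&`
     [set w | [set z | C (riem_val h s m (qpath q) + z)] (W (tt n + s) w - W (tt n) w)]).
    by rewrite future_law//; exact: measurable_shift.
  apply/seteqP; split => w /=.
    move=> [[[Ew Cw] Xw] Fw]; by split => //; rewrite -(riem_obs_path _ Fw).
  move=> [[Ew Fw] Cw]; split => //; split; first by rewrite (riem_obs_path _ Fw).
  by have := Fw m (leqnn _); rewrite mulfK// qm.
move=> ne; rewrite (_ : _ `&` _ = set0) ?Pr0//; apply/seteqP; split => w //=.
move=> [[[[Ew _] _] Xw] Fw]; move/negP: ne; apply.
have := Fw m (leqnn _); rewrite mulfK// Xw => ->.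
have := Fw 0%N (leq0n _); rewrite mulr0 mul0r addr0 => <-.
by rewrite (Ew n (leqnn _)) !eqxx.
Qed.

(** * Gaussian estimates and the sign of an observation increment *)

Hypothesis Rv0 : 0 < Rv.
Hypothesis rho0 : forall x, 0 < rho x.

Definition peak (s : R) : R := normal_peak (Num.sqrt (Rv * s)).

Lemma sqrt_Rv_neq0 s : 0 < s -> Num.sqrt (Rv * s) != 0.
Proof. by move=> s0; rewrite gt_eqF// sqrtr_gt0 mulr_gt0. Qed.

Lemma peak_gt0 s : 0 < s -> 0 < peak s.
Proof. by move=> s0; rewrite normal_peak_gt0// sqrt_Rv_neq0. Qed.

Lemma peak_ge0 s : 0 <= peak s.
Proof. exact: normal_peak_ge0. Qed.

(** The tangent bound exp(-u) >= 1 - u applied to the Gaussian exponent. *)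
Lemma normal_pdf_lower s b z : 0 < s -> `|z| <= b ->
  peak s * (1 - b ^+ 2 / (2 * Rv * s)) <= normal_pdf 0 (Num.sqrt (Rv * s)) z.
Proof.
move=> s0 zb; rewrite normal_pdfE ?sqrt_Rv_neq0// /normal_fun -/(peak s).
rewrite ler_wpM2l ?peak_ge0//; apply: le_trans (expR_ge1Dx _).
rewrite lerD2l subr0 sqr_sqrtr ?mulr_ge0 ?(ltW Rv0) ?(ltW s0)// mulNr lerN2.
rewrite -mulr_natl mulrA ler_wpM2r//.
  by rewrite invr_ge0 !mulr_ge0// ltW.
by rewrite -[z ^+ 2]real_normK ?num_real// ler_sqr ?nnegrE// (le_trans _ zb).
Qed.

Lemma lebesgue_itv_oc (a b : R) : a <= b ->
  lebesgue_measure (`]a, b]%classic : set R) = (b - a)%:E.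
Proof.
move=> ab; apply: (etrans (lebesgue_measure_itv _)) => /=; rewrite lte_fin.
case: ltP => [_|ba]; first by rewrite -EFinB.
by rewrite (@le_anti _ _ a b) ?ab// subrr.
Qed.

Lemma gauss_itv_upper s (a b : R) : 0 < s -> a <= b ->
  gauss s `]a, b]%classic <= peak s * (b - a).
Proof.
move=> s0 ab; rewrite -lee_fin /gauss fineK; last exact: gauss_fin_num.
rewrite EFinM -lebesgue_itv_oc// -integral_cst// /normal_prob.
apply: ge0_le_integral => //.
- by move=> x _; rewrite lee_fin normal_pdf_ge0.
- apply/measurable_EFinP; apply: measurable_funTS; exact: measurable_normal_pdf.
- by move=> x _; rewrite lee_fin normal_pdf_ub// sqrt_Rv_neq0.
Qed.

Lemma integrable_pdf s (D : set R) : measurable D ->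
  lebesgue_measure.-integrable D (EFin \o normal_pdf 0 (Num.sqrt (Rv * s))).
Proof.
move=> mD; apply: integrableS (integrable_normal_pdf 0 (Num.sqrt (Rv * s))) => //.
Qed.

Lemma gauss_itv_lower s (a b c : R) : 0 < s -> a <= b -> (forall z, a < z <= b -> `|z| <= c) ->
  peak s * (1 - c ^+ 2 / (2 * Rv * s)) * (b - a) <= gauss s `]a, b]%classic.
Proof.
move=> s0 ab zc; rewrite -lee_fin /gauss fineK; last exact: gauss_fin_num.
rewrite EFinM -lebesgue_itv_oc// -integral_cst// /normal_prob.
apply: le_integral => //.
- apply: (@measurable_bounded_integrable _ _ _ _ (cst (peak s * (1 - c ^+ 2 / (2 * Rv * s))))) => //.
    by have := lebesgue_itv_oc ab; rewrite /= => ->; rewrite ltry.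
  exists `|peak s * (1 - c ^+ 2 / (2 * Rv * s))|; split; first exact: num_real.
  by move=> M hM u _ /=; exact: ltW.
- exact: integrable_pdf.
- move=> z; rewrite inE/= in_itv/= => az; rewrite lee_fin.
  by apply: normal_pdf_lower => //; exact: zc.
Qed.

Lemma le_gauss s (B B' : set R) : measurable B -> measurable B' -> B `<=` B' ->
  gauss s B <= gauss s B'.
Proof.
move=> mB mB' BB'; rewrite -lee_fin /gauss !fineK; try exact: gauss_fin_num.
by apply: le_measure => //; rewrite inE.
Qed.

Lemma gaussU s (B B' : set R) : measurable B -> measurable B' -> B `&` B' = set0 ->
  gauss s (B `|` B') = gauss s B + gauss s B'.
Proof.
move=> mB mB' BB'; apply: EFin_inj; rewrite EFinD /gauss !fineK;
  try by apply: gauss_fin_num => //; exact: measurableU.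
by rewrite measureU.
Qed.

(** The noise values for which drift [a] plus noise is positive. *)
Definition half (a : R) : set R := [set z | 0 < a + z].

Lemma halfE a : half a = `]- a, +oo[%classic.
Proof. by apply/seteqP; split => z; rewrite /half/= in_itv/= andbT -ltrBlDl sub0r. Qed.

Lemma measurable_half a : measurable (half a).
Proof. by rewrite halfE; exact: measurable_itv. Qed.

Lemma gauss_half_split s (a b : R) : a <= b ->
  gauss s (half b) = gauss s (half a) + gauss s `]- b, - a]%classic.
Proof.
move=> ab; rewrite -gaussU ?measurable_itv//; last 2 first.
- exact: measurable_half.
- apply/seteqP; split => z //=; rewrite in_itv/= /half/=.
  by move=> [+ /andP[_]]; rewrite -ltrBlDl sub0r => /lt_le_trans /[apply]; rewrite ltxx.
congr (gauss s _); apply/seteqP; split => z; rewrite /half/= in_itv/=.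
  move=> bz; have [az|az] := ltP 0 (a + z); [by left|right].
  by rewrite -ltrBlDl sub0r in bz; rewrite bz/= -lerBrDl sub0r in az *.
move=> [az|/andP[bz _]]; first by rewrite (lt_le_trans az)// lerD2r.
by rewrite -ltrBlDl sub0r.
Qed.

(** The two half-lines differ by an interval of length [|a|] with 0 as an endpoint, on which the
    density lies between [peak s * (1 - a ^+ 2 / (2 * Rv * s))] and [peak s]. For [a] proportional
    to s the linear term has order sqrt(s) and the error order s^(3/2). *)
Lemma gauss_half_expansion s a : 0 < s ->
  `|gauss s (half a) - gauss s (half 0) - peak s * a| <=
  peak s * `|a| * (a ^+ 2 / (2 * Rv * s)).
Proof.
move=> s0; have pk := peak_ge0 s.
have c0 : 0 <= a ^+ 2 / (2 * Rv * s) by rewrite divr_ge0 ?sqr_ge0// !mulr_ge0// ltW.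
have [a0|a0] := leP 0 a.
- rewrite (gauss_half_split s a0) oppr0.
  have na : - a <= 0 by rewrite oppr_le0.
  have up := gauss_itv_upper s0 na.
  have lo : peak s * (1 - a ^+ 2 / (2 * Rv * s)) * (0 - - a) <= gauss s `]- a, 0]%classic.
    apply: gauss_itv_lower => // z /andP[z1 z2]; rewrite ler_norml ltW//=.
    exact: le_trans z2 a0.
  rewrite sub0r opprK in up lo; rewrite (ger0_norm a0); move: up lo.
  move: (gauss s `]- a, 0]%classic) (gauss s (half 0)) => I h0.
  have -> : h0 + I - h0 - peak s * a = I - peak s * a by ring.
  by rewrite ler_norml => up lo; apply/andP; split; nra.
- have ale := ltW a0.
  rewrite (gauss_half_split s ale) oppr0.
  have na : 0 <= - a by rewrite oppr_ge0.
  have up := gauss_itv_upper s0 na.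
  have lo : peak s * (1 - (- a) ^+ 2 / (2 * Rv * s)) * (- a - 0) <= gauss s `]0, - a]%classic.
    apply: gauss_itv_lower => // z /andP[z1 z2]; rewrite ger0_norm// ltW//.
  rewrite subr0 sqrrN in up lo; rewrite (ltr0_norm a0); move: up lo.
  move: (gauss s `]0, - a]%classic) (gauss s (half a)) => I h0.
  have -> : h0 - (h0 + I) - peak s * a = - I - peak s * a by ring.
  by rewrite ler_norml => up lo; apply/andP; split; nra.
Qed.

Lemma grid_to t : 0 <= t -> exists n tt, grid n tt /\ tt n = t.
Proof.
rewrite le_eqVlt => /predU1P[<-|t0]; first by exists 0%N, (fun=> 0); split.
exists 1%N, (fun i => if i == 0%N then 0 else t); split => //.
by split => // -[|i].
Qed.

(** Given the states on the grid, the quantity is a shifted Gaussian, whose density is at most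
    [peak s] whatever the shift. The bound does not depend on [m] and therefore survives
    refinement. *)
Lemma riem_obs_small h t s m e : 0 <= t -> 0 < s -> (0 < m)%N -> 0 < e ->
  Pr P [set w | `|riem_obs h t s m w| < e] <= peak s * (2 * e).
Proof.
move=> t0 s0 m0 e0; have [n [tt [g <-]]] := grid_to t0.
pose C : set R := [set z | `|z| < e].
have mC : measurable C.
  rewrite (_ : C = `]- e, e[%classic); first exact: measurable_itv.
  by apply/seteqP; split => z; rewrite /C/= in_itv/= ltr_norml.
have mE : measurable [set w | C (riem_obs h (tt n) s m w)].
  rewrite -[X in measurable X]setTI; exact: measurable_riem_obs.
rewrite (Pr_path_partition (n + m) (joined n tt s m) mE).
apply: (@le_trans _ _ (\sum_(q : {ffun 'I_(n + m).+1 -> 'I_d})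
   Pr P (cyl (n + m) (joined n tt s m) (pt (qpath q)) (fun=> setT)) * (peak s * (2 * e)))).
  apply: ler_sum => q _; set Q := cyl _ _ _ _.
  pose p j := qpath q (n + j)%N.
  have Qp w : Q w -> future_path n tt s m p w.
    move=> [H _] j jm; have := H (n + j)%N; rewrite leq_add2l => /(_ jm).
    by rewrite /pt/= joined_right.
  rewrite (_ : _ `&` Q = Q `&`
     [set w | [set z | C (riem_val h s m p + z)] (W (tt n + s) w - W (tt n) w)]); last first.
    apply/seteqP; split => w /= [H1 H2]; split => //.
      by rewrite -(riem_obs_path _ (Qp _ H2)).
    by rewrite (riem_obs_path _ (Qp _ H1)).
  rewrite path_noise_law//; last exact: measurable_shift.
  rewrite ler_wpM2l ?Pr_ge0//; set a := riem_val _ _ _ _.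
  have ae : - e - a <= e - a by rewrite lerD2r; lra.
  apply: le_trans (_ : gauss s `](- e - a), (e - a)]%classic <= _).
    apply: le_gauss; [exact: measurable_shift|exact: measurable_itv|].
    by move=> z; rewrite /C/= in_itv/= ltr_norml => /andP[z1 z2]; apply/andP; split; lra.
  apply: le_trans (gauss_itv_upper s0 ae) _; rewrite ler_wpM2l ?peak_ge0//; lra.
rewrite -mulr_suml ler_piMl// ?mulr_ge0 ?peak_ge0 ?(ltW e0)//.
rewrite -(PrT P) [leRHS](Pr_path_partition (n + m) (joined n tt s m))//.
by under [leRHS]eq_bigr do rewrite setTI.
Qed.

Lemma measurable_obs_incr h t s : 0 <= t -> 0 < s -> measurable_fun setT (obs_incr h t s).
Proof.
move=> t0 s0.
apply: (@measurable_fun_cvg _ _ _ _ (fun n => riem_obs h t s (2 ^ n))).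
  by move=> n; exact: measurable_riem_obs.
by move=> w _; exact: riem_obs_cvg.
Qed.

(** Where the increment vanishes, all sufficiently fine Riemann approximations are below any given
    [dl], an event of probability at most [peak s * (2 * dl)]. This controls the boundary of the
    half-line in [obsC]. *)
Lemma obs_incr_no_atom h t s : 0 <= t -> 0 < s ->
  P.-negligible [set w | obs_incr h t s w = 0].
Proof.
move=> t0 s0; set N := [set w | _].
have mN : measurable N.
  rewrite -[N]setTI; have := measurable_obs_incr h t0 s0.
  by move=> /(_ measurableT [set 0]); apply; exact: measurable_set1.
suff N0 : Pr P N = 0 by apply/negligibleP => //; have := PrE P mN; rewrite N0.
apply/eqP; rewrite eq_le Pr_ge0 andbT; apply/ler_addgt0Pr => e e0; rewrite add0r.
pose dl := e / (2 * peak s).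
have pk := peak_gt0 s0.
have dl0 : 0 < dl by rewrite divr_gt0// mulr_gt0.
have -> : e = peak s * (2 * dl) by rewrite /dl; field; rewrite gt_eqF.
pose F r := [set w | `|riem_obs h t s (2 ^ r) w| < dl].
have mF r : measurable (F r).
  rewrite (_ : F r = riem_obs h t s (2 ^ r) @^-1` `]- dl, dl[%classic); last first.
    by apply/seteqP; split => w; rewrite /F/= in_itv/= ltr_norml.
  by rewrite -[X in measurable X]setTI; apply: measurable_riem_obs.
pose G n := \bigcap_(r in [set r | (n <= r)%N]) F r.
have mG n : measurable (G n) by apply: bigcap_measurableType => r _.
apply: (@le_trans _ _ (Pr P (\bigcup_n G n))).
  apply: le_Pr => //; first exact: bigcup_measurable.
  move=> w Nw; have := @riem_obs_cvg h t s w t0 s0.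
  rewrite Nw => /cvgrPdist_lt/(_ _ dl0)[n _ H]; exists n => // r nr.
  by have := H r nr; rewrite sub0r normrN.
have nd n k : (n <= k)%N -> G n `<=` G k.
  by move=> nk w Gw r /= kr; apply: Gw => /=; exact: leq_trans kr.
apply: (ler_cvg_to (cvg_Pr_nd mG nd) (cvg_cst (peak s * (2 * dl)))); near=> n.
apply: le_trans (riem_obs_small h t0 s0 (_ : 0 < 2 ^ n)%N dl0); last by rewrite expn_gt0.
by apply: (le_Pr P (mG n) (mF n)) => w; apply => /=.
Unshelve. all: by end_near. Qed.

(** Two events are enough: without a constraint the kernel leads to [A], with positivity it leads to
    [h]. *)
Definition obsC (b : bool) : set R := if b then [set z | 0 < z] else setT.

Lemma measurable_obsC b : measurable (obsC b).
Proof.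
case: b => //=; rewrite (_ : [set z | 0 < z] = `]0, +oo[%classic); first exact: measurable_itv.
by apply/seteqP; split => z /=; rewrite in_itv/= andbT.
Qed.

Lemma riem_obs_event_cvg h b t s (E F : set Omega) : 0 <= t -> 0 < s ->
  measurable E -> measurable F ->
  Pr P (E `&` [set w | obsC b (riem_obs h t s (2 ^ n) w)] `&` F) @[n --> \oo] -->
  Pr P (E `&` [set w | obsC b (obs_incr h t s w)] `&` F).
Proof.
move=> t0 s0 mE mF; have mb := measurable_obsC b.
apply: (cvg_Pr_ae _ _ (obs_incr_no_atom h t0 s0)).
- move=> n; apply: measurableI => //; apply: measurableI => //.
  by rewrite -[X in measurable X]setTI; apply: measurable_riem_obs.
- apply: measurableI => //; apply: measurableI => //.
  by rewrite -[X in measurable X]setTI; apply: measurable_obs_incr.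
move=> w /= /eqP nw; case: b {mb} => /=; last by apply: nearW => n.
have cv := @riem_obs_cvg h t s w t0 s0.
have [pos|neg] := ltP 0 (obs_incr h t s w).
  have /cvgrPdist_lt/(_ _ pos) := cv; apply: filterS => n; rewrite ltr_norml => /andP[_ H].
  by have -> : 0 < riem_obs h t s (2 ^ n) w by lra.
have {}neg : 0 < - obs_incr h t s w by rewrite oppr_gt0 lt_neqAle nw.
have /cvgrPdist_lt/(_ _ neg) := cv; apply: filterS => n; rewrite ltr_norml => /andP[H _].
by have -> : (0 < riem_obs h t s (2 ^ n) w) = false by apply/negbTE; rewrite -leNgt; lra.
Qed.

(* The division by rho x conditions on X_0 = x; [b] says whether the observation
   increment is also required to be positive. *)
Definition obs_kern (h : 'I_d -> R) (b : bool) (s : R) (x y : 'I_d) : R :=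
  Pr P ([set w | X 0 w = x] `&` [set w | obsC b (obs_incr h 0 s w)] `&`
        [set w | X s w = y]) / rho x.

(** Time homogeneity comes from the discretisation: [kern] is the same after [tt n] as after time 0,
    and both sides converge as the subdivision is refined. This identifies the limiting kernel with
    the one defined at time 0. *)
Lemma markov_cyl h b n tt x B s y : grid n tt -> 0 < s -> (forall i, measurable (B i)) ->
  Pr P (cyl n tt (pt x) B `&` [set w | obsC b (obs_incr h (tt n) s w)] `&`
        [set w | X (tt n + s) w = y]) =
  Pr P (cyl n tt (pt x) B) * obs_kern h b s (x n) y.
Proof.
move=> g s0 mB; have tn0 := grid_ge0 g (leqnn n).
have p2 k : (0 < 2 ^ k)%N by rewrite expn_gt0.
have mC := measurable_obsC b.
have c1 := @riem_obs_event_cvg h b _ _ _ _ tn0 s0 (measurable_cyl n tt (pt x) mB) (mX (tt n + s) y).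
pose g0 : grid 0 (fun=> 0 : R) := conj erefl (fun i (H : (i < 0)%N) => False_ind _ (elimF idP erefl H)).
have cE : cyl 0 (fun=> 0) (pt (fun=> x n)) (fun=> setT) = [set w | X 0 w = x n].
  by apply/seteqP; split => w; [case=> /(_ 0%N isT)|move=> Xw; split => // -[]].
have c0 : Pr P ([set w | X 0 w = x n] `&` [set w | obsC b (riem_obs h 0 s (2 ^ k) w)] `&`
        [set w | X s w = y]) @[k --> \oo] --> obs_kern h b s (x n) y * rho (x n).
  rewrite /obs_kern divfK ?gt_eqF//.
  by have := @riem_obs_event_cvg h b _ _ _ _ (lexx 0) s0 (mX 0 (x n)) (mX s y).
have kE k : kern h s (2 ^ k) (obsC b) (x n) y = Pr P ([set w | X 0 w = x n] `&`
   [set w | obsC b (riem_obs h 0 s (2 ^ k) w)] `&` [set w | X s w = y]) / rho (x n).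
  have := @future_kern h 0 (fun=> 0) s (2 ^ k) (fun=> x n) (fun=> setT) (obsC b) y g0 s0 (p2 k).
  rewrite cE add0r => -> //; rewrite -cE cyl_path// big_ord0 mulr1.
  by rewrite [RHS]mulrC mulKf// gt_eqF.
have c2 : Pr P (cyl n tt (pt x) B) * kern h s (2 ^ k) (obsC b) (x n) y @[k --> \oo] -->
    Pr P (cyl n tt (pt x) B) * obs_kern h b s (x n) y.
  apply: cvgM; first exact: cvg_cst.
  rewrite (_ : obs_kern h b s (x n) y = obs_kern h b s (x n) y * rho (x n) / rho (x n)).
    by under eq_fun do rewrite kE; apply: cvgM => //; exact: cvg_cst.
  by rewrite mulfK// gt_eqF.
apply: cvg_unique c1 _ => //.
by rewrite /=; under eq_fun do rewrite future_kern//.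
Qed.

Lemma obs_kern_false h s x y : 0 < s -> obs_kern h false s x y = trans s x y.
Proof.
move=> s0; rewrite /obs_kern /= setIT.
pose tt (i : nat) : R := if i == 0%N then 0 else s.
pose xx (i : nat) := if i == 0%N then x else y.
have g : grid 1 tt by split => // -[|i].
have -> : [set w | X 0 w = x] `&` [set w | X s w = y] = cyl 1 tt (pt xx) (fun=> setT).
  apply/seteqP; split => w.
    by move=> [H1 H2]; split => // -[|[|i]].
  by move=> [H _]; split; [exact: (H 0%N)|exact: (H 1%N)].
rewrite cyl_path// big_ord1/= /tt /xx/= subr0 mulrC mulKf// gt_eqF//.
Qed.

Lemma cyl_sum n tt D B (F : set Omega) : (forall i, measurable (B i)) -> measurable F ->
  Pr P (cyl n tt D B `&` F) =
  \sum_(q : {ffun 'I_n.+1 -> 'I_d} | `[< forall i, (i <= n)%N -> D i (qpath q i) >])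
    Pr P (cyl n tt (pt (qpath q)) B `&` F).
Proof.
move=> mB mF; rewrite (Pr_path_partition n tt); last first.
  by apply: measurableI => //; exact: measurable_cyl.
rewrite [RHS]big_mkcond/=; apply: eq_bigr => q _.
rewrite setIAC cylI; case: asboolP => H.
  congr (Pr P (_ `&` _)); apply/seteqP; split => w [H1 H2]; split => i ni.
  - by have [] := H1 i ni.
  - by have [] := H2 i ni.
  - by have := H1 i ni; rewrite /pt/= => E; split => //; rewrite E; exact: H.
  - by split => //; exact: H2.
rewrite (_ : _ `&` _ = set0) ?Pr0//; apply/seteqP; split => w //= [[H1 _] _].
apply: H => i ni; have [+ E] := H1 i ni.
by move: E; rewrite /pt/= => ->.
Qed.

(** * Dyadic grids and the sigma-algebras they generate *)

Definition dgrid (T : R) (n i : nat) : R := T * i%:R / (2 ^ n)%:R.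

Lemma dgrid_grid T n : 0 < T -> grid (2 ^ n) (dgrid T n).
Proof.
move=> T0; split; first by rewrite /dgrid mulr0 mul0r.
by move=> i _; rewrite /dgrid ltr_pM2r ?invr_gt0 ?pow2_gt0// ltr_pM2l// ltr_nat.
Qed.

Lemma dgrid_last T n : dgrid T n (2 ^ n) = T.
Proof. by rewrite /dgrid mulfK// gt_eqF// pow2_gt0. Qed.

Lemma dgrid_refine T n k i : dgrid T n i = dgrid T (n + k) (i * 2 ^ k).
Proof.
rewrite /dgrid expnD !natrM; field.
by rewrite !gt_eqF// pow2_gt0.
Qed.

(** The noise is fully visible, the state only through the sets in [DD]: all sets for the full
    filtration, the level sets of [h] for unobservability. *)
Definition info_gen (DD : set (set 'I_d)) (T : R) : set (set Omega) :=
  [set E | exists2 u, 0 <= u <= T &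
    (exists2 D, DD D & E = [set w | D (X u w)]) \/
    (exists2 B, measurable B & E = [set w | B (W u w)])].

Section DyadicGenerators.
Variables (DD : set (set 'I_d)) (T : R).
Hypotheses (T0 : 0 < T) (DDI : setI_closed DD) (DDT : DD setT).

Let pgen n : set (set Omega) := [set E | exists D B,
  [/\ forall i, DD (D i), forall i, measurable (B i) & E = cyl (2 ^ n) (dgrid T n) D B]].

Let pgen_sa n := sigma_algebra_gen (pgen n).

Let pgen_state n i D : (i <= 2 ^ n)%N -> DD D ->
  <<s pgen n >> [set w | D (X (dgrid T n i) w)].
Proof.
move=> ni DDD; apply: sub_sigma_algebra.
exists (fun j => if j == i then D else setT), (fun=> setT); split => //.
  by move=> j; case: ifP.
apply/seteqP; split => w /=.
  by move=> Dw; split => // j nj; case: eqP => // ->.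
by move=> [/(_ i ni)]; rewrite eqxx.
Qed.

Let pgen_noise n i : (i <= 2 ^ n)%N -> measurable_wrt <<s pgen n >> (W (dgrid T n i)).
Proof.
elim: i => [_|i ih ni].
  rewrite (_ : W _ = (fun=> 0)); first exact: wrt_cst.
  by apply/funext => w; rewrite /dgrid mulr0 mul0r W0.
rewrite (_ : W (dgrid T n i.+1) = (fun w => (W (dgrid T n i.+1) w - W (dgrid T n i) w) +
   W (dgrid T n i) w)); last by apply/funext => w; rewrite subrK.
apply: wrtD => //; last by apply: ih; exact: ltnW.
move=> B mB; apply: sub_sigma_algebra.
exists (fun=> setT), (fun j => if j == i then B else setT); split => //.
  by move=> j; case: ifP.
apply/seteqP; split => w /=.
  by move=> Bw; split => // j nj; case: eqP => // ->.
by move=> [_ /(_ i ni)]; rewrite eqxx.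
Qed.

(** A coarse cylinder is not a finer one, since a coarse noise increment is a sum of fine
    increments. Inclusion holds only between the generated sigma-algebras. *)
Let pgen_sub n k : <<s pgen n >> `<=` <<s pgen (n + k) >>.
Proof.
apply: smallest_sub => // E [D [B [DDD mB ->]]].
have le i : (i <= 2 ^ n)%N -> (i * 2 ^ k <= 2 ^ (n + k))%N.
  by move=> ni; rewrite expnD leq_pmul2r// expn_gt0.
rewrite (_ : cyl _ _ _ _ =
  [set w | forall i, (i <= 2 ^ n)%N -> [set w | D i (X (dgrid T n i) w)] w] `&`
  [set w | forall i, (i < 2 ^ n)%N ->
     [set w | B i (W (dgrid T n i.+1) w - W (dgrid T n i) w)] w])//.
apply: (saI (pgen_sa _)); apply: sa_forall => // i ni.
  by rewrite (dgrid_refine T n k); apply: pgen_state => //; exact: le.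
have m1 : measurable_wrt <<s pgen (n + k) >> (W (dgrid T n i.+1)).
  by rewrite (dgrid_refine T n k); apply: pgen_noise; exact: le.
have m2 : measurable_wrt <<s pgen (n + k) >> (W (dgrid T n i)).
  by rewrite (dgrid_refine T n k); apply: pgen_noise; apply: le; exact: ltnW.
have := wrtD (pgen_sa _) m1 (wrtZ (pgen_sa _) (-1) m2).
move=> /(_ (B i) (mB i)); congr (<<s _ >> _).
by apply/seteqP; split => w /=; rewrite mulN1r.
Qed.

(** The pi-lambda argument is run twice, because the cylinders of all levels together are not stable
    under intersection: once from the cylinders of a level to their sigma-algebra, then from the
    union of these nested sigma-algebras to what it generates. Path regularity brings in the
    non-dyadic times. *)
Lemma dyadic_pi_lambda (I : finType) (c : I -> R) (S : I -> set Omega) :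
  (forall i, measurable (S i)) ->
  (forall n D B, (forall i, DD (D i)) -> (forall i, measurable (B i)) ->
     \sum_i c i * Pr P (cyl (2 ^ n) (dgrid T n) D B `&` S i) = 0) ->
  forall E, <<s info_gen DD T >> E -> \sum_i c i * Pr P (E `&` S i) = 0.
Proof.
move=> mS L.
have mpgen n E : pgen n E -> measurable E.
  by move=> [D [B [_ mB ->]]]; exact: measurable_cyl.
have mspgen n E : <<s pgen n >> E -> measurable E.
  move: E; apply: smallest_sub; first exact: sigma_algebra_measurable.
  exact: mpgen.
have LT : \sum_i c i * Pr P (S i) = 0.
  have := L 0%N (fun=> setT) (fun=> setT) (fun=> DDT) (fun=> measurableT).
  by under eq_bigr do rewrite cylT setTI.
have Ln n E : <<s pgen n >> E -> \sum_i c i * Pr P (E `&` S i) = 0.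
  move: E; apply: pi_lambda_comb => //.
  - move=> E E' [D [B [DDD mB ->]]] [D' [B' [DDD' mB' ->]]].
    exists (fun i => D i `&` D' i), (fun i => B i `&` B' i); split.
    + by move=> i; exact: DDI.
    + by move=> i; exact: measurableI.
    + exact: cylI.
  - exact: mpgen.
  - by move=> E [D [B [DDD mB ->]]]; exact: L.
pose U : set (set Omega) := \bigcup_n <<s pgen n >>.
have LU E : <<s U >> E -> \sum_i c i * Pr P (E `&` S i) = 0.
  move: E; apply: pi_lambda_comb => //.
  - move=> E E' [n _ sE] [n' _ sE']; exists (n + n')%N => //.
    by apply: (saI (pgen_sa _)); [|rewrite addnC]; exact: pgen_sub.
  - by move=> E [n _]; exact: mspgen.
  - by move=> E [n _]; exact: Ln.
have saU' := sigma_algebra_gen U.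
have sub n : <<s pgen n >> `<=` <<s U >>.
  by move=> E sE; apply: sub_sigma_algebra; exists n.
move=> E sE; apply: LU; move: E sE; apply: smallest_sub => // E [u uT].
case=> [[D DDD ->]|[B mB ->]].
  (* Encoding the event as a real function makes pointwise limits along dyadic times applicable; the
     event is recovered as the preimage of 1. *)
  have : measurable_wrt <<s U >> (fun w => (`[< D (X u w) >])%:R : R).
    apply: (@path_dyadic_wrt _ _ _ _ X rcX _ saU' (fun x => (`[< D x >])%:R : R) T) => //.
    move=> n i ni; have SE := sub _ _ (pgen_state ni DDD).
    have := wrt_ind (R := R) saU' SE; congr (measurable_wrt _ _).
  move=> /(_ [set 1] (measurable_set1 _)); congr (<<s _ >> _).
  apply/seteqP; split => w /=; last by move=> Dw; rewrite asboolT.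
  by case: asboolP => // _ /esym/eqP; rewrite oner_eq0.
apply: (noise_dyadic_wrt cW saU' T0) => // n i ni.
by apply: measurable_wrtS (sub n) _; exact: pgen_noise.
Qed.

End DyadicGenerators.

(** * Filtrations and the Markov property of the observed chain *)

Definition filtr (t : R) : set (set Omega) := <<s info_gen setT t >>.

Lemma filtr_sa t : sigma_algebra setT (filtr t).
Proof. exact: sigma_algebra_gen. Qed.

Lemma filtr_mono s t : s <= t -> filtr s `<=` filtr t.
Proof.
move=> st; apply: smallest_sub; first exact: filtr_sa.
move=> E [u /andP[u0 us] H]; apply: sub_sigma_algebra; exists u => //.
by rewrite u0 (le_trans us).
Qed.

Lemma filtr_state t u D : 0 <= u <= t -> filtr t [set w | D (X u w)].
Proof. by move=> ut; apply: sub_sigma_algebra; exists u => //; left; exists D. Qed.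

Lemma filtr_measurable t E : filtr t E -> measurable E.
Proof.
move: E; apply: smallest_sub; first exact: sigma_algebra_measurable.
move=> E [u _ [[D _ ->]|[B mB ->]]]; first exact: measurable_state.
by rewrite -[X in measurable X]setTI; exact: mW.
Qed.

Lemma filtr_obs h t u : 0 <= u <= t -> measurable_wrt (filtr t) (obs h X W u).
Proof.
apply: obs_measurable_wrt => //; first exact: filtr_sa.
  by move=> v vt B mB; exact: (@filtr_state t v [set x | B (h x)]).
by move=> v vt B mB; apply: sub_sigma_algebra; exists v => //; right; exists B.
Qed.

Lemma obs_sigma_filtr h t : obs_sigma (obs h X W) t `<=` filtr t.
Proof.
apply: smallest_sub; first exact: filtr_sa.
by move=> E [s [B [st mB ->]]]; exact: filtr_obs.
Qed.

Lemma obs_sigma_obs h t u : 0 <= u <= t ->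
  measurable_wrt (obs_sigma (obs h X W) t) (obs h X W u).
Proof. by move=> ut B mB; apply: sub_sigma_algebra; exists u, B. Qed.

Lemma obs_sigma_sa h t : sigma_algebra setT (obs_sigma (obs h X W) t).
Proof. exact: sigma_algebra_gen. Qed.

Lemma obs_sigma_mono h s t : s <= t ->
  obs_sigma (obs h X W) s `<=` obs_sigma (obs h X W) t.
Proof.
move=> st; apply: smallest_sub; first exact: obs_sigma_sa.
move=> E [u [B [/andP[u0 us] mB ->]]]; apply: obs_sigma_obs => //.
by rewrite u0 (le_trans us).
Qed.

Lemma obs_sigma_measurable h t E : obs_sigma (obs h X W) t E -> measurable E.
Proof. by move=> /obs_sigma_filtr; exact: filtr_measurable. Qed.

Lemma obs_sigma_incr h b t s : 0 <= t -> 0 < s ->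
  obs_sigma (obs h X W) (t + s) [set w | obsC b (obs_incr h t s w)].
Proof.
move=> t0 s0; have sa := obs_sigma_sa h (t + s).
have m1 : measurable_wrt (obs_sigma (obs h X W) (t + s)) (obs h X W (t + s)).
  by apply: obs_sigma_obs; rewrite lexx addr_ge0// ltW.
have m2 : measurable_wrt (obs_sigma (obs h X W) (t + s)) (obs h X W t).
  by apply: obs_sigma_obs; rewrite t0 lerDl ltW.
have := wrtD sa m1 (wrtZ sa (-1) m2).
move=> /(_ (obsC b) (measurable_obsC b)); congr (obs_sigma _ _ _).
by apply/seteqP; split => w /=; rewrite mulN1r.
Qed.

Lemma markov h b t s x y E : 0 < t -> 0 < s -> filtr t E ->
  Pr P (E `&` ([set w | X t w = x] `&` [set w | obsC b (obs_incr h t s w)] `&`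
               [set w | X (t + s) w = y])) =
  obs_kern h b s x y * Pr P (E `&` [set w | X t w = x]).
Proof.
move=> t0 s0 fE; have t0' := ltW t0.
set G := _ `&` _ `&` _.
have mO : measurable [set w | obsC b (obs_incr h t s w)].
  exact: (obs_sigma_measurable (@obs_sigma_incr h b t s t0' s0)).
have mG : measurable G by apply: measurableI => //; exact: measurableI.
have DDT : [set: set 'I_d] [set: 'I_d] by [].
have DDI : setI_closed [set: set 'I_d] by [].
(* The Markov identity is a vanishing combination of two events, with coefficients 1 and minus the
   kernel, so it needs checking on cylinders only. *)
have := @dyadic_pi_lambda setT t t0 DDI DDT bool
  (fun b' => if b' then 1 else - obs_kern h b s x y)
  (fun b' => if b' then G else [set w | X t w = x]).
move=> H; apply/eqP; rewrite -subr_eq0 -mulNr -[X in X + _]mul1r; apply/eqP.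
have := H _ _ E fE; rewrite big_bool/=; apply; first by case.
move=> n D B _ mB; rewrite big_bool/= mul1r.
rewrite !cyl_sum// mulr_sumr -big_split/=; apply: big1 => q _.
have [qx|qx] := eqVneq (qpath q (2 ^ n)) x; last first.
  have e0 : cyl (2 ^ n) (dgrid t n) (pt (qpath q)) B `&` [set w | X t w = x] = set0.
    apply/seteqP; split => w //= [[Ew _] Xw]; move/eqP: qx; apply.
    by have := Ew (2 ^ n)%N (leqnn _); rewrite /pt/= dgrid_last Xw.
  rewrite e0 Pr0 mulr0 addr0 (_ : _ `&` G = set0) ?Pr0//.
  by apply/seteqP; split => w // [Ew [[Xw _] _]]; rewrite -e0.
have sub : cyl (2 ^ n) (dgrid t n) (pt (qpath q)) B `<=` [set w | X t w = x].
  by move=> w [/(_ (2 ^ n)%N (leqnn _))]; rewrite /pt/= dgrid_last qx.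
rewrite (setIidl sub) (_ : _ `&` G = cyl (2 ^ n) (dgrid t n) (pt (qpath q)) B `&`
   [set w | obsC b (obs_incr h t s w)] `&` [set w | X (t + s) w = y]); last first.
  by apply/seteqP; split => w [Ew]; [case=> -[]|move=> Yw; case: Ew => Ew Ow; split => //;
    split => //; split => //; exact: sub].
have := markov_cyl h b (qpath q) y (dgrid_grid n t0) s0 mB.
by rewrite dgrid_last qx => ->; rewrite mulNr mulrC subrr.
Qed.

(** * Small-time asymptotics *)

Lemma pair_law t s x y : 0 <= t -> 0 < s ->
  Pr P ([set w | X t w = x] `&` [set w | X (t + s) w = y]) =
  Pr P [set w | X t w = x] * trans s x y.
Proof.
rewrite le_eqVlt => /predU1P[<- s0|t0 s0].
  rewrite -(obs_kern_false (fun=> 0) x y s0) /obs_kern/= setIT add0r.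
  have -> : Pr P [set w | X 0 w = x] = rho x.
    pose g0 : grid 0 (fun=> 0 : R) :=
      conj erefl (fun i (H : (i < 0)%N) => False_ind _ (elimF idP erefl H)).
    have := cyl_path (fun=> x) g0; rewrite big_ord0 mulr1 => <-; congr (Pr P _).
    by apply/seteqP; split => w; [move=> Xw; split => // -[]|case=> /(_ 0%N isT)].
  by rewrite mulrC divfK// gt_eqF.
have := @markov (fun=> 0) false t s x y setT t0 s0 (saT (filtr_sa t)).
by rewrite !setTI/= setIT obs_kern_false// mulrC.
Qed.

Lemma jump_prob t s : 0 <= t -> 0 < s -> s * mxsum_norm A <= 1/2 ->
  Pr P [set w | X (t + s) w <> X t w] <= d%:R * (2 * (s * mxsum_norm A)).
Proof.
move=> t0 s0 sA; set E := [set w | _].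
have EE y : E `&` [set w | X (t + s) w = y] =
    [set w | X (t + s) w = y] `&` [set w | ~ (X t w = y)].
  apply/seteqP; split => w /= [H1 H2]; split => //= e; first by apply: H1; rewrite H2 e.
  by apply: H2; rewrite -e H1.
have mE : measurable E.
  rewrite (_ : E = \bigcup_(y in [set: 'I_d]) ([set w | X (t + s) w = y] `&`
     [set w | ~ (X t w = y)])); last first.
    apply/seteqP; split => w /=; first by move=> ne; exists (X (t + s) w) => //; rewrite -EE.
    by move=> [y _]; rewrite -EE => -[].
  apply: fin_bigcup_measurable; first exact: finite_finset.
  by move=> y _; apply: measurableI => //; exact: (measurable_state t [set x | x <> y]).
rewrite (Pr_partition P mE (mX t)).
apply: (@le_trans _ _ (\sum_(x : 'I_d) Pr P [set w | X t w = x] *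
    (d%:R * (2 * (s * mxsum_norm A))))); last first.
  rewrite -mulr_suml ler_piMl ?mulr_ge0 ?mxsum_norm_ge0 ?(ltW s0)//.
  rewrite -(PrT P) (Pr_partition P measurableT (mX t)).
  by under [leRHS]eq_bigr do rewrite setTI.
apply: ler_sum => x _.
rewrite (Pr_partition P (measurableI _ _ mE (mX t x)) (mX (t + s))).
have -> : Pr P [set w | X t w = x] * (d%:R * (2 * (s * mxsum_norm A))) =
    \sum_(y : 'I_d) Pr P [set w | X t w = x] * (2 * (s * mxsum_norm A)).
  by rewrite sumr_const card_ord -mulr_natl; ring.
apply: ler_sum => y _.
have [yx|yx] := eqVneq y x.
  rewrite (_ : _ `&` _ = set0) ?Pr0 ?mulr_ge0 ?Pr_ge0 ?mxsum_norm_ge0 ?(ltW s0)//.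
  by apply/seteqP; split => w //= -[[ne Xw] Yw]; apply: ne; rewrite Xw Yw.
apply: (@le_trans _ _ (Pr P ([set w | X t w = x] `&` [set w | X (t + s) w = y]))).
  apply: le_Pr; [by apply: measurableI => //; exact: measurableI|exact: measurableI|].
  by move=> w [[_ ?] ?].
rewrite pair_law// ler_wpM2l ?Pr_ge0//.
have := @expmx_order0 _ _ A s x y (ltW s0) sA.
by rewrite eq_sym (negbTE yx) subr0 /trans => /(le_trans (ler_norm _)).
Qed.

(* By right continuity dyadic times detect every departure from X_0 on [0, s]. *)
Definition moved (s : R) : set Omega :=
  \bigcup_n [set w | exists2 j, (j < (2 ^ n).+1)%N & X (dgrid s n j) w <> X 0 w].

Lemma measurable_neq t u : measurable [set w | X t w <> X u w].
Proof.
rewrite (_ : [set w | _] = \bigcup_(y in [set: 'I_d])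
   ([set w | X t w = y] `&` [set w | ~ (X u w = y)])); last first.
  apply/seteqP; split => w /=; first by move=> ne; exists (X t w) => //; split => // /esym.
  by move=> [y _ [/= -> H]] E; apply: H.
apply: fin_bigcup_measurable; first exact: finite_finset.
by move=> y _; apply: measurableI => //; exact: (measurable_state u [set x | x <> y]).
Qed.

Let mexists n (F : nat -> set Omega) : (forall i, measurable (F i)) ->
  measurable [set w | exists2 i, (i < n)%N & F i w].
Proof.
move=> mF; rewrite (_ : [set w | _] = \bigcup_(i in [set i | (i < n)%N]) F i)//.
by apply: bigcup_measurable => i _.
Qed.

Lemma measurable_moved s : measurable (moved s).
Proof.
by apply: bigcup_measurable => n _; apply: mexists => i; exact: measurable_neq.
Qed.

(** A departure from [X 0] on a grid forces a change over one of its steps. Each of the [2 ^ n]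
    steps costs O(s / 2^n), so the union bound is independent of [n] and passes to the increasing
    union. *)
Lemma moved_prob s : 0 < s -> s * mxsum_norm A <= 1/2 ->
  Pr P (moved s) <= d%:R * (2 * (s * mxsum_norm A)).
Proof.
move=> s0 sA.
pose F n := [set w | exists2 j, (j < (2 ^ n).+1)%N & X (dgrid s n j) w <> X 0 w].
have mF n : measurable (F n) by apply: mexists => i; exact: measurable_neq.
have nd n k : (n <= k)%N -> F n `<=` F k.
  move=> nk w [j jn ne]; exists (j * 2 ^ (k - n))%N.
    by rewrite ltnS -{2}(subnKC nk) expnD leq_pmul2r ?expn_gt0.
  by have := dgrid_refine s n (k - n) j; rewrite subnKC// => <-.
apply: (ler_cvg_to (cvg_Pr_nd mF nd) (cvg_cst (d%:R * (2 * (s * mxsum_norm A))))).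
near=> n.
pose J i := [set w | X (dgrid s n i.+1) w <> X (dgrid s n i) w].
have mJ i : measurable (J i) by exact: measurable_neq.
have FJ : F n `<=` [set w | exists2 i, (i < 2 ^ n)%N & J i w].
  move=> w [j]; rewrite ltnS; elim: j => [_|j ih jn ne].
    by rewrite {1}/dgrid mulr0 mul0r.
  have [e|ne'] := pselect (X (dgrid s n j.+1) w = X (dgrid s n j) w); last by exists j.
  by apply: ih; [exact: ltnW|rewrite -e].
apply: le_trans (le_Pr P (mF n) (mexists _ mJ) FJ) _.
apply: le_trans (le_Pr_bigU P _ mJ) _.
have p2 : 0 < (2 ^ n)%:R :> R by exact: pow2_gt0.
apply: (@le_trans _ _ (\sum_(i < 2 ^ n) d%:R * (2 * (s / (2 ^ n)%:R * mxsum_norm A)))).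
  apply: ler_sum => i _; rewrite /J.
  have -> : dgrid s n i.+1 = dgrid s n i + s / (2 ^ n)%:R.
    by rewrite /dgrid -natr1; field; rewrite gt_eqF.
  apply: jump_prob; first by rewrite /dgrid divr_ge0 ?mulr_ge0// ltW.
    by rewrite divr_gt0.
  apply: le_trans sA; rewrite ler_wpM2r ?mxsum_norm_ge0//.
  by rewrite ler_pdivrMr// ler_peMr ?(ltW s0)// ler1n expn_gt0.
rewrite sumr_const card_ord -mulr_natl le_eqVlt; apply/orP; left; apply/eqP.
by field; rewrite gt_eqF.
Unshelve. all: by end_near. Qed.

Lemma not_moved s w : 0 < s -> ~ moved s w -> forall u, 0 <= u <= s -> X u w = X 0 w.
Proof.
move=> s0 nm.
have dg n j : (j <= 2 ^ n)%N -> X (dgrid s n j) w = X 0 w.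
  by move=> jn; apply: contrapT => ne; apply: nm; exists n => //; exists j.
move=> u /andP[u0]; rewrite le_eqVlt => /predU1P[->|us].
  by have := dg 0%N _ (leqnn _); rewrite dgrid_last.
have [n _ H] := right_cont_dyadic (rcX w) (lexx 0) s0 u0.
have := H n (leqnn _); rewrite !add0r => <-.
by rewrite /dyadic_up; apply: dg; rewrite dyadic_up_index// u0.
Qed.

Lemma Pr_dist (E F B : set Omega) : measurable E -> measurable F -> measurable B ->
  (forall w, ~ B w -> E w <-> F w) -> `|Pr P E - Pr P F| <= Pr P B.
Proof.
move=> mE mF mB EF.
have half (E1 E2 : set Omega) : measurable E1 -> measurable E2 ->
    (forall w, ~ B w -> E1 w -> E2 w) -> Pr P E1 - Pr P E2 <= Pr P B.
  move=> m1 m2 H; rewrite lerBlDl; apply: le_trans (le_PrU P m2 mB).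
  apply: le_Pr => //; first exact: measurableU.
  by move=> w E1w; have [|nB] := pselect (B w); [right|left; exact: H].
rewrite ler_norml lerNl opprB; apply/andP; split; apply: half => // w nB.
  by move/(EF w nB).
by move/(EF w nB).
Qed.

(** Off [moved s] the increment is exactly [s * h x] plus noise, so the event coincides with a
    two-point cylinder whose law is explicit. The error is the probability of a move, divided by
    [rho x] because of the conditioning. *)
Lemma obs_kern_approx h s x y : 0 < s -> s * mxsum_norm A <= 1/2 ->
  `|obs_kern h true s x y - trans s x y * gauss s (half (s * h x))| <=
  d%:R * (2 * (s * mxsum_norm A)) / rho x.
Proof.
move=> s0 sA.
pose tt (i : nat) : R := if i == 0%N then 0 else s.
pose xx (i : nat) := if i == 0%N then x else y.
have g : grid 1 tt by split => // -[|i].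
have := cyl_law xx g (fun=> measurable_half (s * h x)).
rewrite !big_ord1/= /tt /xx/= subr0 -/tt -/xx => cE.
rewrite /obs_kern.
have -> : trans s x y * gauss s (half (s * h x)) =
    Pr P (cyl 1 tt (pt xx) (fun=> half (s * h x))) / rho x.
  by rewrite cE; field; rewrite gt_eqF.
rewrite -mulrBl normrM [X in _ * X]ger0_norm ?invr_ge0 ?(ltW (rho0 x))//.
rewrite ler_wpM2r ?invr_ge0 ?(ltW (rho0 x))//.
apply: le_trans (moved_prob s0 sA).
apply: Pr_dist.
- apply: measurableI => //; apply: measurableI => //.
  have := obs_sigma_measurable (@obs_sigma_incr h true 0 s (lexx 0) s0).
  exact.
- by apply: measurable_cyl => i; exact: measurable_half.
- exact: measurable_moved.
move=> w /not_moved => /(_ s0) Xc.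
have oE : obs_incr h 0 s w = s * h (X 0 w) + (W s w - W 0 w).
  rewrite /obs_incr /obs add0r -/(primitive h (X ^~ w) s) -/(primitive h (X ^~ w) 0).
  rewrite primitive0 (primitive_cst h (ltW s0) Xc); ring.
split.
  move=> [[X0 /= pos] Xs]; split; first by move=> -[|[|i]].
  by move=> [|i]//= _; rewrite /half/= /tt/= -X0 -oE.
move=> [H1 H2]; have X0 : X 0 w = x := H1 0%N isT.
split; last exact: (H1 1%N).
split => //; have := H2 0%N isT.
by rewrite /half/= /tt/= -{1}X0 -oE.
Qed.

Lemma cvg_dist_le (u v : nat -> R) (l : R) :
  (\forall n \near \oo, `|u n - l| <= v n) -> v n @[n --> \oo] --> 0 ->
  u n @[n --> \oo] --> l.
Proof.
move=> uv v0; apply/cvgrPdist_lt => e e0.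
have /cvgrPdist_lt/(_ e e0) := v0; apply: filterS2 uv => n un.
rewrite sub0r normrN => vn; rewrite distrC; apply: le_lt_trans un _.
by apply: le_lt_trans (ler_norm _) vn.
Qed.

Lemma peak_inv_cvg : (peak n.+1%:R^-1)^-1 @[n --> \oo] --> 0.
Proof.
rewrite (_ : (fun n => _) = (fun n => Num.sqrt (Rv * n.+1%:R^-1 * trigo.pi *+ 2))); last first.
  apply/funext => n; rewrite /peak /normal_peak invrK sqr_sqrtr//.
  by rewrite mulr_ge0 ?(ltW Rv0).
rewrite -[X in _ --> X](@sqrtr0 R).
apply: (@cvg_comp _ _ _ (fun n => Rv * n.+1%:R^-1 * trigo.pi *+ 2) Num.sqrt _ (nbhs (0 : R)) _ _ (@sqrt_continuous R 0)).
have -> : (0 : R) = Rv * 0 * trigo.pi *+ 2 by rewrite mulr0 mul0r mul0rn.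
apply: cvgMn; apply: cvgM; last exact: cvg_cst.
by apply: cvgM; [exact: cvg_cst|exact: cvg_harmonic].
Qed.

Lemma small_step : \forall n \near \oo, n.+1%:R^-1 * mxsum_norm A <= 1/2.
Proof.
have c0 : n.+1%:R^-1 * mxsum_norm A @[n --> \oo] --> 0.
  rewrite -(mul0r (mxsum_norm A)).
  by apply: cvgM; [exact: cvg_harmonic|exact: cvg_cst].
have h2 : 0 < 1/2 :> R by lra.
have /cvgrPdist_lt/(_ _ h2) := c0; apply: filterS => n.
by rewrite sub0r normrN => /ltW; apply: le_trans; exact: ler_norm.
Qed.

Lemma trans_cvg0 x y : trans n.+1%:R^-1 x y @[n --> \oo] --> ((x == y)%:R : R).
Proof.
apply: (@cvg_dist_le _ (fun n => 2 * (n.+1%:R^-1 * mxsum_norm A))).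
  apply: filterS small_step => n sn.
  by apply: expmx_order0 => //; rewrite invr_ge0.
have -> : (0 : R) = 2 * (0 * mxsum_norm A) by rewrite mul0r mulr0.
apply: cvgM; first exact: cvg_cst.
by apply: cvgM; [exact: cvg_harmonic|exact: cvg_cst].
Qed.

Lemma trans_deriv x y :
  n.+1%:R * (trans n.+1%:R^-1 x y - (x == y)%:R) @[n --> \oo] --> A x y.
Proof.
apply: (@cvg_dist_le _ (fun n => 2 * (n.+1%:R^-1 * mxsum_norm A ^+ 2))).
  apply: filterS small_step => n sn.
  have s0 : 0 < n.+1%:R^-1 :> R by rewrite invr_gt0.
  have := @expmx_order1 _ _ A n.+1%:R^-1 x y (ltW s0) sn.
  have -> : n.+1%:R * (trans n.+1%:R^-1 x y - (x == y)%:R) - A x y =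
     n.+1%:R * (trans n.+1%:R^-1 x y - (x == y)%:R - n.+1%:R^-1 * A x y).
    by rewrite [RHS]mulrBr mulVKf// pnatr_eq0.
  rewrite normrM ger0_norm// -ler_pdivlMl// => /le_trans; apply.
  by rewrite le_eqVlt; apply/orP; left; apply/eqP; ring.
have -> : (0 : R) = 2 * (0 * mxsum_norm A ^+ 2) by rewrite mul0r mulr0.
apply: cvgM; first exact: cvg_cst.
by apply: cvgM; [exact: cvg_harmonic|exact: cvg_cst].
Qed.

Lemma gauss_deriv (a : R) :
  (gauss n.+1%:R^-1 (half (n.+1%:R^-1 * a)) - gauss n.+1%:R^-1 (half 0)) *
  (n.+1%:R / peak n.+1%:R^-1) @[n --> \oo] --> a.
Proof.
apply: (@cvg_dist_le _ (fun n => n.+1%:R^-1 * (`|a| * a ^+ 2 / (2 * Rv)))).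
  apply: nearW => n; set s := n.+1%:R^-1; have s0 : 0 < s by rewrite invr_gt0.
  have pk := peak_gt0 s0.
  have nE : n.+1%:R = s^-1 by rewrite invrK.
  rewrite nE; have := gauss_half_expansion (s * a) s0.
  move: (gauss s (half (s * a))) (gauss s (half 0)) => G1 G0 H.
  have -> : (G1 - G0) * (s^-1 / peak s) - a = (G1 - G0 - peak s * (s * a)) / (s * peak s).
    by field; rewrite !gt_eqF.
  rewrite normrM [X in _ * X]ger0_norm ?invr_ge0 ?mulr_ge0 ?(ltW s0) ?(ltW pk)//.
  rewrite ler_pdivrMr ?mulr_gt0//; apply: le_trans H _.
  rewrite normrM (gtr0_norm s0) le_eqVlt; apply/orP; left; apply/eqP.
  by field; rewrite !gt_eqF.
rewrite -[X in _ --> X](mul0r (`|a| * a ^+ 2 / (2 * Rv))).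
by apply: cvgM; [exact: cvg_harmonic|exact: cvg_cst].
Qed.

(* [gauss s (half a)] has slope [peak s] at a = 0, and the observation drifts by
   h(x) s on a time interval without jumps. *)
Lemma obs_kern_deriv h x y :
  (obs_kern h true n.+1%:R^-1 x y - gauss n.+1%:R^-1 (half 0) * trans n.+1%:R^-1 x y) *
  (n.+1%:R / peak n.+1%:R^-1) @[n --> \oo] --> (x == y)%:R * h x.
Proof.
pose k n := n.+1%:R / peak n.+1%:R^-1.
(* [u] is the error due to jumps, O(s) against the normalisation s * peak(s), hence of order
   sqrt(s); [v] carries the drift and gives the limit. *)
pose u n := (obs_kern h true n.+1%:R^-1 x y -
   trans n.+1%:R^-1 x y * gauss n.+1%:R^-1 (half (n.+1%:R^-1 * h x))) * k n.
pose v n := trans n.+1%:R^-1 x y *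
  ((gauss n.+1%:R^-1 (half (n.+1%:R^-1 * h x)) - gauss n.+1%:R^-1 (half 0)) * k n).
rewrite (_ : (fun n => _) = (fun n => u n + v n)); last first.
  by apply/funext => n; rewrite /u /v -/(k n); ring.
rewrite -[X in _ --> X]add0r; apply: cvgD; last first.
  by apply: cvgM; [exact: trans_cvg0|exact: gauss_deriv].
apply: (@cvg_dist_le _ (fun n => (d%:R * (2 * mxsum_norm A) / rho x) * (peak n.+1%:R^-1)^-1)).
  apply: filterS small_step => n sn; rewrite subr0 /u /k.
  set s := n.+1%:R^-1; have s0 : 0 < s by rewrite invr_gt0.
  have nE : n.+1%:R = s^-1 by rewrite invrK.
  have pk := peak_gt0 s0; have r0 := rho0 x.
  rewrite nE normrM [X in _ * X]ger0_norm ?divr_ge0 ?invr_ge0 ?(ltW s0) ?(ltW pk)//.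
  have := @obs_kern_approx h s x y s0 sn => H.
  apply: (@le_trans _ _ (d%:R * (2 * (s * mxsum_norm A)) / rho x * (s^-1 / peak s))).
    by rewrite ler_wpM2r// ?divr_ge0 ?invr_ge0 ?(ltW s0) ?(ltW pk).
  by rewrite le_eqVlt; apply/orP; left; apply/eqP; field; rewrite !gt_eqF.
rewrite -[X in _ --> X](mulr0 (d%:R * (2 * mxsum_norm A) / rho x)).
by apply: cvgM; [exact: cvg_cst|exact: peak_inv_cvg].
Qed.

(** * Estimable functions and consistency *)

(* f is estimable when some bounded statistic of the observation increments after
   time t has conditional mean f(X_t) given the past; the statistic is kept as a
   finite linear combination of indicators so that only probabilities occur. *)
Definition estimable (h : 'I_d -> R) (f : 'rV[R]_d) : Prop :=
  exists (tau : R) (I : finType) (al : I -> R) (Ev : I -> R -> set Omega),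
  [/\ 0 <= tau,
      forall i t, 0 < t -> obs_sigma (obs h X W) (t + tau) (Ev i t) &
      forall t E, 0 < t -> filtr t E ->
        \sum_i al i * Pr P (E `&` Ev i t) = \sum_x f 0 x * Pr P (E `&` [set w | X t w = x])].

Lemma estimable0 h : estimable h 0.
Proof.
exists 0, 'I_0, (fun=> 0), (fun _ _ => setT); split => //.
  by move=> i t _; exact: saT (obs_sigma_sa _ _).
by move=> t E _ _; rewrite big_ord0 big1// => x _; rewrite mxE mul0r.
Qed.

Lemma estimable1 h : estimable h (const_mx 1).
Proof.
exists 0, unit, (fun=> 1), (fun _ _ => setT); split => //.
  by move=> i t _; exact: saT (obs_sigma_sa _ _).
move=> t E _ fE; rewrite (big_pred1 tt)// mul1r setIT.
rewrite (Pr_partition P (filtr_measurable fE) (mX t)).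
by apply: eq_bigr => x _; rewrite mxE mul1r.
Qed.

Lemma estimableZ h a f : estimable h f -> estimable h (a *: f).
Proof.
move=> [tau [I [al [Ev [tau0 oEv L]]]]].
exists tau, I, (fun i => a * al i), Ev; split => // t E t0 fE.
under eq_bigr do rewrite -mulrA.
rewrite -mulr_sumr L// mulr_sumr; apply: eq_bigr => x _.
by rewrite mxE mulrA.
Qed.

Lemma estimableD h f g : estimable h f -> estimable h g -> estimable h (f + g).
Proof.
move=> [tau [I [al [Ev [tau0 oEv L]]]]] [tau' [I' [al' [Ev' [tau'0 oEv' L']]]]].
exists (tau + tau'), (I + I')%type,
  (fun i => match i with inl j => al j | inr j => al' j end),
  (fun i => match i with inl j => Ev j | inr j => Ev' j end); split.
- by rewrite addr_ge0.
- move=> [i|i] t t0.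
    by apply: (@obs_sigma_mono h (t + tau)); [rewrite lerD2l lerDl|exact: oEv].
  by apply: (@obs_sigma_mono h (t + tau')); [rewrite lerD2l lerDr|exact: oEv'].
- move=> t E t0 fE; rewrite big_sumType/= L// L'// -big_split/=.
  by apply: eq_bigr => x _; rewrite mxE mulrDl.
Qed.

(** Tower property: start the statistic at [t + s] and multiply it by the indicator of an
    observation event between [t] and [t + s]. The result still uses only later increments, and the
    Markov property computes its conditional mean. *)
Lemma estimable_kern h b s f : 0 < s -> estimable h f ->
  estimable h (\row_x \sum_y obs_kern h b s x y * f 0 y).
Proof.
move=> s0 [tau [I [al [Ev [tau0 oEv L]]]]].
exists (s + tau), I, al, (fun i t => [set w | obsC b (obs_incr h t s w)] `&` Ev i (t + s)).
split; first by rewrite addr_ge0// ltW.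
  move=> i t t0; apply: (saI (obs_sigma_sa _ _)).
    apply: (@obs_sigma_mono h (t + s)); first by rewrite addrA lerDl.
    by apply: obs_sigma_incr => //; exact: ltW.
  by rewrite addrA; apply: oEv; rewrite addr_gt0.
move=> t E t0 fE; set O := [set w | obsC _ _].
have oO : filtr (t + s) O.
  by apply: (@obs_sigma_filtr h); apply: obs_sigma_incr => //; exact: ltW.
have fEO : filtr (t + s) (E `&` O).
  by apply: (saI (filtr_sa _)) => //; apply: filtr_mono fE; rewrite lerDl ltW.
under eq_bigr do rewrite setIA.
rewrite L ?addr_gt0//.
transitivity (\sum_y \sum_x f 0 y * (obs_kern h b s x y * Pr P (E `&` [set w | X t w = x]))).
  apply: eq_bigr => y _; rewrite -mulr_sumr; congr (_ * _).
  rewrite (Pr_partition P _ (mX t)); last first.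
    by apply: measurableI => //; exact: filtr_measurable fEO.
  apply: eq_bigr => x _; rewrite -markov//; congr (Pr P _).
  by apply/seteqP; split => w /=; tauto.
rewrite exchange_big/=; apply: eq_bigr => x _; rewrite mxE mulr_suml.
by apply: eq_bigr => y _; ring.
Qed.

(** No statistic is exhibited for [A g] or [h g]. Difference quotients of estimable functions are
    estimable, and a finite-dimensional subspace is closed, so their limits stay inside. *)
Lemma ctrb_estimable h (V : 'M[R]_d) f :
  is_ctrb_space A (\row_i h i) V -> (f <= V)%MS -> estimable h f.
Proof.
move=> [_ Vmin] fV.
have [U UE] := @subspace_matrix _ _ (estimable h) (estimable0 h) (@estimableD h) (@estimableZ h).
suff cU : closed_ctrb A (\row_i h i) U.
  by apply/UE; apply: submx_trans fV _; exact: Vmin.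
have s0 n : 0 < n.+1%:R^-1 :> R by rewrite invr_gt0.
have transU (g : 'rV[R]_d) n : (g <= U)%MS -> ((\row_x (\sum_y trans n.+1%:R^-1 x y * g 0 y)%R) <= U)%MS.
  move=> /UE eg; apply/UE; have := estimable_kern false (s0 n) eg.
  congr (estimable h _); apply/rowP => x; rewrite !mxE.
  by apply: eq_bigr => y _; rewrite obs_kern_false.
apply/and3P; split.
- by apply/UE; exact: estimable1.
- apply/row_subP => i; rewrite row_mul; have gU := row_sub i U.
  move: (row i U) gU => g gU.
  apply: (@submx_cvg _ _ _ (fun n => n.+1%:R *:
    (\row_x (\sum_y trans n.+1%:R^-1 x y * g 0 y)%R - g))).
    move=> n; apply: scalemx_sub; apply: addmx_sub; first exact: transU.
    by rewrite eqmx_opp.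
  move=> x; rewrite !mxE.
  rewrite (_ : (fun n => _) = (fun n =>
     \sum_y (n.+1%:R * (trans n.+1%:R^-1 x y - (x == y)%:R)) * g 0 y)).
    under [X in _ --> X]eq_bigr do rewrite mxE mulrC.
    apply: cvg_big => [|y _]; first exact: add_continuous.
    by apply: cvgM; [exact: trans_deriv|exact: cvg_cst].
  apply/funext => n; rewrite !mxE.
  have -> : g 0 x = \sum_y (x == y)%:R * g 0 y.
    rewrite (bigD1 x)//= eqxx mul1r big1 ?addr0// => y /negbTE yx.
    by rewrite eq_sym yx mul0r.
  rewrite -sumrB mulr_sumr; apply: eq_bigr => y _; ring.
- apply/row_subP => i; rewrite row_mul; have gU := row_sub i U.
  move: (row i U) gU => g gU.
  (* The subtracted term is the kernel for zero drift. It cancels the contribution of order one and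
     leaves one of order s * peak(s), which the prefactor normalises. *)
  apply: (@submx_cvg _ _ _ (fun n => (n.+1%:R / peak n.+1%:R^-1) *:
    (\row_x (\sum_y obs_kern h true n.+1%:R^-1 x y * g 0 y)%R -
     gauss n.+1%:R^-1 (half 0) *: \row_x (\sum_y trans n.+1%:R^-1 x y * g 0 y)%R))).
    move=> n; apply: scalemx_sub; apply: addmx_sub.
      by apply/UE; apply: estimable_kern => //; exact/UE.
    by rewrite eqmx_opp; apply: scalemx_sub; exact: transU.
  move=> x; rewrite mul_mx_diag !mxE.
  rewrite (_ : (fun n => _) = (fun n => \sum_y ((obs_kern h true n.+1%:R^-1 x y -
      gauss n.+1%:R^-1 (half 0) * trans n.+1%:R^-1 x y) *
      (n.+1%:R / peak n.+1%:R^-1)) * g 0 y)).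
    rewrite (_ : g 0 x * h x = \sum_y ((x == y)%:R * h x) * g 0 y); last first.
      rewrite (bigD1 x)//= eqxx mul1r big1 ?addr0; first by rewrite mulrC.
      by move=> y /negbTE yx; rewrite eq_sym yx !mul0r.
    apply: cvg_big => [|y _]; first exact: add_continuous.
    by apply: cvgM; [exact: obs_kern_deriv|exact: cvg_cst].
  apply/funext => n; rewrite !mxE [gauss _ _ * _]mulr_sumr -sumrB mulr_sumr.
  by apply: eq_bigr => y _; ring.
Qed.

Lemma closed_stays (D : {set 'I_d}) t : 0 < t -> closed_class A D ->
  Pr P ([set w | X 0 w \in D] `&` [set w | X t w \notin D]) = 0.
Proof.
move=> t0 cD.
have mD : measurable [set w | X 0 w \in D] by exact: (measurable_state 0 [set x | x \in D]).
have mDC : measurable [set w | X t w \notin D].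
  exact: (measurable_state t [set x | x \notin D]).
rewrite (Pr_partition P (measurableI _ _ mD mDC) (mX 0)) big1// => x _.
rewrite (Pr_partition P _ (mX t)); last by apply: measurableI => //; exact: measurableI.
rewrite big1// => y _.
have [/andP[xD yD]|nxy] := boolP ((x \in D) && (y \notin D)); last first.
  rewrite (_ : _ `&` _ = set0) ?Pr0//; apply/seteqP; split => w //= [[[]]] xD yD X0 Xt.
  by move: nxy; rewrite -X0 -Xt xD yD.
apply/eqP; rewrite eq_le Pr_ge0 andbT.
apply: (@le_trans _ _ (Pr P ([set w | X 0 w = x] `&` [set w | X (0 + t) w = y]))).
  apply: le_Pr.
  - by apply: measurableI => //; apply: measurableI => //; exact: measurableI.
  - exact: measurableI.
  - by move=> w /= [[_ ?] ?]; rewrite add0r.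
rewrite pair_law// /trans (expmx_closed _ xD yD) ?mulr0// => u v uD vD.
by rewrite mxE (cD u v) ?mulr0.
Qed.

Lemma closed_constant (D : {set 'I_d}) t (F : set Omega) : 0 < t ->
  closed_class A D -> closed_class A (~: D) -> measurable F ->
  Pr P (F `&` [set w | X t w \in D]) = Pr P (F `&` [set w | X 0 w \in D]).
Proof.
move=> t0 cD cDC mF; apply/eqP; rewrite -subr_eq0 -normr_eq0 eq_le normr_ge0 andbT.
pose B := ([set w | X 0 w \in D] `&` [set w | X t w \notin D]) `|`
          ([set w | X 0 w \in ~: D] `&` [set w | X t w \notin ~: D]).
have mS u (D' : set 'I_d) : measurable [set w | D' (X u w)] by exact: measurable_state.
have mB1 : measurable ([set w | X 0 w \in D] `&` [set w | X t w \notin D]).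
  by apply: measurableI; [exact: (mS 0 [set x | x \in D])|exact: (mS t [set x | x \notin D])].
have mB2 : measurable ([set w | X 0 w \in ~: D] `&` [set w | X t w \notin ~: D]).
  by apply: measurableI; [exact: (mS 0 [set x | x \in ~: D])|
                          exact: (mS t [set x | x \notin ~: D])].
apply: (@le_trans _ _ (Pr P B)).
  apply: Pr_dist.
  - by apply: measurableI => //; exact: (mS t [set x | x \in D]).
  - by apply: measurableI => //; exact: (mS 0 [set x | x \in D]).
  - exact: measurableU.
  move=> w nB; split => -[Fw Dw]; split => //=.
    apply: contrapT => /negP nD; apply: nB; right; split => /=; rewrite ?inE ?negbK//.
  by apply: contrapT => /negP nD; apply: nB; left.
apply: le_trans (le_PrU P mB1 mB2) _.
by rewrite !closed_stays// addr0.
Qed.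

Lemma class_consistent h (D : {set 'I_d}) :
  closed_class A D -> closed_class A (~: D) -> estimable h (\row_x ind_set D x) ->
  forall e, 0 < e -> exists (T : R) (Q : set Omega),
    [/\ 0 <= T, obs_sigma (obs h X W) T Q &
        Pr P ((Q `\` [set w | X 0 w \in D]) `|` ([set w | X 0 w \in D] `\` Q)) < e].
Proof.
move=> cD cDC [tau [I [al [Ev [tau0 oEv L]]]]] e e0.
set Xi := [set w | X 0 w \in D].
have fXi t : 0 <= t -> filtr t Xi.
  by move=> t0; apply: (@filtr_state t 0 [set x | x \in D]); rewrite lexx.
have mXi : measurable Xi by exact: (measurable_state 0 [set x | x \in D]).
(* With the extra index carrying coefficient -1 for [Xi], the combination with coefficients [c] is
   the error made by the statistic of one window. *)
pose c (i : unit + I) : R := if i is inr j then al j else -1.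
(* Window [m] ends at [t m + tau], before the next one starts. Adding 1 keeps the starting times
   positive and increasing even if [tau] is 0. *)
pose t (m : nat) : R := m.+1%:R * (tau + 1).
have t0 m : 0 < t m by rewrite mulr_gt0// ltr_wpDl.
have tS m m' : (m < m')%N -> t m + tau <= t m'.
  move=> mm'; apply: (@le_trans _ _ (t m.+1)).
    by rewrite /t -[m.+2%:R]natr1 mulrDl lerD2l mul1r lerDl.
  by rewrite /t ler_wpM2r ?addr_ge0// ler_nat.
pose F m (i : unit + I) : set Omega := if i is inr j then Ev j (t m) else Xi.
have fF m m' i : (m < m')%N -> filtr (t m') (F m i).
  move=> mm'; case: i => [[]|j] /=; first by apply: fXi; exact: ltW.
  by apply: (@obs_sigma_filtr h); apply: obs_sigma_mono (oEv _ _ _) => //; exact: tS.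
have mF m i : measurable (F m i) by exact: filtr_measurable (fF m m.+1 i (leqnn _)).
(* The error of a later window has conditional mean zero given everything known at its start, since
   [X] lies in [D] then exactly when it did at time 0, up to a null event. Errors of different
   windows are thus orthogonal. *)
have orth m m' i : (m < m')%N -> \sum_j c j * Pr P (F m i `&` F m' j) = 0.
  move=> mm'; have fi := fF m m' i mm'.
  rewrite big_sumType/= (big_pred1 tt)// mulN1r L//.
  have -> : \sum_x (\row_x0 ind_set D x0) 0 x * Pr P (F m i `&` [set w | X (t m') w = x]) =
      Pr P (F m i `&` [set w | X (t m') w \in D]).
    rewrite [RHS](Pr_partition P _ (mX (t m'))); last first.
      by apply: measurableI => //; exact: (measurable_state _ [set x | x \in D]).
    apply: eq_bigr => x _; rewrite mxE /ind_set; have [xD|xD] := boolP (x \in D).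
      rewrite mul1r; congr (Pr P _); apply/seteqP; split => w /=.
        by move=> [H1 H2]; split => //; split => //; rewrite H2.
      by move=> [[]].
    rewrite mul0r (_ : _ `&` _ = set0) ?Pr0//; apply/seteqP; split => w //= [[_ wD] wx].
    by move: xD; rewrite -wx wD.
  by rewrite closed_constant// addNr.
pose S m m' := \sum_i \sum_j c i * c j * Pr P (F m i `&` F m' j).
have Slt m m' : (m < m')%N -> S m m' = 0.
  move=> mm'; apply: big1 => i _; under eq_bigr do rewrite -mulrA.
  by rewrite -mulr_sumr orth// mulr0.
have Ssym m m' : S m m' = S m' m.
  rewrite /S exchange_big/=; apply: eq_bigr => i _; apply: eq_bigr => j _.
  by rewrite setIC (mulrC (c j)).
have S0 (m m' : nat) : m != m' -> S m m' = 0.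
  case: (ltngtP m m') => // mm' _; first exact: Slt.
  by rewrite Ssym; exact: Slt.
pose B : R := \sum_i \sum_j `|c i * c j|.
have B0 : 0 <= B by do 2 (apply: sumr_ge0 => ? _).
have SB m : S m m <= B.
  apply: ler_sum => i _; apply: ler_sum => j _.
  apply: le_trans (ler_norm _) _; rewrite normrM ler_piMr//.
  rewrite ger0_norm ?Pr_ge0// -(PrT P); apply: le_Pr => //; exact: measurableI.
(* Orthogonality bounds the second moment of the total error by [N * B]. Chebyshev at level [N / 2]
   then gives probability at most [4 * B / N], which is below [e]. *)
pose N := (Num.truncn (4 * B / e)).+1.
have N0 : 0 < N%:R :> R by rewrite ltr0n.
have NB : 4 * B < e * N%:R.
  by rewrite -ltr_pdivrMl// mulrC; exact: truncnS_gt.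
(* [f] is close to [N] on [Xi] and to 0 off it, so the test cuts at [N / 2] and a wrong answer
   forces an error of at least [N / 2]. *)
pose f w := \sum_(m < N) \sum_i al i * (w \in Ev i (t m))%:R.
exists (t N), [set w | N%:R / 2 <= f w]; split.
- exact: ltW.
- have sa := obs_sigma_sa h (t N).
  have : measurable_wrt (obs_sigma (obs h X W) (t N)) f.
    apply: (wrt_sum sa) => m; apply: (wrt_sum sa) => i; apply: (wrtZ sa).
    apply: (wrt_ind sa); apply: obs_sigma_mono (oEv _ _ _) => //; exact: tS.
  move=> /(_ `[N%:R / 2, +oo[%classic (measurable_itv _)); congr (obs_sigma _ _ _).
  by apply/seteqP; split => w /=; rewrite in_itv/= andbT.
pose K := ('I_N * (unit + I))%type.
have := @chebyshev_fin _ _ _ P ('I_N * (unit + I))%type (fun k => c k.2) (fun k => F k.1 k.2) (N%:R / 2).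
have gE w : \sum_(k : K) c k.2 * (w \in F k.1 k.2)%:R = f w - N%:R * (w \in Xi)%:R.
  rewrite -(pair_bigA _ (fun (m : 'I_N) i => c i * (w \in F m i)%:R))/=.
  under eq_bigr do rewrite big_sumType/= (big_pred1 tt)// mulN1r.
  rewrite big_split/= addrC; congr (_ + _).
  by rewrite sumr_const card_ord -[LHS]mulr_natl mulrN.
move=> Ch; have {Ch}[||mEv Ch] := Ch; first by rewrite divr_ge0.
  by move=> k; exact: mF.
have tot : \sum_(k : K) \sum_(l : K) c k.2 * c l.2 * Pr P (F k.1 k.2 `&` F l.1 l.2) <=
    N%:R * B.
  rewrite -(pair_bigA _ (fun (m : 'I_N) i => \sum_(l : K) c i * c l.2 * Pr P (F m i `&` F l.1 l.2)))/=.
  rewrite mulr_natl -[X in _ *+ X]card_ord -sumr_const; apply: ler_sum => m _.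
  apply: le_trans (SB m); rewrite /S.
  under eq_bigr do rewrite -(pair_bigA _ (fun (m' : 'I_N) j =>
     c _ * c j * Pr P (F m _ `&` F m' j)))/=.
  rewrite exchange_big/= (bigD1 m)//= -[leRHS]addr0 lerD2l big1//= => m' m'm.
  by apply: S0; rewrite eq_sym.
set Bad := _ `|` _.
have sub : Bad `<=` [set w | N%:R / 2 <= `|\sum_(k : K) c k.2 * (w \in F k.1 k.2)%:R|].
  move=> w; rewrite /= gE => -[[/= Qw nXi]|[Xiw /negP]].
    by rewrite memNset// mulr0 subr0 (le_trans Qw)// ler_norm.
  rewrite -ltNge => Qw; rewrite mem_set// mulr1 -normrN opprB.
  by apply: le_trans (ler_norm _); lra.
have mQ : measurable [set w | N%:R / 2 <= f w].
  rewrite (_ : [set w | _] = f @^-1` `[N%:R / 2, +oo[%classic); last first.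
    by apply/seteqP; split => w /=; rewrite in_itv/= andbT.
  rewrite -[X in measurable X]setTI.
  have mf : measurable_fun setT f.
    apply: measurable_sum => m; apply: measurable_sum => i; apply: measurable_funM => //.
    have mE : measurable (Ev i (t m)) by exact: (mF m (inr i)).
    by have := @measurable_indic _ _ R setT _ mE.
  by apply: mf => //; exact: measurable_itv.
have mBad : measurable Bad by apply: measurableU; exact: measurableD.
have pB := le_Pr P mBad mEv sub.
rewrite ltNge; apply/negP => ep.
have : N%:R * (e * N%:R) <= N%:R * (4 * B).
  have := le_trans Ch tot.
  have := ler_wpM2l (sqr_ge0 (N%:R / 2 : R)) (le_trans ep pB).
  move: (Pr P _) => p; move: (N%:R : R) => n; nra.
by rewrite ler_pM2l// leNgt NB.
Qed.

(** * Change of initial law and the maximal inequality *)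

Section WeightedMeasure.
Variable nu : 'I_d -> R.
Hypothesis nu0 : forall x, 0 <= nu x.

(** The probability of [E] under initial law [nu], written out over the values of [X 0], on each of
    which the density is constant. *)
Definition Pw (E : set Omega) : R := \sum_x nu x / rho x * Pr P (E `&` [set w | X 0 w = x]).

Let cx_ge0 x : 0 <= nu x / rho x.
Proof. by rewrite divr_ge0// ltW. Qed.

Lemma Pw_ge0 E : 0 <= Pw E.
Proof. by apply: sumr_ge0 => x _; rewrite mulr_ge0// Pr_ge0. Qed.

Lemma le_Pw E F : measurable E -> measurable F -> E `<=` F -> Pw E <= Pw F.
Proof.
move=> mE mF EF; apply: ler_sum => x _; rewrite ler_wpM2l//.
by apply: le_Pr; [exact: measurableI|exact: measurableI|exact: setSI].
Qed.

Lemma PwU E F : measurable E -> measurable F -> E `&` F = set0 ->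
  Pw (E `|` F) = Pw E + Pw F.
Proof.
move=> mE mF EF; rewrite /Pw -big_split/=; apply: eq_bigr => x _.
rewrite -mulrDr setIUl PrU//; [exact: measurableI|exact: measurableI|].
by rewrite setIACA EF set0I.
Qed.

Lemma le_PwU E F : measurable E -> measurable F -> Pw (E `|` F) <= Pw E + Pw F.
Proof.
move=> mE mF; rewrite /Pw -big_split/=; apply: ler_sum => x _.
rewrite -mulrDr ler_wpM2l// setIUl; apply: le_PrU; exact: measurableI.
Qed.

Lemma Pw_le_Pr : exists2 C, 0 < C & forall E, measurable E -> Pw E <= C * Pr P E.
Proof.
exists (1 + \sum_x nu x / rho x); first by rewrite ltr_pwDl// sumr_ge0.
move=> E mE; apply: (@le_trans _ _ (\sum_x nu x / rho x * Pr P E)).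
  apply: ler_sum => x _; rewrite ler_wpM2l//; apply: le_Pr => //; exact: measurableI.
by rewrite -mulr_suml ler_wpM2r ?Pr_ge0// lerDr.
Qed.

Lemma cvg_Pw_nd (F : nat -> set Omega) : (forall i, measurable (F i)) ->
  (forall n m, (n <= m)%N -> F n `<=` F m) ->
  Pw (F n) @[n --> \oo] --> Pw (\bigcup_n F n).
Proof.
move=> mF nd; apply: cvg_big => [|x _]; first exact: add_continuous.
apply: cvgM; first exact: cvg_cst.
rewrite setI_bigcupl; apply: cvg_Pr_nd; first by move=> n; exact: measurableI.
by move=> n m nm; apply: setSI; exact: nd.
Qed.

Lemma Pw_null_negligible N : measurable N -> Pw N = 0 ->
  P.-negligible (N `&` [set w | 0 < dens rho nu X w]).
Proof.
move=> mN N0; pose D := [set x | 0 < nu x].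
have sub : N `&` [set w | 0 < dens rho nu X w] `<=` N `&` [set w | D (X 0 w)].
  move=> w [Nw]; rewrite /dens/= => dw; split => //; rewrite /D/=.
  by move: dw; rewrite pmulr_lgt0// invr_gt0.
apply: negligibleS sub _.
have mND : measurable (N `&` [set w | D (X 0 w)]).
  by apply: measurableI => //; exact: measurable_state.
suff ND0 : Pr P (N `&` [set w | D (X 0 w)]) = 0.
  by apply/negligibleP => //; have := PrE P mND; rewrite ND0.
rewrite (Pr_partition P mND (mX 0)) big1// => x _.
have [Dx|Dx] := pselect (D x); last first.
  rewrite (_ : _ `&` _ = set0) ?Pr0//; apply/seteqP; split => w //= [[_ Dw] wx].
  by apply: Dx; rewrite -wx.
have p0 y : true -> 0 <= nu y / rho y * Pr P (N `&` [set w | X 0 w = y]).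
  by move=> _; rewrite mulr_ge0// Pr_ge0.
have /eqP : nu x / rho x * Pr P (N `&` [set w | X 0 w = x]) = 0.
  by apply: (psumr_eq0P p0 N0).
rewrite mulf_eq0 (gt_eqF (divr_gt0 (Dx : 0 < nu x) (rho0 x)))/= => /eqP NX.
apply/eqP; rewrite eq_le Pr_ge0 andbT.
apply: (@le_trans _ _ (Pr P (N `&` [set w | X 0 w = x]))); last by rewrite NX.
apply: le_Pr.
- by apply: measurableI => //.
- exact: measurableI.
- by move=> w [[Nw _] wx].
Qed.

Lemma measurable_init (g : 'I_d -> R) : measurable_fun setT (fun w => g (X 0 w)).
Proof.
by move=> _ B mB; rewrite setTI; exact: (measurable_state 0 [set x | B (g x)]).
Qed.

Lemma integrable_dens_bounded E (f : Omega -> R) (b : R) : measurable E ->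
  measurable_fun setT f -> (forall w, `|f w| <= b) ->
  P.-integrable E (fun w => (dens rho nu X w * f w)%:E).
Proof.
move=> mE mf fb; apply: integrableS measurableT mE _ _ => //.
apply: (@measurable_bounded_integrable _ _ _ _ (fun w => dens rho nu X w * f w)) => //.
- by apply: le_lt_trans (probability_le1 P measurableT) _; rewrite ltry.
- apply: measurable_funM => //; exact: (measurable_init (fun x => nu x / rho x)).
- exists (fun_bound (fun x => nu x / rho x) * b); split; first exact: num_real.
  move=> M hM w _ /=; apply: le_trans (ltW hM); rewrite normrM ler_pM//.
  exact: (le_fun_bound (fun x => nu x / rho x)).
Qed.

Lemma integral_dens_ind E F : measurable E -> measurable F ->
  (\int[P]_(w in E) (dens rho nu X w * (w \in F)%:R)%:E)%E = (Pw (E `&` F))%:E.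
Proof.
move=> mE mF.
have mFx x : measurable (F `&` [set w | X 0 w = x]) by exact: measurableI.
have igx x : P.-integrable E (EFin \o (\1_(F `&` [set w | X 0 w = x]) : Omega -> R)).
  apply: integrableS measurableT mE _ _ => //; exact: integrable_indic.
transitivity (\int[P]_(w in E) (\sum_x (nu x / rho x)%:E *
    (EFin \o (\1_(F `&` [set w | X 0 w = x]) : Omega -> R)) w)%E)%E.
  apply: eq_integral => w _ /=.
  under eq_bigr do rewrite -EFinM.
  rewrite sumEFin; congr (_%:E).
  rewrite (bigD1 (X 0 w))//= big1 ?addr0; last first.
    move=> x xw; rewrite indicE memNset ?mulr0//= => -[_ e].
    by rewrite e eqxx in xw.
  rewrite /dens indicE; congr (_ * _%:R); congr nat_of_bool.
  by apply/idP/idP; rewrite !inE => // -[].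
rewrite integral_sum//; last by move=> x; exact: integrableZl.
rewrite /Pw -sumEFin; apply: eq_bigr => x _.
rewrite integralZl// [RHS]EFinM; congr (_ * _)%E.
rewrite /comp integral_indic// -PrE; last by apply: measurableI => //; exact: measurableI.
by congr (P _); apply/seteqP; split => w /=; tauto.
Qed.

Lemma integral_dens_affine E F (a b : R) : measurable E -> measurable F ->
  (\int[P]_(w in E) (dens rho nu X w * (a + b * (w \in F)%:R))%:E)%E =
  (a * Pw E + b * Pw (E `&` F))%:E.
Proof.
move=> mE mF.
have ig (G : set Omega) : measurable G ->
    P.-integrable E (fun w => (dens rho nu X w * (w \in G)%:R)%:E).
  move=> mG; apply: (@integrable_dens_bounded _ _ 1) => //.
    by have := @measurable_indic _ _ R setT _ mG.
  by move=> w; case: (_ \in _); rewrite ?normr1 ?normr0.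
transitivity (\int[P]_(w in E) (a%:E * (dens rho nu X w * (w \in [set: Omega])%:R)%:E +
    b%:E * (dens rho nu X w * (w \in F)%:R)%:E))%E.
  apply: eq_integral => w _; rewrite -!EFinM -EFinD in_setT/= mulr1; congr (_%:E); ring.
rewrite integralD//; [|by apply: integrableZl => //; exact: ig|by apply: integrableZl => //; exact: ig].
rewrite !integralZl//; [|exact: ig|exact: ig].
by rewrite !integral_dens_ind// setIT -!EFinM -EFinD.
Qed.

End WeightedMeasure.

Section ConditionalBounds.
Variables (h : 'I_d -> R) (nu : 'I_d -> R) (D : {set 'I_d}) (t : R) (M : Omega -> R).
Hypothesis nu0 : forall x, 0 <= nu x.
Hypothesis filt : cexp_version P (dens rho nu X) (obs_sigma (obs h X W) t)
  (fun w => ind_set D (X t w)) M.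

Let dens_ge0 w : 0 <= dens rho nu X w.
Proof. by rewrite divr_ge0// ltW. Qed.

Lemma cexp_integral E : obs_sigma (obs h X W) t E ->
  (\int[P]_(w in E) (dens rho nu X w * M w)%:E)%E =
  (Pw nu (E `&` [set w | X t w \in D]))%:E.
Proof.
move=> ZE; have mE := obs_sigma_measurable ZE.
have [_ _ ->] := filt; last exact: ZE.
rewrite -integral_dens_ind//; last exact: (measurable_state t [set x | x \in D]).
by apply: eq_integral => w _; rewrite /ind_set; congr (_ * _%:R)%:E; rewrite mem_setE.
Qed.

Lemma integrable_affine E Q a b : measurable E -> measurable Q ->
  P.-integrable E (fun w => (dens rho nu X w * (a + b * (w \in Q)%:R))%:E).
Proof.
move=> mE mQ; apply: (@integrable_dens_bounded nu _ _ (`|a| + `|b|)) => //.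
  apply: measurable_funD => //; apply: measurable_funM => //.
  by have := @measurable_indic _ _ R setT _ mQ.
move=> w; apply: le_trans (ler_normD _ _) _; rewrite lerD2l normrM ler_piMr//.
by case: (_ \in _); rewrite ?normr1 ?normr0.
Qed.

(** Integrating the pointwise bound over [E] is the only use made of the conditional expectation.
    The form a + b 1_Q covers constant thresholds ([b = 0]) and comparison with an indicator
    ([b = 1]). *)
Lemma cexp_ge E Q a b : obs_sigma (obs h X W) t E -> measurable Q ->
  (forall w, E w -> a + b * (w \in Q)%:R <= M w) ->
  a * Pw nu E + b * Pw nu (E `&` Q) <= Pw nu (E `&` [set w | X t w \in D]).
Proof.
move=> ZE mQ H; have mE := obs_sigma_measurable ZE.
rewrite -lee_fin -integral_dens_affine// -(cexp_integral ZE).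
apply: le_integral => //; first exact: integrable_affine.
- by have [_ ig _] := filt; apply: integrableS ig.
- by move=> w; rewrite inE => Ew; rewrite lee_fin ler_wpM2l// H.
Qed.

Lemma cexp_le E Q a b : obs_sigma (obs h X W) t E -> measurable Q ->
  (forall w, E w -> M w <= a + b * (w \in Q)%:R) ->
  Pw nu (E `&` [set w | X t w \in D]) <= a * Pw nu E + b * Pw nu (E `&` Q).
Proof.
move=> ZE mQ H; have mE := obs_sigma_measurable ZE.
rewrite -lee_fin -integral_dens_affine// -(cexp_integral ZE).
apply: le_integral => //; last 2 first.
- exact: integrable_affine.
- by move=> w; rewrite inE => Ew; rewrite lee_fin ler_wpM2l// H.
by have [_ ig _] := filt; apply: integrableS ig.
Qed.

End ConditionalBounds.

(** * Almost sure convergence of the filtered class probability *)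

Section Convergence.
Variables (h : 'I_d -> R) (nu : 'I_d -> R) (D : {set 'I_d}) (M : R -> Omega -> R).
Hypothesis nu0 : forall x, 0 <= nu x.
Hypotheses (cD : closed_class A D) (cDC : closed_class A (~: D)).
Hypothesis cM : forall w, {within [set t : R | 0 <= t], continuous (fun t => M t w)}.
Hypothesis filt : forall t, 0 <= t ->
  cexp_version P (dens rho nu X) (obs_sigma (obs h X W) t)
    (fun w => ind_set D (X t w)) (M t).

Let Z := obs_sigma (obs h X W).
Let Xi : set Omega := [set w | X 0 w \in D].
Let mXi : measurable Xi.
Proof. exact: (measurable_state 0 [set x | x \in D]). Qed.

Lemma Pw_class t E : 0 <= t -> measurable E ->
  Pw nu (E `&` [set w | X t w \in D]) = Pw nu (E `&` Xi).
Proof.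
rewrite le_eqVlt => /predU1P[<-//|t0 mE]; apply: eq_bigr => x _; congr (_ * _).
by rewrite [in LHS]setIAC [in RHS]setIAC closed_constant//; exact: measurableI.
Qed.

Lemma filt_ge t E Q a b : 0 <= t -> Z t E -> measurable Q ->
  (forall w, E w -> a + b * (w \in Q)%:R <= M t w) ->
  a * Pw nu E + b * Pw nu (E `&` Q) <= Pw nu (E `&` Xi).
Proof.
move=> t0 ZE mQ H; rewrite -(Pw_class t0); last exact: (obs_sigma_measurable ZE).
exact: (cexp_ge nu0 (filt t0) ZE mQ H).
Qed.

Lemma filt_le t E Q a b : 0 <= t -> Z t E -> measurable Q ->
  (forall w, E w -> M t w <= a + b * (w \in Q)%:R) ->
  Pw nu (E `&` Xi) <= a * Pw nu E + b * Pw nu (E `&` Q).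
Proof.
move=> t0 ZE mQ H; rewrite -(Pw_class t0); last exact: (obs_sigma_measurable ZE).
exact: (cexp_le nu0 (filt t0) ZE mQ H).
Qed.

Definition sdiff (Q : set Omega) : set Omega := (Q `\` Xi) `|` (Xi `\` Q).

Lemma measurable_sdiff Q : measurable Q -> measurable (sdiff Q).
Proof. by move=> mQ; apply: measurableU; exact: measurableD. Qed.

Lemma Pw_sdiff E Q : measurable E -> measurable Q ->
  Pw nu (E `&` Xi) - Pw nu (E `&` Q) <= Pw nu (E `&` sdiff Q) /\
  Pw nu (E `&` Q) - Pw nu (E `&` Xi) <= Pw nu (E `&` sdiff Q).
Proof.
move=> mE mQ; have mS := measurable_sdiff mQ.
have gen (F G : set Omega) : measurable F -> measurable G ->
    (forall w, F w -> G w \/ sdiff Q w) ->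
    Pw nu (E `&` F) - Pw nu (E `&` G) <= Pw nu (E `&` sdiff Q).
  move=> mF mG FG; rewrite lerBlDl.
  apply: le_trans (le_PwU nu0 (measurableI _ _ mE mG) (measurableI _ _ mE mS)).
  apply: (le_Pw nu0); [exact: measurableI| |].
    by apply: measurableU; exact: measurableI.
  by move=> w [Ew /FG[Gw|Sw]]; [left|right].
split; apply: gen => // w Fw.
- by have [|nQ] := pselect (Q w); [left|right; right].
- by have [|nQ] := pselect (Xi w); [left|right; left].
Qed.

(* Doob's maximal inequality for the martingale pi_t(1_D) - 1_Q, t >= T0. *)
Lemma maximal_inequality T0 Q e (u : nat -> R) n : 0 <= T0 -> Z T0 Q -> 0 < e ->
  (forall i, T0 <= u i) -> (forall i j, (i <= j)%N -> u i <= u j) ->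
  let U := [set w | exists2 i, (i < n)%N & e < `|M (u i) w - (w \in Q)%:R|] in
  Z (u n) U /\ e * Pw nu U <= 2 * Pw nu (U `&` sdiff Q).
Proof.
move=> T00 ZQ e0 uT um /=; have mQ := obs_sigma_measurable ZQ.
have mS := measurable_sdiff mQ.
have u0 i : 0 <= u i by exact: le_trans (uT i).
elim: n => [|n [ZU ih]].
  rewrite (_ : [set w | _] = set0); last by apply/seteqP; split => w //= -[].
  split; first by have [] := obs_sigma_sa h (u 0%N).
  by rewrite set0I /Pw big1 ?mulr0// => x _; rewrite set0I Pr0 mulr0.
set U := [set w | _] in ZU ih *.
(* [Cp] and [Cm] are the first exceedances at step [n], above and below. Removing [U] makes them
   disjoint from the past ones while keeping them in the observation sigma-algebra of time [u n]. *)
pose Cp := [set w | e < M (u n) w - (w \in Q)%:R] `\` U.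
pose Cm := [set w | e < (w \in Q)%:R - M (u n) w] `\` U.
have sa := obs_sigma_sa h (u n).
have ZQn : Z (u n) Q by apply: obs_sigma_mono ZQ; exact: uT.
have [mMn _ _] := filt (u0 n).
have mi : measurable_wrt (Z (u n)) (fun w => (w \in Q)%:R : R) by exact: wrt_ind.
have ZUC : Z (u n) (~` U) by exact: (saC sa).
have ZCp : Z (u n) Cp.
  rewrite /Cp setDE; apply: (saI sa) => //.
  have := wrtD sa mMn (wrtZ sa (-1) mi) => /(_ _ (measurable_itv `]e, +oo[)).
  congr (obs_sigma _ _ _); apply/seteqP; split => w /=; by rewrite in_itv/= andbT mulN1r.
have ZCm : Z (u n) Cm.
  rewrite /Cm setDE; apply: (saI sa) => //.
  have := wrtD sa mi (wrtZ sa (-1) mMn) => /(_ _ (measurable_itv `]e, +oo[)).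
  congr (obs_sigma _ _ _); apply/seteqP; split => w /=; by rewrite in_itv/= andbT mulN1r.
have mU := obs_sigma_measurable ZU.
have mCp := obs_sigma_measurable ZCp; have mCm := obs_sigma_measurable ZCm.
have UE : [set w | exists2 i, (i < n.+1)%N & e < `|M (u i) w - (w \in Q)%:R|] =
    U `|` (Cp `|` Cm).
  apply/seteqP; split => w /=.
    move=> [j]; rewrite ltnS leq_eqVlt => /predU1P[->|lin] H; last by left; exists j.
    have [|nU] := pselect (U w); [by left|right].
    move: H; rewrite ltr_normr opprB => /orP[H|H]; [left|right]; by split.
  move=> [[i lin H]|[[/= H _]|[/= H _]]]; first by exists i => //; exact: ltnW.
    by exists n => //; apply: lt_le_trans H (ler_norm _).
  by exists n => //; rewrite distrC; apply: lt_le_trans H (ler_norm _).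
have mC := measurableU _ _ mCp mCm.
rewrite UE; split.
  apply: (@obs_sigma_mono h (u n)); first exact: um.
  by apply: (saU sa) => //; exact: (saU sa).
have bp : e * Pw nu Cp <= Pw nu (Cp `&` sdiff Q).
  have H := @filt_ge (u n) Cp Q e 1 (u0 n) ZCp mQ.
  have {}H : e * Pw nu Cp + 1 * Pw nu (Cp `&` Q) <= Pw nu (Cp `&` Xi).
    by apply: H => w [/= H _]; rewrite mul1r; lra.
  by have [] := Pw_sdiff mCp mQ; lra.
have bm : e * Pw nu Cm <= Pw nu (Cm `&` sdiff Q).
  have H := @filt_le (u n) Cm Q (- e) 1 (u0 n) ZCm mQ.
  have {}H : Pw nu (Cm `&` Xi) <= - e * Pw nu Cm + 1 * Pw nu (Cm `&` Q).
    by apply: H => w [/= H _]; rewrite mul1r; lra.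
  by have [] := Pw_sdiff mCm mQ; lra.
have UC : U `&` (Cp `|` Cm) = set0.
  by apply/seteqP; split => w // [Uw [[_ /(_ Uw)]|[_ /(_ Uw)]]].
rewrite setIUl (@PwU nu _ _ mU mC UC).
rewrite (@PwU nu _ _ (measurableI _ _ mU mS) (measurableI _ _ mC mS)); last first.
  by rewrite setIACA UC set0I.
(* [Cp] and [Cm] are both compared with their union, which produces the factor 2. *)
have c1 : Pw nu (Cp `&` sdiff Q) <= Pw nu ((Cp `|` Cm) `&` sdiff Q).
  by apply: (le_Pw nu0); [exact: measurableI|exact: measurableI|apply: setSI; exact: subsetUl].
have c2 : Pw nu (Cm `&` sdiff Q) <= Pw nu ((Cp `|` Cm) `&` sdiff Q).
  by apply: (le_Pw nu0); [exact: measurableI|exact: measurableI|apply: setSI; exact: subsetUr].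
have c3 := le_PwU nu0 mCp mCm.
by nra.
Qed.

Lemma uniform_bound T0 Q e : 0 <= T0 -> Z T0 Q -> 0 < e ->
  exists B : set Omega, [/\ measurable B, e * Pw nu B <= (2 + e) * Pw nu (sdiff Q) &
    forall w, ~ B w -> forall T, T0 <= T -> `|M T w - ind_set D (X 0 w)| <= e].
Proof.
move=> T00 ZQ e0; have mQ := obs_sigma_measurable ZQ; have mS := measurable_sdiff mQ.
pose u r (i : nat) : R := T0 + dgrid 1 r i.
(* Mesh and horizon grow together: level [r] uses spacing [2 ^ - r] on an interval of length [r], so
   every dyadic time after [T0] is eventually included. *)
pose V r := [set w | exists2 i, (i < r * 2 ^ r)%N & e < `|M (u r i) w - (w \in Q)%:R|].
have uT r i : T0 <= u r i by rewrite lerDl /dgrid divr_ge0// mulr_ge0.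
have um r i j : (i <= j)%N -> u r i <= u r j.
  by move=> ij; rewrite lerD2l /dgrid ler_wpM2r ?invr_ge0// !mul1r ler_nat.
have mi r := @maximal_inequality T0 Q e (u r) (r * 2 ^ r) T00 ZQ e0 (uT r) (um r).
have mV r : measurable (V r) by have [/obs_sigma_measurable] := mi r.
have bV r : Pw nu (V r) <= 2 / e * Pw nu (sdiff Q).
  have [_ H] := mi r; rewrite mulrAC ler_pdivlMr// mulrC; apply: le_trans H _.
  by rewrite ler_pM2l//; apply: (le_Pw nu0 (measurableI _ _ (mV r) mS) mS) => w [].
have nd r k : (r <= k)%N -> V r `<=` V k.
  move=> rk w [i ir H]; exists (i * 2 ^ (k - r))%N; last first.
    by rewrite /u; have := dgrid_refine 1 r (k - r) i; rewrite subnKC// => <-.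
  apply: leq_trans (_ : r * 2 ^ r * 2 ^ (k - r) <= _)%N.
    by rewrite ltn_pmul2r// expn_gt0.
  by rewrite -mulnA -expnD subnKC// leq_mul2r rk orbT.
have mVU : measurable (\bigcup_r V r) by exact: bigcup_measurable.
have bVU : Pw nu (\bigcup_r V r) <= 2 / e * Pw nu (sdiff Q).
  by apply: (ler_cvg_to (cvg_Pw_nd mV nd) (cvg_cst _)); apply: nearW => r; exact: bV.
exists ((\bigcup_r V r) `|` sdiff Q); split; first exact: measurableU.
  apply: (@le_trans _ _ (e * (2 / e * Pw nu (sdiff Q) + Pw nu (sdiff Q)))).
    rewrite ler_pM2l//; apply: le_trans (le_PwU nu0 mVU mS) _; by rewrite lerD2r.
  by rewrite le_eqVlt; apply/orP; left; apply/eqP; field; rewrite gt_eqF.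
move=> w nB T T0T.
have Qw : (w \in Q)%:R = ind_set D (X 0 w) :> R.
  rewrite /ind_set; congr (_%:R); congr nat_of_bool; apply/idP/idP.
    move=> /set_mem Qw; apply: contrapT => nX; apply: nB; right; left; by split.
  move=> Xw; apply/mem_set; apply: contrapT => nQ; apply: nB; right; right; by split.
rewrite -Qw leNgt; apply/negP => H.
have TT : 0 <= T - T0 by rewrite subr_ge0.
have cv : M (T0 + dyadic_up 1 (T - T0) r) w @[r --> \oo] --> M T w.
  apply: (@cvg_within_ge0 _ (M^~ w) (fun r => T0 + dyadic_up 1 (T - T0) r) T) => //.
  - exact: le_trans T0T.
  - rewrite -[X in _ --> X](subrKC T0); apply: cvgD; first exact: cvg_cst.
    exact: dyadic_up_cvg.
  - by move=> r; rewrite addr_ge0// ltW// (le_lt_trans TT)// dyadic_up_gt.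
have cv' : `|M (T0 + dyadic_up 1 (T - T0) r) w - (w \in Q)%:R| @[r --> \oo] -->
    `|M T w - (w \in Q)%:R|.
  by apply: cvg_norm; apply: cvgB => //; exact: cvg_cst.
have He : 0 < `|M T w - (w \in Q)%:R| - e by rewrite subr_gt0.
have /cvgrPdist_lt/(_ _ He)[n _ Hn] := cv'.
(* [r >= n] makes the sampled value close enough to still exceed [e]; [r > T - T0 + 1] places the
   sampling point, at most one mesh beyond [T], inside the horizon of level [r]. *)
pose r := maxn n (Num.truncn (T - T0 + 1)).+1.
have := Hn r (leq_maxl _ _); rewrite /= ltr_norml => /andP[_ Hr].
apply: nB; left; exists r => //.
exists (Num.truncn ((T - T0) * (2 ^ r)%:R / 1)).+1; last first.
  by rewrite /u /dgrid; move: Hr; rewrite /dyadic_up; lra.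
have rT : T - T0 + 1 < r%:R.
  apply: lt_le_trans (truncnS_gt _) _; rewrite ler_nat; exact: leq_maxr.
rewrite -(ltr_nat R) -natr1 natrM divr1.
have p2 : 1 <= (2 ^ r)%:R :> R by rewrite ler1n expn_gt0.
have := truncn_le ((T - T0) * (2 ^ r)%:R).
rewrite mulr_ge0// => le.
apply: le_lt_trans (_ : (T - T0) * (2 ^ r)%:R + (2 ^ r)%:R < _); first exact: lerD.
by rewrite -[X in _ + X]mul1r -mulrDl ltr_pM2r// pow2_gt0.
Qed.

(** For fixed [e], ever better tests [Q] give exceptional sets of arbitrarily small weight, so their
    intersection is null; a countable choice of [e] finishes. Consistency is assumed under [P] and
    transfers to initial law [nu] because the density is bounded. *)
Lemma filter_converges_ae :
  (forall e, 0 < e -> exists (T : R) (Q : set Omega),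
    [/\ 0 <= T, Z T Q & Pr P (sdiff Q) < e]) ->
  exists2 N, P.-negligible N &
    forall w, ~ N w -> 0 < dens rho nu X w ->
      M T w @[T --> +oo] --> (ind_set D (X 0 w) : R).
Proof.
move=> consist.
have [C C0 PC] := Pw_le_Pr nu0.
have small e : 0 < e -> exists N : set Omega, [/\ measurable N, Pw nu N = 0 &
    forall w, ~ N w -> exists T0, forall T, T0 <= T ->
      `|M T w - ind_set D (X 0 w)| <= e].
  move=> e0.
  have step (j : nat) : exists B : set Omega, [/\ measurable B,
      Pw nu B <= (2 + e) / e * C * j.+1%:R^-1 &
      forall w, ~ B w -> exists T0, forall T, T0 <= T ->
      `|M T w - ind_set D (X 0 w)| <= e].
    have j0 : 0 < j.+1%:R^-1 :> R by rewrite invr_gt0.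
    have [T0 [Q [T00 ZQ PQ]]] := consist _ j0.
    have mQ := obs_sigma_measurable ZQ; have mS := measurable_sdiff mQ.
    have [B [mB bB HB]] := uniform_bound T00 ZQ e0.
    exists B; split => //; last by move=> w /HB ?; exists T0.
    have : Pw nu B <= (2 + e) / e * Pw nu (sdiff Q).
      by rewrite mulrAC ler_pdivlMr// mulrC.
    move=> /le_trans; apply; rewrite -[leRHS]mulrA ler_wpM2l//.
      by rewrite divr_ge0// ?addr_ge0// ltW.
    by apply: le_trans (PC _ mS) _; rewrite ler_pM2l// ltW.
  have [B HB] := choice step.
  exists (\bigcap_j B j); split.
  - by apply: bigcap_measurableType => j _; have [] := HB j.
  - apply/eqP; rewrite eq_le Pw_ge0// andbT.
    have c0 : (2 + e) / e * C * j.+1%:R^-1 @[j --> \oo] --> 0.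
      rewrite -[X in _ --> X](mulr0 ((2 + e) / e * C)).
      by apply: cvgM; [exact: cvg_cst|exact: cvg_harmonic].
    apply: (ler_cvg_to (cvg_cst (Pw nu (\bigcap_j B j))) c0); apply: nearW => j.
    have [mB bB _] := HB j; apply: le_trans bB; apply: (le_Pw nu0) => //.
      by apply: bigcap_measurableType => k _; have [] := HB k.
    by apply: bigcap_inf.
  - move=> w nB; have /existsNP[j /not_implyP[_ nBj]] : ~ forall j, setT j -> B j w by [].
    by have [_ _ H] := HB j; exact: H.
have h0 (k : nat) : 0 < k.+1%:R^-1 :> R by rewrite invr_gt0.
have [N HN] := choice (fun k => small _ (h0 k)).
exists (\bigcup_k (N k `&` [set w | 0 < dens rho nu X w])).
  apply: negligible_bigcup => k; have [mN N0 _] := HN k.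
  exact: (Pw_null_negligible nu0).
move=> w nN dw; apply/cvgrPdist_le => e e0.
have [k ke] : exists k : nat, k.+1%:R^-1 <= e.
  exists (Num.truncn (e^-1)); rewrite -[leRHS]invrK lef_pV2 ?posrE ?invr_gt0//.
  by rewrite ltW// truncnS_gt.
have nNk : ~ N k w by move=> Nw; apply: nN; exists k.
have [_ _ /(_ w nNk)[T0 HT]] := HN k.
exists T0; split; first exact: num_real.
by move=> T /ltW T0T; rewrite distrC; apply: le_trans (HT T T0T) ke.
Qed.

End Convergence.

(** * Unobservable signed measures *)

Section Unobservable.
Variables (h : 'I_d -> R) (V : 'M[R]_d) (w0 : 'I_d -> R).
Hypothesis cV : closed_ctrb A (\row_i h i) V.
Hypothesis w0V : forall g : 'rV[R]_d, (g <= V)%MS -> \sum_i w0 i * g 0 i = 0.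

Let V1 : ((const_mx 1 : 'rV[R]_d) <= V)%MS. Proof. by case/and3P: cV. Qed.
Let VA : (V *m A^T <= V)%MS. Proof. by case/and3P: cV. Qed.
Let Vh : (V *m diag_mx (\row_i h i) <= V)%MS. Proof. by case/and3P: cV. Qed.

(** [V] is stable under multiplication by polynomials in [h]. As [h] takes finitely many values,
    Lagrange interpolation yields the indicator of each value, and sums of these yield every level
    set. *)
Lemma ctrb_level (H : set R) (g : 'rV[R]_d) : (g <= V)%MS ->
  ((\row_x ((`[< H (h x) >])%:R * g 0 x)%R) <= V)%MS.
Proof.
move=> gV.
have prodV (s : seq R) : ((\row_x ((\prod_(b <- s) (h x - b)) * g 0 x)%R) <= V)%MS.
  elim: s => [|b s ih].
    suff -> : \row_x ((\prod_(b <- [::]) (h x - b)) * g 0 x)%R = g by [].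
    by apply/rowP => x; rewrite mxE big_nil mul1r.
  set f := \row_x _ in ih.
  suff -> : \row_x ((\prod_(b0 <- b :: s) (h x - b0)) * g 0 x)%R =
      f *m diag_mx (\row_i h i) - b *: f.
    apply: addmx_sub; first by apply: submx_trans Vh; exact: submxMr.
    by rewrite eqmx_opp; exact: scalemx_sub.
  by apply/rowP => x; rewrite mul_mx_diag !mxE big_cons; ring.
pose L := undup [seq h x | x <- enum 'I_d].
have hL x : h x \in L by rewrite mem_undup map_f// mem_enum.
have levV (a : R) : ((\row_x ((h x == a)%B%:R * g 0 x)%R) <= V)%MS.
  pose s := [seq b <- L | b != a].
  pose c := \prod_(b <- s) (a - b).
  have c0 : c != 0.
    rewrite /c prodf_seq_neq0; apply/allP => b; rewrite mem_filter => /andP[ba _] /=.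
    by rewrite subr_eq0 eq_sym.
  suff -> : \row_x ((h x == a)%B%:R * g 0 x)%R =
      c^-1 *: \row_x ((\prod_(b <- s) (h x - b)) * g 0 x)%R by exact: scalemx_sub.
  apply/rowP => x; rewrite !mxE mulrA; congr (_ * _).
  have [->|hxa] := eqVneq (h x) a; first by rewrite -/c mulVf.
  have hxs : h x \in s by rewrite mem_filter hxa hL.
  by rewrite (big_rem (h x))//= subrr mul0r mulr0.
suff -> : \row_x ((`[< H (h x) >])%:R * g 0 x)%R =
    \sum_(a <- L | `[< H a >]) \row_x ((h x == a)%B%:R * g 0 x)%R.
  by apply: summx_sub.
apply/rowP => x; rewrite summxE mxE.
rewrite big_mkcond/= (bigD1_seq (h x)) ?undup_uniq//= big1 ?addr0.
  by case: asboolP => _; rewrite ?mxE ?eqxx ?mul0r.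
by move=> a ah; case: ifP => // _; rewrite mxE eq_sym (negbTE ah) mul0r.
Qed.

Lemma ctrb_trans s (g : 'rV[R]_d) : (g <= V)%MS ->
  ((\row_x (\sum_y trans s x y * g 0 y)%R) <= V)%MS.
Proof.
move=> gV; apply: expmx_stable => //.
by rewrite linearZ/= -scalemxAr; exact: scalemx_sub.
Qed.

Lemma init_law x : Pr P [set w | X 0 w = x] = rho x.
Proof.
pose g0 : grid 0 (fun=> 0 : R) :=
  conj erefl (fun i (H : (i < 0)%N) => False_ind _ (elimF idP erefl H)).
have := cyl_path (fun=> x) g0; rewrite big_ord0 mulr1 => <-; congr (Pr P _).
by apply/seteqP; split => w; [move=> Xw; split => // -[]|case=> /(_ 0%N isT)].
Qed.

Lemma cyl_step n tt D B C z y : grid n.+1 tt -> (forall i, measurable (B i)) ->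
  measurable C -> D n `<=` [set z] ->
  Pr P (cyl n tt D B `&` ([set w | C (W (tt n.+1) w - W (tt n) w)] `&`
     [set w | X (tt n.+1) w = y])) =
  Pr P (cyl n tt D B) * (trans (tt n.+1 - tt n) z y * gauss (tt n.+1 - tt n) C).
Proof.
move=> g mB mC Dz; have g' : grid n tt.
  by case: g => t0 ti; split => // i ni; apply: ti; exact: ltnW.
have mF : measurable ([set w | C (W (tt n.+1) w - W (tt n) w)] `&`
     [set w | X (tt n.+1) w = y]).
  by apply: measurableI => //; exact: measurable_incr.
rewrite cyl_sum// -[X in Pr P X * _]setIT cyl_sum// mulr_suml.
apply: eq_bigr => q /asboolP Dq; rewrite setIT.
pose x i := if (i <= n)%N then qpath q i else y.
pose B' i := if (i < n)%N then B i else C.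
have -> : cyl n tt (pt (qpath q)) B `&` ([set w | C (W (tt n.+1) w - W (tt n) w)] `&`
     [set w | X (tt n.+1) w = y]) = cyl n.+1 tt (pt x) B'.
  apply/seteqP; split => w.
    move=> [[H1 H2] [H3 H4]]; split => i.
      rewrite leq_eqVlt ltnS => /predU1P[->|ni]; rewrite /pt /x ?ltnn//= ni.
      exact: H1.
    rewrite ltnS leq_eqVlt => /predU1P[->|ni]; rewrite /B' ?ltnn// ni.
    exact: H2.
  move=> [H1 H2]; split; split.
  - by move=> i ni; have := H1 i (leqW ni); rewrite /pt /x/= ni.
  - by move=> i ni; have := H2 i (leqW ni); rewrite /B' ni.
  - by have := H2 n (ltnSn _); rewrite /B' ltnn.
  - by have := H1 n.+1 (leqnn _); rewrite /pt /x/= ltnn.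
rewrite !cyl_law//; last by move=> i; rewrite /B'; case: ifP.
rewrite !big_ord_recr/= /x /B' leq0n leqnn !ltnn (Dz _ (Dq n (leqnn _))).
rewrite [X in _ * (X * _) * _](eq_bigr (fun i : 'I_n =>
  trans (tt i.+1 - tt i) (qpath q i) (qpath q i.+1))); last first.
  by move=> i _; rewrite (ltn_ord i) (ltnW (ltn_ord i)).
rewrite [X in _ * _ * (X * _)](eq_bigr (fun i : 'I_n => gauss (tt i.+1 - tt i) (B i))); last first.
  by move=> i _; rewrite (ltn_ord i).
by ring.
Qed.

Definition level_sets : set (set 'I_d) := [set D | exists H : set R, D = [set x | H (h x)]].

(** Backward recursion along the grid: removing the last time replaces the terminal function [g] by
    [trans] applied to [g] cut down to a level set, up to the Gaussian factor of the last increment.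
    Both operations preserve [V], and at time 0 only the orthogonality of [w0] to [V] is left. The
    recursion changes [g], hence the general terminal function. *)
Lemma unobservable_cyl n tt D B (g : 'rV[R]_d) : grid n tt ->
  (forall i, level_sets (D i)) -> (forall i, measurable (B i)) -> (g <= V)%MS ->
  \sum_y g 0 y * \sum_x w0 x / rho x *
    Pr P (cyl n tt D B `&` [set w | X 0 w = x] `&` [set w | X (tt n) w = y]) = 0.
Proof.
move=> + HD mB; elim: n g => [|n ih] g gr gV.
  have [H DH] := HD 0%N.
  have := w0V (ctrb_level H gV) => E0; rewrite -[RHS]E0.
  apply: eq_bigr => y _; rewrite mxE (bigD1 y)//= big1 ?addr0; last first.
    move=> x xy; rewrite (_ : _ `&` _ = set0) ?Pr0 ?mulr0//.
    apply/seteqP; split => w //= [[_ Xx]]; have [-> _] := gr; rewrite Xx => xy'.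
    by rewrite xy' eqxx in xy.
  have [tt0 _] := gr; rewrite tt0.
  case: asboolP => Hy.
    rewrite (_ : _ `&` _ = [set w | X 0 w = y]); last first.
      apply/seteqP; split => w /=; first by case.
      move=> Xw; split => //; split => //; split => // -[|i]// _; rewrite DH tt0/=.
      by rewrite Xw.
    rewrite init_law /= mul1r; field; by rewrite gt_eqF.
  rewrite (_ : _ `&` _ = set0) ?Pr0; first by rewrite mul0r !mulr0.
  apply/seteqP; split => w //= [[[H1 _] Xw] _]; apply: Hy.
  by have := H1 0%N isT; rewrite DH tt0/= Xw.
have gr' : grid n tt.
  by case: gr => t0 ti; split => // i ni; apply: ti; exact: ltnW.
have [H DH] := HD n.+1.
pose g1 : 'rV[R]_d := \row_x ((`[< H (h x) >])%:R * g 0 x)%R.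
pose dt := tt n.+1 - tt n.
pose g2 : 'rV[R]_d := \row_x (\sum_y trans dt x y * g1 0 y)%R.
have g2V : (g2 <= V)%MS by apply: ctrb_trans; exact: ctrb_level.
have step x y : Pr P (cyl n.+1 tt D B `&` [set w | X 0 w = x] `&` [set w | X (tt n.+1) w = y]) =
    (`[< H (h y) >])%:R * \sum_z Pr P (cyl n tt D B `&` [set w | X 0 w = x] `&`
       [set w | X (tt n) w = z]) * (trans dt z y * gauss dt (B n)).
  have cS : cyl n.+1 tt D B = cyl n tt D B `&`
      ([set w | B n (W (tt n.+1) w - W (tt n) w)] `&` [set w | D n.+1 (X (tt n.+1) w)]).
    apply/seteqP; split => w.
      move=> [H1 H2]; split; last by split; [exact: H2|exact: H1].
      by split => i ni; [apply: H1; exact: leqW|apply: H2; exact: leqW].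
    move=> [[H1 H2] [H3 H4]]; split => i.
      by rewrite leq_eqVlt ltnS => /predU1P[->|ni] //; exact: H1.
    by rewrite ltnS leq_eqVlt => /predU1P[->|ni] //; exact: H2.
  case: asboolP => Hy; last first.
    rewrite mul0r (_ : _ `&` _ = set0) ?Pr0//; apply/seteqP; split => w //= [[[H1 _] _] Xw].
    by apply: Hy; have := H1 n.+1 (leqnn _); rewrite DH/= Xw.
  rewrite mul1r.
  have mc : measurable (cyl n.+1 tt D B `&` [set w | X 0 w = x] `&` [set w | X (tt n.+1) w = y]).
    by apply: measurableI => //; apply: measurableI => //; exact: measurable_cyl.
  rewrite (Pr_partition P mc (mX (tt n))); apply: eq_bigr => z _.
  (* Absorbs the conditions on the first and current states into the cylinder, leaving a singleton
     as its last constraint, as [cyl_step] demands. For [n = 0] both fall on the same index. *)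
  pose D' i := D i `&` (if i == 0%N then [set x] else setT) `&`
                       (if i == n then [set z] else setT).
  have D'E : cyl n tt D B `&` [set w | X 0 w = x] `&` [set w | X (tt n) w = z] =
      cyl n tt D' B.
    have [tt0 _] := gr.
    apply/seteqP; split => w.
      move=> [[[H1 H2] H3] H4]; split => // i ni; split; first split.
      - exact: H1.
      - by case: eqP => // ->; rewrite tt0.
      - by case: eqP => // ->.
    move=> [H1 H2]; split; first split.
    - by split => // i ni; have [[]] := H1 i ni.
    - by have [[_ +] _] := H1 0%N (leq0n _); rewrite /= tt0.
    - by have [_] := H1 n (leqnn _); rewrite /= eqxx.
  rewrite D'E -cyl_step//; last by move=> v [_] /=; rewrite eqxx.
  rewrite -D'E cS; congr (Pr P _); apply/seteqP; split => w /=; first by tauto.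
  move=> [[[Cw X0] Xn] [Bw Xy]]; do 3 (split => //).
  by split => //; rewrite DH/= Xy.
rewrite -[RHS](mulr0 (gauss dt (B n))) -[X in _ = _ * X](ih g2 gr' g2V) mulr_sumr.
transitivity (\sum_y \sum_z \sum_x g1 0 y * (w0 x / rho x * (Pr P (cyl n tt D B `&`
   [set w | X 0 w = x] `&` [set w | X (tt n) w = z]) * (trans dt z y * gauss dt (B n))))).
  apply: eq_bigr => y _; rewrite exchange_big/= mulr_sumr; apply: eq_bigr => x _.
  rewrite step -mulr_sumr -mulr_sumr mxE; ring.
rewrite exchange_big/=; apply: eq_bigr => z _.
rewrite mxE mulr_suml mulr_sumr; apply: eq_bigr => y _.
rewrite !mulr_sumr; apply: eq_bigr => x _; ring.
Qed.

(** The constant 1 lies in [V]; used as terminal function it sums out the final state. Observation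
    events are reached because Z depends on the chain only through [h]. *)
Lemma unobservable t E : 0 < t -> obs_sigma (obs h X W) t E ->
  \sum_x w0 x / rho x * Pr P (E `&` [set w | X 0 w = x]) = 0.
Proof.
move=> t0 ZE.
have DDI : setI_closed level_sets.
  by move=> D D' [H ->] [H' ->]; exists (H `&` H').
have DDT : level_sets setT by exists setT.
apply: (@dyadic_pi_lambda level_sets t t0 DDI DDT) => //.
  move=> n D B HD mB; have gr := dgrid_grid n t0.
  have := unobservable_cyl gr HD mB V1.
  under eq_bigr do rewrite mxE mul1r.
  rewrite exchange_big/= => E0; rewrite -[RHS]E0; apply: eq_bigr => x _.
  rewrite -mulr_sumr; congr (_ * _).
  apply: Pr_partition => //; apply: measurableI => //; exact: measurable_cyl.
have sa := sigma_algebra_gen (info_gen level_sets t).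
move: E ZE; apply: smallest_sub => // E [s [B [st mB ->]]].
apply: (@obs_measurable_wrt _ _ _ _ X W rcX _ sa h t) => //.
  by move=> v vt C mC; apply: sub_sigma_algebra; exists v => //; left;
    exists [set x | C (h x)] => //; exists C.
by move=> v vt C mC; apply: sub_sigma_algebra; exists v => //; right; exists C.
Qed.

End Unobservable.

Lemma Pw_stays (nu : 'I_d -> R) (D : {set 'I_d}) t E : (forall x, 0 <= nu x) ->
  0 < t -> closed_class A D -> (forall x, nu x != 0 -> x \in D) -> measurable E ->
  Pw nu (E `&` [set w | X t w \in D]) = Pw nu E.
Proof.
move=> nu0 t0 cD supp mE; apply: eq_bigr => x _.
have [->|/supp xD] := eqVneq (nu x) 0; first by rewrite !mul0r.
congr (_ * _).
have mD : measurable [set w | X t w \in D] by exact: (measurable_state t [set x | x \in D]).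
pose N := [set w | X 0 w \in D] `&` [set w | X t w \notin D].
have mN : measurable N.
  by apply: measurableI; [exact: (measurable_state 0 [set x | x \in D])|
    exact: (measurable_state t [set x | x \notin D])].
have mED : measurable (E `&` [set w | X t w \in D] `&` [set w | X 0 w = x]).
  by apply: measurableI => //; exact: measurableI.
have mEx : measurable (E `&` [set w | X 0 w = x]) by exact: measurableI.
apply/eqP; rewrite eq_le; apply/andP; split.
  by apply: le_Pr => // w [[]].
apply: (@le_trans _ _ (Pr P ((E `&` [set w | X t w \in D] `&` [set w | X 0 w = x]) `|` N))).
  apply: le_Pr => //; first exact: measurableU.
  move=> w [Ew wx]; have [wD|wD] := boolP (X t w \in D); [by left|right].
  by split => //=; rewrite wx.
by apply: le_trans (le_PrU P mED mN) _; rewrite closed_stays// addr0.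
Qed.

(** * The two implications *)

Section Main.
Variables (h : 'I_d -> R) (pi : ('I_d -> R) -> R -> ('I_d -> R) -> Omega -> R).
Hypothesis rA : rate_matrix A.
Hypothesis wf : is_wonham_filter P rho X (obs h X W) pi.

(* The positive and negative parts of w give two initial laws, carried by disjoint
   closed sets, under which the observations have the same law; the filter started
   from their mixture therefore cannot tell the two sets apart. *)
Lemma null_functional_unstable (V : 'M[R]_d) (w : 'I_d -> R) :
  closed_ctrb A (\row_i h i) V -> (exists x, w x != 0) ->
  (forall j, \sum_i w i * A i j = 0) ->
  (forall g : 'rV[R]_d, (g <= V)%MS -> \sum_i w i * g 0 i = 0) ->
  ~ filter_stable P rho X pi.
Proof.
move=> cV [x0 wx0] wA wV st.
have w1 : \sum_x w x = 0.
  have V1 : ((const_mx 1 : 'rV[R]_d) <= V)%MS by case/and3P: cV.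
  by rewrite -[RHS](wV _ V1); apply: eq_bigr => x _; rewrite mxE mulr1.
pose p x := Num.max (w x) 0; pose q x := Num.max (- w x) 0.
have pq x : p x - q x = w x.
  by rewrite /p /q; case: (leP (w x) 0) => h1; case: (leP (- w x) 0) => h2; lra.
have p0 x : 0 <= p x by rewrite le_max lexx orbT.
have q0 x : 0 <= q x by rewrite le_max lexx orbT.
pose c := \sum_x p x.
have cq : \sum_x q x = c.
  apply/eqP; rewrite eq_sym -subr_eq0 /c -sumrB -[X in _ == X]w1; apply/eqP.
  by apply: eq_bigr => x _; exact: pq.
have c0 : 0 < c.
  rewrite lt_neqAle eq_sym sumr_ge0// andbT; apply: contra wx0 => /eqP cE.
  rewrite -pq (psumr_eq0P (fun i _ => p0 i) cE)// (psumr_eq0P (fun i _ => q0 i) (etrans cq cE))//.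
  by rewrite subrr.
(* [mu] and [nu] have disjoint supports, so absolute continuity fails between them; the mixture
   [eta] dominates both. *)
pose mu x := p x / c; pose nu x := q x / c; pose eta x := (mu x + nu x) / 2.
have mu0 x : 0 <= mu x by rewrite divr_ge0// ltW.
have nu0 x : 0 <= nu x by rewrite divr_ge0// ltW.
have eta0 x : 0 <= eta x by rewrite divr_ge0// addr_ge0.
have smu : \sum_x mu x = 1 by rewrite -mulr_suml divff// gt_eqF.
have snu : \sum_x nu x = 1 by rewrite -mulr_suml cq divff// gt_eqF.
have pmu : prob_vec mu by [].
have peta : prob_vec eta.
  by split => //; rewrite -mulr_suml big_split/= smu snu; field.
have ac : abs_cont mu eta.
  by move=> x; rewrite /eta => e0; have := mu0 x; have := nu0 x; lra.
pose D := [set x | 0 < w x]%SET; pose D' := [set x | 0 < - w x]%SET.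
have cD : closed_class A D.
  by move=> x y; rewrite !inE; exact: rate_null_pos_closed.
have cD' : closed_class A D'.
  move=> x y; rewrite !inE; apply: (rate_null_pos_closed rA (w := fun i => - w i)) => j.
  by under eq_bigr do rewrite mulNr; rewrite sumrN wA oppr0.
have muD x : mu x != 0 -> x \in D.
  rewrite inE; apply: contraNT; rewrite -leNgt => wx.
  by rewrite /mu /p max_r// mul0r.
have nuD x : nu x != 0 -> x \in D'.
  rewrite inE; apply: contraNT; rewrite -leNgt => wx.
  by rewrite /nu /q max_r// mul0r.
have etaE E : Pw eta E = (Pw mu E + Pw nu E) / 2.
  by rewrite /Pw -big_split/= mulr_suml; apply: eq_bigr => x _; rewrite /eta; ring.
(* The two filters are almost surely 1 and 1/2. The thresholds 7/8 and 5/8 lie strictly between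
   these values and leave a gap of 1/4, whose square is 1/16. *)
have lb (t : R) : 0 < t -> ((1 / 16)%:E <=
    \int[P]_v (dens rho mu X v * (pi mu t (ind_set D) v - pi eta t (ind_set D) v) ^+ 2)%:E)%E.
  move=> t0; pose f : 'I_d -> R := ind_set D; rewrite -/f.
  have fm := (wf pmu f).1 t (ltW t0); have fe := (wf peta f).1 t (ltW t0).
  pose Z := obs_sigma (obs h X W) t.
  have mZ E : Z E -> measurable E by exact: obs_sigma_measurable.
  have mDt : measurable [set v | X t v \in D].
    exact: (measurable_state t [set x | x \in D]).
  have mDt' : measurable [set v | X t v \in D'].
    exact: (measurable_state t [set x | x \in D']).
  have same E : Z E -> Pw mu E = Pw nu E.
    move=> ZE; apply/eqP; rewrite -subr_eq0 /Pw -sumrB; apply/eqP.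
    rewrite -[RHS](mulr0 c^-1) -[X in _ = _ * X](unobservable cV wV t0 ZE) mulr_sumr.
    by apply: eq_bigr => x _; rewrite -pq /mu /nu; ring.
  have nuD0 E : Z E -> Pw nu (E `&` [set v | X t v \in D]) = 0.
    move=> /mZ mE; have := Pw_stays nu0 t0 cD' nuD mE.
    have mE1 := measurableI _ _ mE mDt; have mE2 := measurableI _ _ mE mDt'.
    have dis0 : (E `&` [set v | X t v \in D]) `&` (E `&` [set v | X t v \in D']) = set0.
      apply/seteqP; split => v //= [[_]]; rewrite !inE => a [_]; lra.
    have sub : (E `&` [set v | X t v \in D]) `|` (E `&` [set v | X t v \in D']) `<=` E.
      by move=> v [[]|[]].
    have := le_Pw nu0 (measurableU _ _ mE1 mE2) mE sub; rewrite PwU//.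
    by have := Pw_ge0 nu0 (E `&` [set v | X t v \in D]); lra.
  have etaD E : Z E -> Pw eta (E `&` [set v | X t v \in D]) = Pw eta E / 2.
    move=> ZE; rewrite !etaE nuD0// -(same E)// (Pw_stays mu0 t0 cD muD (mZ _ ZE)).
    by field.
  pose G1 := [set v | pi mu t f v < 7 / 8].
  pose G2 := [set v | 5 / 8 < pi eta t f v].
  have ZG1 : Z G1.
    have [/(_ `]-oo, (7 / 8)[%classic (measurable_itv _)) + _ _] := fm.
    by congr (obs_sigma _ _ _); apply/seteqP; split => v /=; rewrite in_itv.
  have ZG2 : Z G2.
    have [/(_ `](5 / 8), +oo[%classic (measurable_itv _)) + _ _] := fe.
    by congr (obs_sigma _ _ _); apply/seteqP; split => v /=; rewrite in_itv/= andbT.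
  (* Under [mu] the conditional probability of [D] is 1, so integrating a bound 7/8 over [G1] is
     contradictory unless [G1] is null. *)
  have G10 : Pw mu G1 = 0.
    have := @cexp_le h mu D t (pi mu t f) mu0 fm G1 set0 (7 / 8) 0 ZG1 measurable0.
    rewrite (Pw_stays mu0 t0 cD muD (mZ _ ZG1)) => H.
    have {}H : Pw mu G1 <= 7 / 8 * Pw mu G1 + 0 * Pw mu (G1 `&` set0).
      by apply: H => v; rewrite /G1/= => Hv; rewrite mul0r addr0 ltW.
    by have := Pw_ge0 mu0 G1; lra.
  (* Under [eta] the conditional probability is 1/2, so [G2] is null for [eta]; it is null for [mu]
     as well because [mu] and [nu], hence [eta], agree on observation events. *)
  have G20 : Pw mu G2 = 0.
    have := @cexp_ge h eta D t (pi eta t f) eta0 fe G2 set0 (5 / 8) 0 ZG2 measurable0.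
    rewrite etaD// => H.
    have {}H : 5 / 8 * Pw eta G2 + 0 * Pw eta (G2 `&` set0) <= Pw eta G2 / 2.
      by apply: H => v; rewrite /G2/= => Hv; rewrite mul0r addr0 ltW.
    move: H; rewrite etaE -(same _ ZG2).
    by have := Pw_ge0 mu0 G2; lra.
  pose G := ~` (G1 `|` G2).
  have mG1 := mZ _ ZG1; have mG2 := mZ _ ZG2.
  have mG : measurable G by apply: measurableC; exact: measurableU.
  have PG : 1 <= Pw mu G.
    have T1 : Pw mu setT = 1.
      rewrite -smu; apply: eq_bigr => x _; rewrite setTI init_law; field.
      by rewrite gt_eqF.
    have := le_PwU mu0 mG (measurableU _ _ mG1 mG2).
    rewrite setvU T1.
    by have := le_PwU mu0 mG1 mG2; rewrite G10 G20; lra.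
  have dens0 v : 0 <= dens rho mu X v by rewrite divr_ge0// ltW.
  have mpi (g : Omega -> R) : measurable_wrt Z g -> measurable_fun setT g.
    by move=> mg _ B mB; rewrite setTI; apply: mZ; exact: mg.
  have mdens : measurable_fun setT (dens rho mu X).
    exact: (measurable_init (fun x => mu x / rho x)).
  apply: (@le_trans _ _ (0 * Pw mu setT + 1 / 16 * Pw mu (setT `&` G))%:E).
    by rewrite lee_fin setTI; lra.
  rewrite -integral_dens_affine//; apply: ge0_le_integral => //.
  - by move=> v _; rewrite lee_fin mulr_ge0// add0r mulr_ge0.
  - apply/measurable_EFinP; apply: measurable_funM => //.
    apply: measurable_funD => //; apply: measurable_funM => //.
    by have := @measurable_indic _ _ R setT _ mG.
  - apply/measurable_EFinP; apply: measurable_funM => //.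
    apply: measurable_funX; apply: measurable_funB; apply: mpi.
      by have [] := fm.
    by have [] := fe.
  - move=> v _; rewrite lee_fin ler_wpM2l// add0r.
    case: (boolP (v \in G)) => [/set_mem vG|_]; last by rewrite mulr0 sqr_ge0.
    have a1 : 7 / 8 <= pi mu t f v.
      by rewrite leNgt; apply/negP => H; apply: vG; left.
    have a2 : pi eta t f v <= 5 / 8.
      by rewrite leNgt; apply/negP => H; apply: vG; right.
    by rewrite mulr1; nra.
have := st mu eta pmu peta ac (ind_set D).
move=> cv; have : ((1 / 16)%:E <= (0 : \bar R))%E.
  apply: (cvge_to_ge cv).
  by exists 0; split; [exact: num_real|exact: lb].
by rewrite lee_fin; lra.
Qed.

Lemma stable_stabilizable : filter_stable P rho X pi -> stabilizable A h.
Proof.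
move=> st; have [V cV] := ctrb_space_exists A (\row_i h i); exists V; split => //.
have [?|nV] := boolP (V == 1%:M)%MS; [by left|right; split => //].
move=> lam eig; rewrite ltNge; apply/negP => lam0.
have [cV0 _] := cV.
have VA : (V *m A^T <= V)%MS by case/and3P: cV0.
have [w [wn0 wA wV]] := quot_eigenvalue_null_functional rA VA eig lam0.
exact: (null_functional_unstable cV0 wn0 wA wV st).
Qed.

Lemma stabilizable_filter_cvg (mu nu : 'I_d -> R) (D : {set 'I_d}) :
  stabilizable A h -> closed_class A D -> closed_class A (~: D) ->
  prob_vec nu -> abs_cont mu nu ->
  ae_under P rho mu X (fun w =>
    pi nu T (ind_set D) w @[T --> +oo] --> (ind_set D (X 0 w) : R)).
Proof.
move=> st cD cDC pnu ac; have [nu0 _] := pnu.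
have [V cV DV] := closed_ind_ctrb rA cD cDC st.
have cons := class_consistent cD cDC (ctrb_estimable cV DV).
have [filt cM] := wf pnu (ind_set D).
have [N nN HN] := @filter_converges_ae h nu D (fun t => pi nu t (ind_set D)) nu0 cD cDC cM filt cons.
apply: negligibleS nN => w nw; apply: contrapT => nNw; apply: nw => dw; apply: HN => //.
rewrite /dens divr_gt0// lt_neqAle nu0 andbT eq_sym; apply/eqP => /ac mu0.
by move: dw; rewrite /dens mu0 mul0r ltxx.
Qed.

End Main.

End Model.

Theorem theorem1 (R : realType) (d m : nat) (A : 'M[R]_d) (h : 'I_d -> R)
    (Rv : R) (cls : 'I_d -> 'I_m)
    (dis : measure_display) (Omega : measurableType dis)
    (P : probability Omega R) (rho : 'I_d -> R)
    (X : R -> Omega -> 'I_d) (W : R -> Omega -> R)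
    (pi : ('I_d -> R) -> R -> ('I_d -> R) -> Omega -> R) :
  rate_matrix A ->
  (forall k : 'I_m, exists x : 'I_d, cls x = k) ->
  (forall k : 'I_m, closed_class A [set x | cls x == k]%SET) ->
  (forall k : 'I_m, irreducible_class A [set x | cls x == k]%SET) ->
  0 < Rv ->
  prob_vec rho -> (forall x, 0 < rho x) ->
  wonham_model P A Rv rho X W ->
  is_wonham_filter P rho X (obs h X W) pi ->
  (filter_stable P rho X pi -> stabilizable A h) /\
  (stabilizable A h ->
   forall mu nu : 'I_d -> R, prob_vec mu -> prob_vec nu -> abs_cont mu nu ->
   forall k : 'I_m,
     ae_under P rho mu X (fun w =>
       pi nu T (ind_set [set x | cls x == k]%SET) w @[T --> +oo] -->
         ind_set [set x | cls x == k]%SET (X 0 w))).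
Proof.
move=> rA _ clD _ Rv0 _ rho0 model wf; split.
  exact: (stable_stabilizable model Rv0 rho0 rA wf).
move=> st mu nu _ pnu ac k.
apply: (stabilizable_filter_cvg model Rv0 rho0 rA wf) => // x y.
(* The complement of a class is closed because the class of [x], itself closed, does not contain
   [y]. *)
rewrite !inE negbK => xk /eqP yk.
by apply: (clD (cls x)); rewrite inE // yk eq_sym.
Qed.
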